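(* Let $A$ be a noetherian equidimensional local ring of positive dimension. Suppose that $A$ is catenary and that the regular locus of $\operatorname{Spec}A$ contains a dense open subset of $\operatorname{Spec}A$. Then $n(A)=\gamma(A)$.
   Context: $A$ is equidimensional if $\dim A/\mathfrak p=\dim A$ for every minimal prime $\mathfrak p$. Definition of $\gamma(A)$: for a noetherian local ring $(A,\mathfrak m)$ of dimension $d$ and an $\mathfrak m$-primary ideal $Q$, the Hilbert-Samuel multiplicity $e(Q,A)$ is $d!$ times the coefficient of $n^d$ in the polynomial which agrees with $\ell_A(A/Q^n)$ for large $n$. $\gamma(A)$ is the greatest common divisor of all the $e(Q,A)$, over all $\mathfrak m$-primary ideals $Q$ of $A$. Definition of $n(A)$: let $(A,\mathfrak m)$ be a noetherian local ring of positive dimension, and let $x_0$ be the closed point of $\operatorname{Spec}A$. For a dense open subset $U$ of $\operatorname{Spec}A$, let $\mathcal N_U$ be the set of all integers of the form $\operatorname{ord}_{x_0}(f)$, where $C$ is a reduced closed one-dimensional subscheme of $\operatorname{Spec}A$ all of whose generic points lie in $U$, and $f$ is an invertible element of the total ring of fractions of $\mathcal O(C)$; here $\operatorname{ord}_{x_0}(a/b)=\ell(\mathcal O(C)/(a))-\ell(\mathcal O(C)/(b))$ for regular elements $a,b$ of $\mathcal O(C)$. Each $\mathcal N_U$ is an ideal of $\mathbb Z$, and the intersection $\mathcal N=\bigcap_U\mathcal N_U$ over all dense open subsets $U$ is a non-zero ideal; $n(A)$ is its positive generator. *)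

(* Defs.v *)
From HB Require Import structures.
From mathcomp Require Import all_boot all_order all_algebra generic_quotient.
From mathcomp Require Import ring_quotient.
From mathcomp Require Import boolp classical_sets topology_structure.

Set Implicit Arguments.
Unset Strict Implicit.
Unset Printing Implicit Defensive.

Import Order.TTheory GRing.Theory Num.Theory.
Local Open Scope classical_set_scope.
Local Open Scope ring_scope.

(* Ideals come in two library flavours: [idealr R] (proper ideals) and         *)
(* [submodClosed R^o] (all ideals, as submodules of the regular module).       *)

Definition proper_subpred (T : Type) (S S' : {pred T}) : bool :=
  `[< {subset S <= S'} /\ ~ {subset S' <= S} >].

(* The largest n such that there is a chain x_0 < ... < x_n; the value is 0    *)
(* when there is no largest n.                                                 *)
Definition max_chain_length (K : Type) (lt : rel K) : nat :=
  xget 0%N [set n | (exists c : seq K, sorted lt c /\ size c = n.+1) /\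
                    (forall c : seq K, sorted lt c -> (size c <= n.+1)%N)].

(* The greatest common divisor of a possibly infinite set of naturals; it      *)
(* always exists, the gcd of the empty set being 0.                            *)
Definition gcd_set (S : set nat) : nat :=
  xget 0%N [set g | (forall x, S x -> (g %| x)%N) /\
                    (forall d, (forall x, S x -> (d %| x)%N) -> (d %| g)%N)].

Section SubmodQuotient.
Variables (R : pzRingType) (M : lmodType R) (N : submodClosed M).

Lemma submod_zmod_closed : zmod_closed N.
Proof. exact: GRing.submod_closedB (submodClosedP N). Qed.

Definition submod_zmod : zmodClosed M :=
  HB.pack (GRing.SubmodClosed.sort N)
    (GRing.isZmodClosed.Build M (GRing.SubmodClosed.sort N)
       submod_zmod_closed).

Definition mod_quot : Type := Quotient.quot submod_zmod.

HB.instance Definition _ := GRing.Zmodule.on mod_quot.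

Local Notation "[pi x ]" := (\pi_(Quotient.quot submod_zmod)%qT x : mod_quot).

Definition quot_scale (a : R) (x : mod_quot) : mod_quot :=
  [pi a *: repr (x : Quotient.quot submod_zmod)].

Lemma pi_scale a (x : M) : quot_scale a [pi x] = [pi a *: x].
Proof.
apply/eqP; rewrite /quot_scale -Quotient.idealrBE -scalerBr.
have rN y : y \in (N : {pred M}) -> a *: y \in submod_zmod.
  by move=> yN; rewrite -[_ \in _]/(_ \in (N : {pred M})) rpredZ.
apply: rN; rewrite -[_ \in _]/(_ \in submod_zmod).
by rewrite Quotient.idealrBE reprK.
Qed.

Lemma piD (x y : M) : [pi x + y] = [pi x] + [pi y].
Proof. exact: (raddfD \pi_(Quotient.quot submod_zmod)%qT). Qed.

Lemma pi_surj (x : mod_quot) : exists y, x = [pi y].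
Proof. by exists (repr (x : Quotient.quot submod_zmod)); rewrite reprK. Qed.

Lemma quot_scaleA a b x : quot_scale a (quot_scale b x) = quot_scale (a * b) x.
Proof. by have [y ->] := pi_surj x; rewrite !pi_scale scalerA. Qed.

Lemma quot_scale1 : left_id 1 quot_scale.
Proof. by move=> x; have [y ->] := pi_surj x; rewrite pi_scale scale1r. Qed.

Lemma quot_scaleDr : right_distributive quot_scale +%R.
Proof.
move=> a x y; have [x' ->] := pi_surj x; have [y' ->] := pi_surj y.
by rewrite -piD !pi_scale scalerDr piD.
Qed.

Lemma quot_scaleDl x : {morph quot_scale^~ x : a b / a + b}.
Proof. by move=> a b; have [y ->] := pi_surj x; rewrite !pi_scale scalerDl piD. Qed.

HB.instance Definition _ := GRing.Zmodule_isLmodule.Build R mod_quot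
  quot_scaleA quot_scale1 quot_scaleDr quot_scaleDl.

End SubmodQuotient.

Section GeneratedSubmodule.
Variables (R : pzRingType) (M : lmodType R) (E : set M).

Definition gen : M -> bool :=
  fun x => `[< forall N : submodClosed M, (forall y, E y -> y \in N) -> x \in N >].

Lemma gen_submod_closed : submod_closed gen.
Proof.
split=> [|a x y /asboolP Ex /asboolP Ey].
  by apply/asboolP => N _; rewrite rpred0.
by apply/asboolP => N EN; rewrite rpredD ?rpredZ ?Ex ?Ey.
Qed.

HB.instance Definition _ := GRing.isSubmodClosed.Build R M gen gen_submod_closed.

End GeneratedSubmodule.

Section Zariski.
Variable R : comNzRingType.

HB.instance Definition _ := gen_eqMixin (prime_idealr R).
HB.instance Definition _ := gen_choiceMixin (prime_idealr R).

Definition zariski_open (U : set (prime_idealr R)) : Prop :=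
  exists E : set R, U = [set p : prime_idealr R | exists2 x, E x & x \notin p].

Lemma zariski_openT : zariski_open setT.
Proof.
exists [set 1]; apply/seteqP; split=> // p _.
by exists 1 => //; rewrite (idealr1 p).
Qed.

Lemma zariski_openI : setI_closed zariski_open.
Proof.
move=> _ _ [E ->] [F ->]; exists [set z | exists x y, [/\ E x, F y & z = x * y]].
apply/seteqP; split=> p /=.
  move=> [[x Ex xp] [y Fy yp]]; exists (x * y); first by exists x, y.
  by rewrite prime_idealrM negb_or xp.
move=> [_ [x [y [Ex Fy ->]]]]; rewrite prime_idealrM negb_or => /andP[xp yp].
by split; [exists x | exists y].
Qed.

Lemma zariski_open_bigcup (I : Type) (f : I -> set (prime_idealr R)) :
  (forall i, zariski_open (f i)) -> zariski_open (\bigcup_i f i).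
Proof.
move=> /choice[E fE]; exists (\bigcup_i E i); apply/seteqP; split=> p /=.
  by move=> [i _]; rewrite fE => -[x Ex xp]; exists x => //; exists i.
by move=> [x [i _ Ex] xp]; exists i => //; rewrite fE; exists x.
Qed.

HB.instance Definition _ := isOpenTopological.Build (prime_idealr R)
  zariski_openT zariski_openI zariski_open_bigcup.

End Zariski.

Notation Spec R := (prime_idealr R).

Definition mod_length (R : pzRingType) (M : lmodType R) : nat :=
  max_chain_length (fun N N' : submodClosed M => proper_subpred N N').

Definition ideal_gen (R : pzRingType) (E : set R) : submodClosed R^o :=
  GRing.SubmodClosed.clone R R^o (@gen R R^o E) _.

Section Rings.
Variable R : comNzRingType.
Implicit Types (m I Q : idealr R) (p q : Spec R).

Definition krull_dim : nat :=
  max_chain_length (fun p q : Spec R => proper_subpred p q).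

Definition noetherian : Prop :=
  forall N : submodClosed R^o,
    exists s : seq R, N =i ideal_gen [set x : R | x \in s].

Definition maximal_ideal m : Prop :=
  forall I, {subset m <= I} -> {subset I <= m}.

Definition local_ring m : Prop :=
  maximal_ideal m /\ forall m', maximal_ideal m' -> m' =i m.

Definition regular_local_ring : Prop :=
  noetherian /\ exists2 m, local_ring m &
    exists t : krull_dim.-tuple R, m =i ideal_gen [set x : R | x \in t].

Definition reduced_ring : Prop := forall (x : R) n, x ^+ n = 0 -> x = 0.

Definition regular_element (a : R) : Prop := forall x, a * x = 0 -> x = 0.

Definition minimal_prime p : Prop :=
  forall q, {subset q <= p} -> {subset p <= q}.

Definition covers p q : bool :=
  `[< proper_subpred p q /\
      ~ exists r : Spec R, proper_subpred p r /\ proper_subpred r q >].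

(* [p :: c] is a chain of primes from p to q whose length is [size c].         *)
Definition catenary : Prop :=
  forall p q, {subset p <= q} ->
    (exists n, forall c : seq (Spec R),
       path (fun p q : Spec R => proper_subpred p q) p c -> last p c = q ->
       (size c <= n)%N) /\
    (forall c c' : seq (Spec R),
       path covers p c -> last p c = q -> path covers p c' -> last p c' = q ->
       size c = size c').

Definition is_localization (S : set R) (L : comUnitRingType)
    (j : {rmorphism R -> L}) : Prop :=
  [/\ forall s, S s -> j s \is a GRing.unit,
      forall y, exists x s, S s /\ y = j x / j s &
      forall x, j x = 0 -> exists2 s, S s & s * x = 0].

Definition colength (a : R) : nat :=
  mod_length (mod_quot (ideal_gen [set a])).

(* n is the order ord(f) of the element f of the total ring of fractions L.    *)
Definition has_ord (L : comUnitRingType) (j : {rmorphism R -> L}) (f : L)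
    (n : int) : Prop :=
  exists a b, [/\ regular_element a, regular_element b, f = j a / j b &
                  n = (colength a)%:Z - (colength b)%:Z].

Definition ideal_power I (n : nat) : submodClosed R^o :=
  ideal_gen [set x | exists t : n.-tuple R,
                     {subset t <= I} /\ x = \prod_(y <- t) y].

Definition primary_to m Q : Prop :=
  (forall x y, x * y \in Q -> x \in Q \/ exists n, y ^+ n \in Q) /\
  (forall x, x \in m <-> exists n, x ^+ n \in Q).

Definition multiplicity Q : nat :=
  xget 0%N [set e | exists P : {poly rat},
    (exists n0, forall n, (n0 <= n)%N ->
       P.[n%:R] = (mod_length (mod_quot (ideal_power Q n)))%:R) /\
    e%:R = (krull_dim`!)%:R * P`_krull_dim].

(* gamma(R), for R local with maximal ideal m. *)
Definition gamma_inv m : nat :=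
  gcd_set [set multiplicity Q | Q in primary_to m].

End Rings.

Section Spectrum.
Variable A : comNzRingType.
Implicit Types (p q : Spec A) (I : idealr A) (U : set (Spec A)).

Definition equidimensional : Prop :=
  forall p, minimal_prime p -> krull_dim {ideal_quot p} = krull_dim A.

Definition regular_locus : set (Spec A) :=
  [set p | exists (L : comUnitRingType) (j : {rmorphism A -> L}),
     is_localization [set x | x \notin p] j /\ regular_local_ring L].

Definition generic_point I p : Prop :=
  {subset I <= p} /\
  forall q, {subset I <= q} -> {subset q <= p} -> {subset p <= q}.

(* The closed subscheme C is the one defined by I, so that O(C) = A / I. *)
Definition ord_values U : set int :=
  [set n | exists I,
     [/\ reduced_ring {ideal_quot I}, krull_dim {ideal_quot I} = 1%N,
         forall p, generic_point I p -> U p &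
         exists (L : comUnitRingType) (j : {rmorphism {ideal_quot I} -> L}),
           is_localization (@regular_element {ideal_quot I}) j /\
           exists2 f : L, f \is a GRing.unit & has_ord j f n]].

(* The value is 0 when the intersection is not a non-zero ideal of int. *)
Definition n_inv : nat :=
  xget 0%N [set n | (0 < n)%N /\
    \bigcap_(U in [set U | open U /\ dense U]) ord_values U =
      [set z | (n%:Z %| z)%Z]].

End Spectrum.

(* Main.v *)
(* The bridge between gamma(A) and n(A) is the set of integral curves V(q) through the
closed point, with the orders ord_q(g) = length of A / (q, g).

   Every e(Q) is an integral combination of such orders, along curves avoiding any
given proper closed set.  Choosing general elements f_1, ..., f_d of Q^k_1, ..., Q^k_d
whose classes are parameters of the associated graded ring of Q, the multiplicity
symbol of Northcott and Wright satisfies e(f_1, ..., f_d) = k_1 ... k_d e(Q).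
Computing it one element at a time, e(f_1, ..., f_d) is the sum over the curves V(q)
inside V(f_1, ..., f_(d-1)) of ord_q(f_d) e(f_1, ..., f_(d-1); A_q).  General
elements exist in degrees k_i which are powers of any t > 1, and using t = 2 and t = 3
removes the factor k_1 ... k_d.

   Conversely let V(p) be a curve through the regular locus.  As A is catenary and
equidimensional, p has height d - 1, so that p A_p is generated by d - 1 elements of p,
which can be moved to a part f' of a system of parameters.  Given a outside p, suitable
g_1 and g_2 that agree up to the factor a on V(p), and agree on the other components of
V(f'), yield ord_p(a) = e(f', g_1) - e(f', g_2).

   Finally the order of a rational function on a reduced union of curves is the sum of
its orders on the components. *)
From HB Require Import structures.
Require Import Defs.
From mathcomp Require Import all_boot all_order all_algebra.
From mathcomp Require Import ring_quotient generic_quotient.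
From mathcomp Require Import boolp classical_sets topology_structure.
From mathcomp Require Import zify lra.

Set Implicit Arguments.
Unset Strict Implicit.
Unset Printing Implicit Defensive.

Import Order.TTheory GRing.Theory Num.Theory.
Local Open Scope classical_set_scope.
Local Open Scope ring_scope.

(** * Ideals and prime filtrations *)

(** The argument works with pairs of ideals instead of modules. A module I / J, graded or not, is
    the pair (I, J); the kernel and cokernel of multiplication by f are again pairs, ((J : f) cap I,
    J) and (I, f I + J). Localizing at a prime only changes which inclusions count as strict, so one
    theory of lengths serves A and every A_q.

    The obstacle is that the residue field may be finite, so general elements of degree one need not
    exist. Homogeneous prime avoidance succeeds only in large degrees; this is the origin of the
    factor k_1 ... k_d. Hilbert functions over generators of such degrees are only quasi-polynomial,
    whence the systematic use of orders of growth.

    The complement V(b) of a dense open set has dimension at most d - 1. Hence d - 1 elements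
    general for both A and V(b) cut out curves that meet V(b) in the closed point only.

    Regularity at p enters as multiplicity one: the symbol of d - 1 generators of p A_p is at most
    the length 1 of A_p / p A_p, and it is not zero because p has height d - 1. *)

Section AscendingChains.
Variables (T : Type) (le : T -> T -> Prop).

(** Asking for one non-strict step, rather than for stabilization, suits preorders and is all that
    the inductions use. *)
Definition acc :=
  forall F : nat -> T, (forall n, le (F n) (F n.+1)) -> exists n, le (F n.+1) (F n).

Lemma acc_ind (Phi : T -> Prop) : acc ->
  (forall x, (forall y, le x y -> ~ le y x -> Phi y) -> Phi x) -> forall x, Phi x.
Proof.
move=> accT step; apply: contrapT => /existsNP[x0 nx0].
have next (x : {x | ~ Phi x}) : exists y : {x | ~ Phi x},
    le (sval x) (sval y) /\ ~ le (sval y) (sval x).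
  case: x => x nx /=; apply: contrapT => nex; apply: (nx); apply: step => y lxy nyx.
  by apply: contrapT => ny; apply: nex; exists (exist _ y ny).
have [g gP] := choice next.
have [n|n] := accT (fun n => sval (iter n g (exist _ x0 nx0))).
  by have [] := gP (iter n g (exist _ x0 nx0)).
by have [_] := gP (iter n g (exist _ x0 nx0)).
Qed.

Lemma acc_max (P : T -> Prop) : (forall x, le x x) ->
  (forall x y z, le x y -> le y z -> le x z) -> acc ->
  (exists x, P x) -> exists x, P x /\ forall y, P y -> le x y -> le y x.
Proof.
move=> lexx letr accT [x Px]; move: x Px.
apply: (acc_ind accT) => x IH Px.
have [[y [Py lxy nyx]]|nex] := pselect (exists y, [/\ P y, le x y & ~ le y x]).
  exact: IH Py.
exists x; split=> // y Py lxy; apply: contrapT => nyx.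
by apply: nex; exists y.
Qed.

End AscendingChains.

(** A third flavour of ideals: predicates in [Prop], the whole ring included, whose equality is
    mutual inclusion ([ideal_eq]), so that identities between sums, colons and products can be
    rewritten. *)
Record ideal (A : comNzRingType) := Ideal {
  icar :> A -> Prop;
  id0 : icar 0;
  idD : forall x y, icar x -> icar y -> icar (x + y);
  idM : forall a x, icar x -> icar (a * x) }.

Arguments icar : simpl never.
HB.instance Definition _ (A : comNzRingType) := gen_eqMixin (ideal A).
HB.instance Definition _ (A : comNzRingType) := gen_choiceMixin (ideal A).

Section Ideals.
Variable A : comNzRingType.
Implicit Types (I J K : ideal A) (x y z a b : A).

Lemma idMr I x a : I x -> I (x * a). Proof. by rewrite mulrC; apply: idM. Qed.
Lemma idN I x : I x -> I (- x). Proof. by rewrite -mulN1r; apply: idM. Qed.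
Lemma idB I x y : I x -> I y -> I (x - y).
Proof. by move=> Ix /idN; apply: idD. Qed.

Lemma idDl I x y : I y -> I (x + y) -> I x.
Proof. by move=> Iy /idB/(_ Iy); rewrite addrK. Qed.

Lemma id_sum I (X : Type) (r : seq X) (P : pred X) (F : X -> A) :
  (forall i, P i -> I (F i)) -> I (\sum_(i <- r | P i) F i).
Proof. by move=> IF; apply: big_ind => //; [exact: id0|exact: idD]. Qed.

Definition ile I J := forall x, I x -> J x.
Local Notation "I <=i J" := (ile I J) (at level 70).

Lemma ideal_eq I J : I <=i J -> J <=i I -> I = J.
Proof.
case: I J => [I I0 ID IM] [J J0 JD JM] IJ JI.
have E : I = J by apply/funext => x; apply/propext; split; [apply: IJ|apply: JI].
by case: _ / E J0 JD JM {IJ JI} => *; f_equal; apply: Prop_irrelevance.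
Qed.

Lemma ile_refl I : I <=i I. Proof. by []. Qed.
Lemma ile_trans I J K : I <=i J -> J <=i K -> I <=i K.
Proof. by move=> IJ JK x /IJ/JK. Qed.

Definition itop : ideal A.
Proof. by exists (fun=> True). Defined.
Definition ibot : ideal A.
Proof.
exists (fun x => x = 0) => // [x y -> ->|a x ->]; by rewrite (addr0, mulr0).
Defined.

Definition isum I J : ideal A.
Proof.
exists (fun z => exists x y, [/\ I x, J y & z = x + y]).
- by exists 0, 0; split; [exact: id0|exact: id0|rewrite addr0].
- move=> _ _ [x [y [Ix Jy ->]]] [x' [y' [Ix' Jy' ->]]].
  by exists (x + x'), (y + y'); split; [exact: idD|exact: idD|rewrite addrACA].
- move=> a _ [x [y [Ix Jy ->]]].
  by exists (a * x), (a * y); split; [exact: idM|exact: idM|rewrite mulrDr].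
Defined.

Definition icap I J : ideal A.
Proof.
exists (fun z => I z /\ J z) => [|x y [? ?] [? ?]|a x [? ?]].
- by split; apply: id0.
- by split; apply: idD.
- by split; apply: idM.
Defined.

Definition imul a I : ideal A.
Proof.
exists (fun z => exists2 x, I x & z = a * x).
- by exists 0; rewrite ?mulr0//; apply: id0.
- move=> _ _ [x Ix ->] [y Iy ->]; exists (x + y); rewrite ?mulrDr//; exact: idD.
- move=> b _ [x Ix ->]; exists (b * x); [exact: idM|exact: mulrCA].
Defined.

Definition icolon I a : ideal A.
Proof.
exists (fun z => I (a * z)) => [|x y Ix Iy|b x Ix].
- by rewrite mulr0; apply: id0.
- by rewrite mulrDr; apply: idD.
- by rewrite mulrCA; apply: idM.
Defined.

(** The intersection of all ideals containing the products, so that no finite sums occur. The lock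
    below keeps this quantification over ideals from being unfolded. *)
Definition iprod_def I J : ideal A.
Proof.
exists (fun z => forall K, (forall x y, I x -> J y -> K (x * y)) -> K z).
- by move=> K _; apply: id0.
- by move=> x y Hx Hy K HK; apply: idD; [apply: Hx|apply: Hy].
- by move=> a x Hx K HK; apply: idM; apply: Hx.
Defined.

Fact iprod_key : unit. Proof. exact: tt. Qed.
Definition iprod I J := locked_with iprod_key (iprod_def I J).
Lemma iprodE I J z :
  iprod I J z <-> forall K, (forall x y, I x -> J y -> K (x * y)) -> K z.
Proof. by rewrite /iprod unlock. Qed.

Definition ipr a := imul a itop.

Lemma icolonE I a x : icolon I a x = I (a * x). Proof. by []. Qed.

Local Notation "I +i J" := (isum I J) (at level 50, left associativity).
Local Notation "I &i J" := (icap I J) (at level 48, left associativity).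

Lemma ile_top I : I <=i itop. Proof. by []. Qed.
Lemma ile_bot I : ibot <=i I. Proof. by move=> x ->; apply: id0. Qed.
Lemma ile_addl I J : I <=i I +i J.
Proof. by move=> x Ix; exists x, 0; rewrite addr0; split=> //; apply: id0. Qed.
Lemma ile_addr I J : J <=i I +i J.
Proof. by move=> x Ix; exists 0, x; rewrite add0r; split=> //; apply: id0. Qed.
Lemma ile_add I J K : I <=i K -> J <=i K -> I +i J <=i K.
Proof. by move=> IK JK _ [x [y [/IK Kx /JK Ky ->]]]; apply: idD. Qed.
Lemma ile_addlW I J K : I <=i J -> I <=i J +i K.
Proof. by move=> IJ; apply: ile_trans IJ _; apply: ile_addl. Qed.
Lemma ile_addrW I J K : I <=i K -> I <=i J +i K.
Proof. by move=> IK; apply: ile_trans IK _; apply: ile_addr. Qed.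
Lemma isumS I J I' J' : I <=i I' -> J <=i J' -> I +i J <=i I' +i J'.
Proof.
move=> II JJ; apply: ile_add; first exact: ile_trans (@ile_addl _ _).
exact: ile_trans (@ile_addr _ _).
Qed.
Lemma isumC I J : I +i J = J +i I.
Proof. by apply: ideal_eq; apply: ile_add; do ?[exact: ile_addl|exact: ile_addr]. Qed.
Lemma isum_idl I J : I <=i J -> I +i J = J.
Proof. by move=> IJ; apply: ideal_eq; [apply: ile_add|apply: ile_addr]. Qed.
Lemma isum_idr I J : J <=i I -> I +i J = I.
Proof. by move=> IJ; rewrite isumC isum_idl. Qed.
Lemma isumA I J K : I +i (J +i K) = (I +i J) +i K.
Proof.
apply: ideal_eq.
  apply: ile_add; first exact: ile_trans (@ile_addl _ _) (@ile_addl _ _).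
  by apply: isumS => //; apply: ile_addr.
apply: ile_add; last exact: ile_trans (@ile_addr _ _) (@ile_addr _ _).
by apply: isumS => //; apply: ile_addl.
Qed.

Lemma ile_capl I J : I &i J <=i I. Proof. by move=> x []. Qed.
Lemma ile_capr I J : I &i J <=i J. Proof. by move=> x []. Qed.
Lemma ile_cap I J K : K <=i I -> K <=i J -> K <=i I &i J.
Proof. by move=> KI KJ x Kx; split; [apply: KI|apply: KJ]. Qed.
Lemma icap_idl I J : I <=i J -> I &i J = I.
Proof. by move=> IJ; apply: ideal_eq => [x []//|x Ix]; split=> //; apply: IJ. Qed.
Lemma icap_idr I J : J <=i I -> I &i J = J.
Proof. by move=> IJ; apply: ideal_eq => [x []//|x Ix]; split=> //; apply: IJ. Qed.
Lemma icapC I J : I &i J = J &i I.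
Proof. by apply: ideal_eq => x [? ?]; split. Qed.
Lemma icapS I J I' J' : I <=i I' -> J <=i J' -> I &i J <=i I' &i J'.
Proof. by move=> II JJ x [/II ? /JJ ?]; split. Qed.

Lemma imulS a I J : I <=i J -> imul a I <=i imul a J.
Proof. by move=> IJ _ [x /IJ Jx ->]; exists x. Qed.
Lemma imul_le a I : imul a I <=i I.
Proof. by move=> _ [x Ix ->]; apply: idM. Qed.
Lemma imulD a I J : imul a (I +i J) = imul a I +i imul a J.
Proof.
apply: ideal_eq.
  move=> _ [_ [x [y [Ix Jy ->]]] ->]; exists (a * x), (a * y).
  by split; [exists x|exists y|rewrite mulrDr].
by apply: ile_add; apply: imulS; [apply: ile_addl|apply: ile_addr].
Qed.
Lemma imulA a b I : imul a (imul b I) = imul (a * b) I.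
Proof.
apply: ideal_eq => [_ [_ [x Ix ->] ->]|_ [x Ix ->]].
  by exists x; rewrite ?mulrA.
by exists (b * x); rewrite ?mulrA//; exists x.
Qed.
Lemma imul1 I : imul 1 I = I.
Proof. by apply: ideal_eq => [_ [x Ix ->]|x Ix]; [|exists x]; rewrite ?mul1r. Qed.
Lemma imul_top_le a I : I a -> ipr a <=i I.
Proof. by move=> Ia _ [x _ ->]; apply: idMr. Qed.
Lemma ipr_in a : ipr a a. Proof. by exists 1; rewrite ?mulr1. Qed.
Lemma imulP a I J : (imul a I <=i J) <-> (forall x, I x -> J (a * x)).
Proof. by split=> [H x Ix|H _ [x Ix ->]]; apply: H => //; exists x. Qed.

Lemma icolon_le I a : I <=i icolon I a. Proof. by move=> x; apply: idM. Qed.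
Lemma icolonS I J a : I <=i J -> icolon I a <=i icolon J a.
Proof. by move=> IJ x /IJ. Qed.

Lemma iprod_in I J x y : I x -> J y -> iprod I J (x * y).
Proof. by move=> Ix Jy; apply/iprodE => K; apply. Qed.
Lemma iprod_le I J K : (forall x y, I x -> J y -> K (x * y)) -> iprod I J <=i K.
Proof. by move=> H x /iprodE; apply. Qed.
Lemma iprodS I J I' J' : I <=i I' -> J <=i J' -> iprod I J <=i iprod I' J'.
Proof. by move=> II JJ; apply: iprod_le => x y /II ? /JJ ?; apply: iprod_in. Qed.
Lemma iprod_ler I J : iprod I J <=i J.
Proof. by apply: iprod_le => x y _; apply: idM. Qed.
Lemma iprod_lel I J : iprod I J <=i I.
Proof. by apply: iprod_le => x y Ix _; apply: idMr. Qed.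
Lemma iprodC I J : iprod I J = iprod J I.
Proof.
by apply: ideal_eq; apply: iprod_le => x y Ix Jy; rewrite mulrC; apply: iprod_in.
Qed.
Lemma iprod1 I : iprod itop I = I.
Proof.
by apply: ideal_eq => [|x Ix]; [exact: iprod_ler|rewrite -[x]mul1r; exact: iprod_in].
Qed.
Lemma iprodA I J K : iprod I (iprod J K) = iprod (iprod I J) K.
Proof.
apply: ideal_eq.
  apply: iprod_le => x y Ix.
  suff H : iprod J K <=i icolon (iprod (iprod I J) K) x by move=> /H.
  apply: iprod_le => z t Jz Kt; rewrite icolonE mulrA.
  by apply: iprod_in => //; apply: iprod_in.
apply: iprod_le => x y Hx Ky.
suff H : iprod I J <=i icolon (iprod I (iprod J K)) y.
  by rewrite mulrC; apply: H.
apply: iprod_le => z t Iz Jt; rewrite icolonE mulrC -mulrA.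
by apply: iprod_in => //; apply: iprod_in.
Qed.
Lemma iprodD I J K : iprod I (J +i K) = iprod I J +i iprod I K.
Proof.
apply: ideal_eq.
  apply: iprod_le => x _ Ix [y [z [Jy Kz ->]]]; rewrite mulrDr.
  by exists (x * y), (x * z); split=> //; apply: iprod_in.
by apply: ile_add; apply: iprodS => //; [apply: ile_addl|apply: ile_addr].
Qed.

Fixpoint ipow I n := if n is n'.+1 then iprod I (ipow I n') else itop.

Lemma ipowD I m n : ipow I (m + n) = iprod (ipow I m) (ipow I n).
Proof. by elim: m => [|m IH] /=; rewrite ?iprod1// IH iprodA. Qed.
Lemma ipow_in I m n x y : ipow I m x -> ipow I n y -> ipow I (m + n) (x * y).
Proof. by rewrite ipowD; apply: iprod_in. Qed.
Lemma ipow1 I : ipow I 1 = I.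
Proof. by rewrite /= iprodC iprod1. Qed.
Lemma ipow_anti I m n : (m <= n)%N -> ipow I n <=i ipow I m.
Proof. by move=> /subnK<-; rewrite ipowD; apply: iprod_ler. Qed.
Lemma ipowS I J n : I <=i J -> ipow I n <=i ipow J n.
Proof. by move=> IJ; elim: n => //= n IH; apply: iprodS. Qed.
Lemma ipowX I m n : ipow (ipow I m) n = ipow I (m * n).
Proof. by elim: n => [|n IH]; rewrite ?muln0//= IH mulnS ipowD. Qed.
Lemma ipow_exp I x m n : ipow I m x -> ipow I (m * n) (x ^+ n).
Proof.
move=> Ix; elim: n => [|n IH]; first by rewrite muln0.
by rewrite mulnS exprS; apply: ipow_in.
Qed.

Fixpoint ispan (s : seq A) : ideal A := if s is x :: s' then ipr x +i ispan s' else ibot.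

Lemma ispan_in s x : x \in s -> ispan s x.
Proof.
elim: s => //= y s IH; rewrite inE => /orP[/eqP->|/IH H].
  apply: ile_addl; exact: ipr_in.
exact: ile_addr.
Qed.
Lemma ispan_le s I : (forall x, x \in s -> I x) -> ispan s <=i I.
Proof.
elim: s => [|y s IH] H /=; first exact: ile_bot.
apply: ile_add; first by apply: imul_top_le; apply: H; rewrite inE eqxx.
by apply: IH => x xs; apply: H; rewrite inE xs orbT.
Qed.
Lemma ispan_cat s t : ispan (s ++ t) = ispan s +i ispan t.
Proof.
elim: s => [|x s IH] /=; last by rewrite IH isumA.
by rewrite isum_idl//; apply: ile_bot.
Qed.
Lemma ispan_rcons s x : ispan (rcons s x) = ispan s +i ipr x.
Proof. by rewrite -cats1 ispan_cat /= (@isum_idr (ipr x))//; apply: ile_bot. Qed.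

Definition inoeth := forall I, exists s, I = ispan s.

Lemma ascend_mono (F : nat -> ideal A) : (forall n, F n <=i F n.+1) ->
  forall m n, (m <= n)%N -> F m <=i F n.
Proof.
move=> Finc m n; elim: n => [|n IH]; first by rewrite leqn0 => /eqP->.
rewrite leq_eqVlt => /orP[/eqP->//|]; rewrite ltnS => /IH H.
exact: ile_trans (Finc n).
Qed.

Lemma ascend_union (F : nat -> ideal A) : (forall n, F n <=i F n.+1) ->
  exists U : ideal A, forall x, U x <-> exists n, F n x.
Proof.
move=> Finc; have Fmono := ascend_mono Finc; unshelve eexists.
  exists (fun x => exists n, F n x).
  - by exists 0; apply: id0.
  - move=> x y [n Fx] [m Fy]; exists (maxn n m); apply: idD.
    + exact: Fmono (leq_maxl _ _) _ Fx.
    + exact: Fmono (leq_maxr _ _) _ Fy.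
  - by move=> a x [n Fx]; exists n; apply: idM.
by [].
Qed.

Lemma ideal_acc_stable : inoeth -> forall F : nat -> ideal A,
  (forall n, F n <=i F n.+1) -> exists n, forall m, F m <=i F n.
Proof.
move=> noe F Finc.
have Fmono := ascend_mono Finc; have [U UE] := ascend_union Finc.
have [s sE] := noe U.
have [n Hn] : exists n, forall x, x \in s -> F n x.
  have : forall x, x \in s -> exists n, F n x.
    by move=> x xs; apply/UE; rewrite sE; apply: ispan_in.
  elim: s {sE} => [|y s IH] H; first by exists 0.
  have [|n Hn] := IH; first by move=> x xs; apply: H; rewrite inE xs orbT.
  have [|m Hm] := H y; first by rewrite inE eqxx.
  exists (maxn n m) => x; rewrite inE => /orP[/eqP->|/Hn].
    exact: Fmono (leq_maxr _ _) _ Hm.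
  exact: Fmono (leq_maxl _ _) _.
exists n => m x Fx; have : U x by apply/UE; exists m.
by rewrite sE; apply: ispan_le.
Qed.

Lemma ideal_acc : inoeth -> acc ile.
Proof.
by move=> noe F /(ideal_acc_stable noe)[n Hn]; exists n; apply: Hn.
Qed.

Definition iprime (P : ideal A) :=
  ~ P 1 /\ forall x y, P (x * y) -> P x \/ P y.

Lemma iprimeX P x n : iprime P -> P (x ^+ n) -> P x.
Proof.
move=> [P1 PM]; elim: n => [|n IH]; first by rewrite expr0 => /P1.
by rewrite exprS => /PM[|/IH].
Qed.

Lemma iprime_prod P I J : iprime P -> iprod I J <=i P -> I <=i P \/ J <=i P.
Proof.
move=> [_ PM] H; have [|/existsNP[x /not_implyP[Ix nPx]]] := pselect (I <=i P); [by left|right].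
by move=> y Jy; have /PM[] := H _ (iprod_in Ix Jy).
Qed.

Lemma iprime_pow P I n : iprime P -> ipow I n <=i P -> I <=i P.
Proof.
move=> Pp; elim: n => [/= H|n IH /= /(iprime_prod Pp)[//|/IH//]].
by case: Pp => []; case; apply: H.
Qed.

(* A maximal annihilator of an element of [I / J] is prime. *)
Lemma prime_filtration (noe : inoeth) I (Phi : ideal A -> Prop) : Phi I ->
  (forall K x, K <=i I -> I x -> iprime (icolon K x) -> Phi (K +i ipr x) -> Phi K) ->
  forall J, J <=i I -> Phi J.
Proof.
move=> PI step; apply: (acc_ind (ideal_acc noe)) => J IH JI.
have [IJ|/existsNP[x0 /not_implyP[Ix0 nJx0]]] := pselect (I <=i J).
  by rewrite (ideal_eq JI IJ).
have [|P [[x [Ix nJx PE]] Pmax]] := @acc_max _ ile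
    (fun P => exists x, [/\ I x, ~ J x & P = icolon J x]) ile_refl ile_trans (ideal_acc noe).
  by exists (icolon J x0), x0.
apply: (step _ x) => //; last first.
  apply: IH; first exact: ile_addl.
    by move=> H; apply: nJx; apply: H; apply: ile_addr; apply: ipr_in.
  by apply: ile_add => //; apply: imul_top_le.
split=> [|y z]; rewrite !icolonE ?mulr1// => Jxyz.
have [|nJxy] := pselect (J (x * y)); [by left|right].
have : icolon J (x * y) <=i icolon J x.
  rewrite -PE; apply: Pmax; first by exists (x * y); split=> //; apply: idMr.
  by rewrite PE => t /(idMr y); rewrite !icolonE -mulrA (mulrC t).
by apply; rewrite icolonE -mulrA.
Qed.

(** The annihilators of the steps of a prime filtration of A / J. Their product kills A / J, so
    every prime over J contains one of them; this stands in for the finiteness of the set of minimal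
    primes. *)
Lemma prime_list (noe : inoeth) J : exists Ps : seq (ideal A),
  (forall P, P \in Ps -> iprime P /\ J <=i P) /\ foldr iprod itop Ps <=i J.
Proof.
pose Phi J := exists Ps : seq (ideal A),
  (forall P, P \in Ps -> iprime P /\ J <=i P) /\ foldr iprod itop Ps <=i J.
apply: (@prime_filtration noe itop Phi) => //; first by exists [::].
move=> K x _ _ Kp [Ps [HP HK]]; exists (icolon K x :: Ps); split=> [P|].
  rewrite inE => /orP[/eqP->|/HP[Pp KP]]; first by split=> //; apply: icolon_le.
  by split=> //; apply: ile_trans KP; apply: ile_addl.
apply: iprod_le => y z Ky /HK[a [_ [Ka [b _ ->] ->]]].
by rewrite mulrDr; apply: idD; [apply: idM|rewrite mulrA; apply: idMr; rewrite mulrC].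
Qed.

Lemma iprime_foldr P Ps : iprime P -> foldr iprod itop Ps <=i P ->
  exists Q, Q \in Ps /\ Q <=i P.
Proof.
move=> Pp; elim: Ps => [/(_ 1 I)|Q Ps IH /= /(iprime_prod Pp)[QP|/IH[R [RP RQ]]]].
- by case: Pp.
- by exists Q; rewrite inE eqxx.
- by exists R; rewrite inE RP orbT.
Qed.

End Ideals.

Arguments itop {A}.
Arguments ibot {A}.
Notation "I <=i J" := (ile I J) (at level 70).
Notation "I +i J" := (isum I J) (at level 50, left associativity).
Notation "I &i J" := (icap I J) (at level 48, left associativity).
#[global] Hint Resolve ile_refl ile_top ile_bot : core.

(** * Lengths *)

Definition mulset (A : comNzRingType) (S : A -> Prop) :=
  S 1 /\ forall s t, S s -> S t -> S (s * t).

(* For [S = {1}] the function [len S] below is the length of the A-module I / J; *)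
(* for S the complement of a prime p it is the length of (I / J)_p over A_p.     *)
Section Length.
Variables (A : comNzRingType) (S : A -> Prop) (Sm : mulset S).
Implicit Types (I J K M : ideal A) (x y z : A).

(** The inclusion of the localizations of I and J at S, stated without denominators. *)
Definition sle I J := forall y, I y -> exists2 s, S s & J (s * y).
Definition slt I J := I <=i J /\ ~ sle J I.

Lemma ile_sle I J : I <=i J -> sle I J.
Proof. by move=> IJ y /IJ Jy; exists 1; rewrite ?mul1r//; case: Sm. Qed.

Lemma sle_trans J I K : sle I J -> sle J K -> sle I K.
Proof.
move=> IJ JK y /IJ[s Ss /JK[t St Ky]]; exists (t * s); rewrite -?mulrA//.
by case: Sm => _; apply.
Qed.

Lemma slt_lel K I J : I <=i K -> slt K J -> slt I J.
Proof.
move=> IK [KJ nJK]; split; first exact: ile_trans KJ.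
by apply: contra_not nJK => JI; apply: sle_trans JI _; apply: ile_sle.
Qed.

(** Chains of n steps that climb from J and stay strict after localization. The last term need only
    lie in I, which makes the predicate monotone in both ends. *)
Fixpoint chain n I J : Prop :=
  if n is n'.+1 then exists2 K, slt J K & chain n' I K else J <=i I.

Lemma chain_le n I J : chain n I J -> J <=i I.
Proof. by elim: n J => //= n IH J [K [JK _] /IH]; apply: ile_trans. Qed.

Lemma chain_lel n I J K : J <=i K -> chain n I K -> chain n I J.
Proof.
case: n => [|n] JK /=; first exact: ile_trans.
by move=> [L KL cL]; exists L => //; apply: slt_lel KL.
Qed.

Lemma chain_ler n I J K : I <=i K -> chain n I J -> chain n K J.
Proof.
move=> IK; elim: n J => [|n IH] J /=; first by move=> JI; apply: ile_trans IK.
by move=> [L JL /IH cL]; exists L.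
Qed.

Lemma chain_leq m n I J : (m <= n)%N -> chain n I J -> chain m I J.
Proof.
elim: n m J => [|n IH] [|m] J //=; first by move=> _ /(@chain_le n.+1).
by rewrite ltnS => mn [L JL /(IH _ _ mn) cL]; exists L.
Qed.

Lemma chain_cat a b I J K : chain a K J -> chain b I K -> chain (a + b) I J.
Proof.
elim: a J => [|a IH] J /=; first by move=> JK; apply: chain_lel.
by move=> [L JL /IH H] /H cL; exists L.
Qed.

Lemma chain_sle n I J : sle I J -> chain n I J -> n = 0%N.
Proof.
case: n => //= n IJ [K [_ nKJ] /chain_le KI]; case: nKJ.
by apply: sle_trans IJ; apply: ile_sle.
Qed.

Lemma sle_modular I J M : I <=i J -> sle (J &i M) (I &i M) ->
  sle (J +i M) (I +i M) -> sle J I.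
Proof.
move=> IJ cap add y Jy; have [|s Ss [i [m [Ii Mm E]]]] := add y.
  exact: ile_addl.
have Jm : J m.
  by rewrite -[m](addKr i) -E addrC; apply: idB; [exact: idM|exact: IJ].
have [|t St [Itm _]] := cap m; first by [].
exists (t * s); first by case: Sm => _; apply.
by rewrite -mulrA E mulrDr; apply: idD => //; apply: idM.
Qed.

(** By the modular law a strict step cannot collapse both in the intersection with M and in the sum
    with M. Additivity of length follows without composition series. *)
Lemma chain_split n I J M : chain n I J -> exists a b,
  [/\ (a + b)%N = n, chain a (I &i M) (J &i M) & chain b (I +i M) (J +i M)].
Proof.
elim: n J => [|n IH] J /=.
  by move=> JI; exists 0, 0; split=> //=; [apply: icapS|apply: isumS].
move=> [K [JK nKJ] /IH[a [b [<- ca cb]]]].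
have [cap|ncap] := pselect (sle (K &i M) (J &i M)).
  exists a, b.+1; split; [exact: addnS| |].
    by apply: chain_lel ca; apply: icapS.
  exists (K +i M) => //; split; first exact: isumS.
  by apply: contra_not nKJ; apply: sle_modular.
exists a.+1, b; split; [exact: addSn| |].
  by exists (K &i M) => //; split=> //; apply: icapS.
by apply: chain_lel cb; apply: isumS.
Qed.

Definition fin I J := exists n, ~ chain n I J.
(** The default value 0 stands for infinite length, so [fin] has to accompany every use. *)
Definition len I J : nat := xget 0 [set n | chain n I J /\ ~ chain n.+1 I J].

Lemma chain_len I J : J <=i I -> fin I J -> forall n, chain n I J <-> (n <= len I J)%N.
Proof.
move=> JI [N cN]; have : exists n, chain n I J /\ ~ chain n.+1 I J.
  elim: N cN => [//|N IH] cN.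
  by have [cN'|/IH//] := pselect (chain N I J); exists N.
rewrite /len => /(xgetPex 0)/=[]; set l := xget _ _ => cl cl1 n; split=> [cn|nl].
  by rewrite leqNgt; apply/negP => ln; apply/cl1/(chain_leq ln).
exact: chain_leq cl.
Qed.

Lemma len_unique I J n : (forall m, chain m I J <-> (m <= n)%N) -> fin I J /\ len I J = n.
Proof.
move=> H; have F : fin I J by exists n.+1 => /H; rewrite ltnn.
have JI : J <=i I by apply: (@chain_le 0); apply/H.
split=> //; apply/eqP; rewrite eqn_leq; apply/andP; split.
  by apply/H/(chain_len JI F).
by apply/(chain_len JI F)/H.
Qed.

Lemma len_chain_eq I J I' J' : J <=i I -> (forall n, chain n I J <-> chain n I' J') ->
  (fin I J <-> fin I' J') /\ (fin I J -> len I J = len I' J').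
Proof.
move=> JI E; have FE : fin I J <-> fin I' J'.
  by split=> -[n cn]; exists n => /E.
split=> // F; symmetry; apply: (len_unique _).2 => n.
by rewrite -E; apply: chain_len.
Qed.

Lemma finD I J K : J <=i K -> K <=i I -> fin I K -> fin K J -> fin I J.
Proof.
move=> JK KI FIK FKJ; exists (len K J + len I K).+1 => /(chain_split K)[a [b [E]]].
rewrite (icap_idr KI) (icap_idl JK) (isum_idr KI) (isum_idl JK).
by move=> /(chain_len JK FKJ) ? /(chain_len KI FIK); lia.
Qed.

Lemma fin_lel I J K : J <=i K -> fin I J -> fin I K.
Proof. by move=> JK [n cn]; exists n => /(chain_lel JK). Qed.

Lemma fin_ler I J K : K <=i I -> fin I J -> fin K J.
Proof. by move=> KI [n cn]; exists n => /(chain_ler KI). Qed.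

Lemma lenD I J K : J <=i K -> K <=i I -> fin I J -> len I J = (len I K + len K J)%N.
Proof.
move=> JK KI F.
have FIK := fin_lel JK F; have FKJ := fin_ler KI F.
apply: (len_unique _).2 => n; split=> [/(chain_split K)[a [b [<-]]]|nl].
  rewrite (icap_idr KI) (icap_idl JK) (isum_idr KI) (isum_idl JK).
  by move=> /(chain_len JK FKJ) ? /(chain_len KI FIK); lia.
apply: (chain_leq nl); rewrite addnC.
by apply: (@chain_cat _ _ _ _ K); [apply/(chain_len JK FKJ)|apply/(chain_len KI FIK)].
Qed.

Lemma len_sle I J : J <=i I -> sle I J -> fin I J /\ len I J = 0%N.
Proof.
move=> JI IJ; apply: len_unique => n; split=> [/(chain_sle IJ)->//|].
by rewrite leqn0 => /eqP->.
Qed.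

Lemma sle_len I J : J <=i I -> fin I J -> len I J = 0%N -> sle I J.
Proof.
move=> JI F L; apply: contrapT => nIJ.
by have /(chain_len JI F) : chain 1 I J; [exists I|rewrite L].
Qed.

Lemma fin_refl I : fin I I. Proof. by apply: (len_sle _ _).1 => //; apply: ile_sle. Qed.
Lemma len_refl I : len I I = 0%N.
Proof. by apply: (len_sle _ _).2 => //; apply: ile_sle. Qed.

Lemma chain_sumcap n I M : chain n (I +i M) M <-> chain n I (I &i M).
Proof.
have H a K : chain a K K -> a = 0%N by apply: chain_sle; apply: ile_sle.
split=> [/(chain_split I)|/(chain_split M)] [a [b [<-]]].
  rewrite (icap_idr (@ile_addl _ I M)) (isum_idr (@ile_addl _ I M)) (isumC M) icapC.
  by move=> ca /H->; rewrite addn0.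
rewrite (icap_idl (@ile_capr _ I M)) (isum_idl (@ile_capr _ I M)).
by move=> /H-> cb; rewrite add0n.
Qed.

Lemma len_sumcap I M :
  (fin (I +i M) M <-> fin I (I &i M)) /\ (fin I (I &i M) -> len (I +i M) M = len I (I &i M)).
Proof.
have [E H] := len_chain_eq (@ile_addr _ I M) (fun n => chain_sumcap n I M).
by split=> // /E.
Qed.

(** Multiplication by x identifies I / ((J : x) cap I) with (x I + J) / J; chains are carried along
    this isomorphism in both directions. *)
Lemma chain_imul n I J x :
  chain n (imul x I +i J) J <-> chain n I (icolon J x &i I).
Proof.
split.
  suff H K : J <=i K -> chain n (imul x I +i J) K -> chain n I (icolon K x &i I).
    exact: H.
  elim: n K => [|n IH] K JK /=; first by move=> _; apply: ile_capr.
  move=> [L [KL nLK] cL]; exists (icolon L x &i I); last first.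
    by apply: IH => //; apply: ile_trans KL.
  split; first by apply: icapS => //; apply: icolonS.
  apply: contra_not nLK => H y Ly.
  have [_ [j [[i Ii ->] Jj E]]] := chain_le cL Ly.
  have Li : icolon L x i.
    by rewrite icolonE -[_ * i](addrK j) -E; apply: idB => //; apply: KL; apply: JK.
  have [s Ss [Ksi _]] := H i (conj Li Ii); exists s => //.
  rewrite E mulrDr; apply: idD; last by apply: idM; apply: JK.
  by rewrite mulrCA.
suff H K : icolon J x &i I <=i K -> chain n I K -> chain n (imul x I +i J) (imul x K +i J).
  move=> /(H _ (@ile_refl _ _)); apply: chain_lel; exact: ile_addr.
elim: n K => [|n IH] K JK /=; first by move=> KI; apply: isumS => //; apply: imulS.
move=> [L [KL nLK] cL]; exists (imul x L +i J); last first.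
  by apply: IH => //; apply: ile_trans KL.
split; first by apply: isumS => //; apply: imulS.
apply: contra_not nLK => H y Ly.
have [|s Ss [_ [j [[k Kk ->] Jj E]]]] := H (x * y).
  by apply: ile_addl; exists y.
exists s => //; rewrite -[s * y](subrK k); apply: idD => //.
apply: JK; split; first by rewrite icolonE mulrBr (mulrCA x) E addrC addKr.
have LI := chain_le cL.
by apply: idB; [apply: idM; apply: LI|apply: LI; apply: KL].
Qed.

Lemma len_imul I J x : let K := icolon J x &i I in
  (fin (imul x I +i J) J <-> fin I K) /\ (fin I K -> len (imul x I +i J) J = len I K).
Proof.
have [E H] := len_chain_eq (@ile_addr _ (imul x I) J) (fun n => chain_imul n I J x).
by split=> // /E.
Qed.

Lemma len_lel I J K : J <=i K -> K <=i I -> fin I J -> (len I K <= len I J)%N.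
Proof. by move=> JK KI F; rewrite (lenD JK KI F) leq_addr. Qed.

(* A step [J <= J + (x)] is isomorphic to A / (J : x). *)
Lemma len_step J x : (fin (J +i ipr x) J <-> fin itop (icolon J x)) /\
  (fin itop (icolon J x) -> len (J +i ipr x) J = len itop (icolon J x)).
Proof.
by have := len_imul itop J x; rewrite /= (icap_idl (@ile_top _ _)) isumC.
Qed.

(** In a prime filtration of I / J every step is cyclic and killed by c, hence a quotient of A /
    c. *)
Lemma fin_killed I J c : inoeth A -> J <=i I -> iprod c I <=i J -> fin itop c -> fin I J.
Proof.
move=> noe JI cIJ Fc; apply: (@prime_filtration A noe I (fun K => J <=i K -> fin I K)) JI _ => //.
  by move=> _; apply: fin_refl.
move=> K x KI Ix Kp IH JK.
have KKx : K <=i K +i ipr x by exact: ile_addl.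
apply: (finD KKx); first by apply: ile_add => //; apply: imul_top_le.
  by apply: IH; apply: ile_trans JK KKx.
apply/(len_step K x).1; apply: fin_lel Fc => y cy.
by rewrite icolonE mulrC; apply: JK; apply: cIJ; apply: iprod_in.
Qed.

Lemma fin_ipow c n : inoeth A -> fin itop c -> fin itop (ipow c n).
Proof.
move=> noe Fc; elim: n => [|n IH]; first exact: fin_refl.
apply: (@finD _ _ (ipow c n)) => //; first exact: iprod_ler.
by apply: (fin_killed noe _ _ Fc) => //; apply: iprod_ler.
Qed.

Lemma fin_sle c J : fin itop c -> sle c J -> fin itop J.
Proof.
move=> Fc cJ; apply: (@finD _ _ (J +i c)) => //; [exact: ile_addl|exact: fin_lel (@ile_addr _ _ _) Fc|].
apply: (len_sle _ _).1; first exact: ile_addl.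
move=> _ [x [y [Jx /cJ[s Ss Jsy] ->]]]; exists s => //.
by rewrite mulrDr; apply: idD => //; apply: idM.
Qed.

(* The two cases of interest: S = {1} with p maximal, and S = A \ p. *)
Definition scompl (p : ideal A) :=
  (forall s, S s -> ~ p s) /\ forall y, ~ p y -> exists a, S (a * y).

Lemma len_scompl p : scompl p -> fin itop p /\ len itop p = 1%N.
Proof.
move=> [Sp pS]; apply: len_unique => -[|[|n]]; split=> //.
  move=> _; exists itop => //; split=> // H.
  by have [//|s Ss ps1] := H 1; apply: (Sp s); rewrite // -[s]mulr1.
move=> [K [pK nKp] [L [KL nLK] _]]; exfalso.
have [y [Ky npy]] : exists y, K y /\ ~ p y.
  apply: contrapT => H; apply: nKp; apply: ile_sle => y Ky.
  by apply: contrapT => npy; apply: H; exists y.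
have [a Say] := pS y npy.
apply: nLK => z _; exists (a * y) => //.
by rewrite -mulrA mulrCA; apply: idMr.
Qed.

Lemma len_prime_other p q : scompl p -> ~ (q <=i p) -> fin itop q /\ len itop q = 0%N.
Proof.
move=> [_ pS] /existsNP[y /not_implyP[qy npy]].
apply: len_sle => // z _; have [a Say] := pS y npy; exists (a * y) => //.
by apply: idMr; apply: idM.
Qed.

End Length.

(** * Graded modules and Hilbert functions *)

(* A list of pairs (f, k) stands for a list of operators of degree k on graded *)
(* modules; a graded submodule of A[T] is given by the ideals of coefficients. *)
Section Graded.
Variables (A : comNzRingType) (noe : inoeth A).
Implicit Types (I J K : ideal A) (U V W F G : nat -> ideal A) (fs : seq (A * nat)).

Definition gle U V := forall n, U n <=i V n.

Definition gclosed fs U :=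
  forall fk, fk \in fs -> forall n, imul fk.1 (U n) <=i U (n + fk.2)%N.

Fixpoint gsum fs U n : ideal A :=
  if fs is fk :: fs' then imul fk.1 (U (n - fk.2)%N) +i gsum fs' U n else ibot.

Definition gpos fs := forall fk : A * nat, fk \in fs -> (0 < fk.2)%N.
Definition gdeg fs n := forall fk : A * nat, fk \in fs -> (fk.2 <= n)%N.

Lemma gposW fk fs : gpos (fk :: fs) -> gpos fs.
Proof. by move=> H gl gls; apply: H; rewrite inE gls orbT. Qed.
Lemma gposH fk fs : gpos (fk :: fs) -> (0 < fk.2)%N.
Proof. by apply; rewrite inE eqxx. Qed.
Lemma gclosedW fk fs U : gclosed (fk :: fs) U -> gclosed fs U.
Proof. by move=> H gl gls; apply: H; rewrite inE gls orbT. Qed.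
Lemma gclosedH fk fs U : gclosed (fk :: fs) U -> forall n, imul fk.1 (U n) <=i U (n + fk.2)%N.
Proof. by apply; rewrite inE eqxx. Qed.
Lemma gclosed_cons fk fs U : (forall n, imul fk.1 (U n) <=i U (n + fk.2)%N) ->
  gclosed fs U -> gclosed (fk :: fs) U.
Proof. by move=> H1 H2 gl; rewrite inE => /orP[/eqP->|/H2]. Qed.

Lemma gdegW n fs m : (n <= m)%N -> gdeg fs n -> gdeg fs m.
Proof. by move=> nm H fk /H/leq_trans; apply. Qed.
Lemma gdeg_bound fs : exists n, gdeg fs n.
Proof.
elim: fs => [|fk fs [n Hn]]; first by exists 0.
exists (fk.2 + n)%N => gl; rewrite inE => /orP[/eqP->|/Hn]; first exact: leq_addr.
by move=> /leq_trans; apply; apply: leq_addl.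
Qed.
Lemma gdeg_ge fs n0 : exists N, (n0 <= N)%N /\ forall n, (N <= n)%N -> gdeg fs n.
Proof.
have [N HN] := gdeg_bound fs; exists (n0 + N)%N; split; first exact: leq_addr.
by move=> n /(leq_trans (leq_addl _ _)) Nn; apply: gdegW HN.
Qed.

Lemma gsum_le fs U n I :
  (forall fk, fk \in fs -> imul fk.1 (U (n - fk.2)%N) <=i I) -> gsum fs U n <=i I.
Proof.
elim: fs => [|fk fs IH] H /=; first exact: ile_bot.
apply: ile_add; first by apply: H; rewrite inE eqxx.
by apply: IH => gl gls; apply: H; rewrite inE gls orbT.
Qed.

Lemma gsum_in fs U n fk : fk \in fs -> imul fk.1 (U (n - fk.2)%N) <=i gsum fs U n.
Proof.
elim: fs => //= gl fs IH; rewrite inE => /orP[/eqP->|/IH H]; first exact: ile_addl.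
exact: ile_addrW.
Qed.

Lemma gsumS fs U V n : gle U V -> gsum fs U n <=i gsum fs V n.
Proof.
move=> UV; apply: gsum_le => fk fks; apply: (ile_trans _ (gsum_in fks)).
by apply: imulS; apply: UV.
Qed.

Lemma gsum_closed fs U n : gdeg fs n -> gclosed fs U -> gsum fs U n <=i U n.
Proof.
move=> dn cU; apply: gsum_le => fk fks.
by have := cU _ fks (n - fk.2)%N; rewrite subnK//; apply: dn.
Qed.

(** Noetherianity of U / V over the operators [fs], in the form of finite generation: modulo V, each
    stable W in between is generated in bounded degrees. *)
Definition gnoeth fs U V := forall W, gle V W -> gle W U -> gclosed fs W ->
  exists n0, forall n, (n0 <= n)%N -> W n <=i V n +i gsum fs W n.

Definition gfinite fs F := exists n0, forall n, (n0 <= n)%N -> F n <=i gsum fs F n.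

(** The union of the chain is generated in degrees below some N. Each of these finitely many degrees
    stabilizes by the chain condition in A, and the higher degrees follow from them. *)
Lemma gnoeth_acc fs F V (c : nat -> nat -> ideal A) : gpos fs -> gnoeth fs F V ->
  (forall j, gclosed fs (c j)) -> (forall j, gle V (c j)) -> (forall j, gle (c j) F) ->
  (forall j, gle (c j) (c j.+1)) -> exists j0, forall j, gle (c j) (c j0).
Proof.
move=> fs0 noeF cc Vc cF cinc.
have cmono n : forall i j, (i <= j)%N -> c i n <=i c j n.
  by apply: ascend_mono => j; apply: cinc.
have [U UE] : exists U, forall n x, U n x <-> exists j, c j n x.
  by have [U UE] := choice (fun n => @ascend_union _ (c^~ n) (fun j => cinc j n)); exists U.
have cU j : gle (c j) U by move=> n x cx; apply/UE; exists j.
have [|||n0 Hn0] := noeF U.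
- by move=> n; apply: (ile_trans _ (cU 0 n)); apply: Vc.
- by move=> n x /UE[j /cF].
- move=> fk fks n; apply/imulP => x /UE[j cx].
  by apply/UE; exists j; apply: cc => //; exists x.
have [N [n0N dN]] := gdeg_ge fs n0.
have [j jP] := choice (fun n => @ideal_acc_stable _ noe (c^~ n) (fun j => cinc j n)).
have [j0 Hj0] : exists j0, forall n, (n < N)%N -> (j n <= j0)%N.
  elim: N {n0N dN} => [|N [j0 IH]]; first by exists 0.
  exists (maxn j0 (j N)) => n; rewrite ltnS leq_eqVlt => /orP[/eqP->|/IH].
    exact: leq_maxr.
  by move=> /leq_trans; apply; apply: leq_maxl.
have UC n : U n <=i c j0 n.
  elim/ltn_ind: n => n IH; have [nN|Nn] := ltnP n N.
    by move=> x /UE[i /jP]; apply: cmono; apply: Hj0.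
  apply: ile_trans (Hn0 n (leq_trans n0N Nn)) _; apply: ile_add; first exact: Vc.
  apply: gsum_le => fk fks.
  have kn := dN n Nn _ fks; have k0 := fs0 _ fks.
  have := cc j0 _ fks (n - fk.2)%N; rewrite subnK//; apply: ile_trans.
  by apply: imulS; apply: IH; rewrite ltn_subrL k0 (leq_trans k0 kn).
by exists j0 => i; move=> n; apply: (ile_trans _ (UC n)); apply: cU.
Qed.

(** * Hilbert's basis theorem for one more operator *)

Section HilbertStep.
Variables (f : A) (k : nat) (fs : seq (A * nat)) (F : nat -> ideal A) (n0 : nat).
Hypotheses (k0 : (0 < k)%N) (fs0 : gpos fs).
Hypothesis dn0 : forall n, (n0 <= n)%N -> gdeg ((f, k) :: fs) n.
Hypothesis clF : gclosed ((f, k) :: fs) F.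
Hypothesis genF : forall n, (n0 <= n)%N -> F n <=i gsum ((f, k) :: fs) F n.

(** What the components of F below degree [n0] generate under [fs] alone. It plays the role of the
    module M in the polynomial module M[X], with [f] acting as X. *)
Definition hbase (n : nat) : ideal A.
Proof.
exists (fun x => forall G, gclosed fs G -> (forall m, (m < n0)%N -> F m <=i G m) -> G n x).
- by move=> G _ _; apply: id0.
- by move=> x y Hx Hy G c H; apply: idD; [apply: Hx|apply: Hy].
- by move=> a x Hx G c H; apply: idM; apply: Hx.
Defined.

Lemma hbase_closed : gclosed fs hbase.
Proof.
move=> fk fks n; apply/imulP => x Hx G c H.
by apply: (c _ fks); exists x => //; apply: Hx.
Qed.

Lemma hbase_low n : (n < n0)%N -> F n <=i hbase n.
Proof. by move=> nn x Fx G _ H; apply: H. Qed.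

Lemma dfs n : (n0 <= n)%N -> gdeg fs n.
Proof. by move=> /dn0 H fk fks; apply: H; rewrite inE fks orbT. Qed.

Lemma hbase_finite : gfinite fs hbase.
Proof.
exists n0 => n nn x Hx.
pose G n := if (n < n0)%N then hbase n else gsum fs hbase n.
have GE : G n x; last by move: GE; rewrite /G ltnNge nn.
have GB m : G m <=i hbase m.
  rewrite /G; case: ltnP => // mm; apply: gsum_closed; [exact: dfs|exact: hbase_closed].
apply: Hx => [fk fks m|m mm]; last by rewrite /G mm; apply: hbase_low.
rewrite /G; case: (ltnP (m + fk.2)%N n0) => mm.
  by apply: (ile_trans _ (@hbase_closed _ fks m)); apply: imulS; apply: GB.
apply: (ile_trans _ (gsum_in fks)); rewrite addnK; apply: imulS; exact: GB.
Qed.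

(** The degree n part of the polynomials in [f] of degree less than j with coefficients in
    [hbase]. *)
Fixpoint hsum j n : ideal A :=
  if j is j'.+1 then hsum j' n +i
    (if (j' * k <= n)%N then imul (f ^+ j') (hbase (n - j' * k)%N) else ibot)
  else ibot.

Lemma hsum_mono n i j : (i <= j)%N -> hsum i n <=i hsum j n.
Proof. by apply: (@ascend_mono _ (hsum^~ n)) => m; apply: ile_addl. Qed.

Lemma hsum_closed j : gclosed fs (hsum j).
Proof.
move=> fk fks n; elim: j => [|j IH] /=.
  by apply/imulP => x ->; rewrite mulr0; apply: id0.
rewrite imulD; apply: isumS => //.
case: leqP => jk; last by apply/imulP => x ->; rewrite mulr0; apply: id0.
rewrite (leq_trans jk (leq_addr _ _)) imulA mulrC -imulA; apply: imulS.
by rewrite -addnBAC//; apply: hbase_closed.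
Qed.

Lemma hsum_shift j n : imul f (hsum j n) <=i hsum j.+1 (n + k)%N.
Proof.
elim: j => [|j IH].
  by apply/imulP => x ->; rewrite mulr0; apply: id0.
rewrite [hsum j.+1 n]/= imulD; apply: ile_add.
  by apply: ile_trans IH _; apply: ile_addl.
apply: ile_addrW.
case: leqP => jk; last by apply/imulP => x ->; rewrite mulr0; apply: id0.
by rewrite mulSn addnC leq_add2r jk imulA -exprS subnDr.
Qed.

Local Open Scope nat_scope.
Lemma hsum_full n : F n <=i hsum n.+1 n.
Proof.
elim/ltn_ind: n => n IH; have [nn|nn] := ltnP n n0.
  apply: (ile_trans _ (@hsum_mono n 1 n.+1 isT)); rewrite /= subn0 imul1.
  by apply: ile_addrW; apply: hbase_low.
apply: ile_trans (genF nn) _; apply: gsum_le => fk; rewrite inE => fks.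
have kn : (fk.2 <= n)%N by apply: (dn0 nn); rewrite inE.
have kp : (0 < fk.2)%N by case/orP: fks => [/eqP->//|]; apply: fs0.
have nk : (n - fk.2 < n)%N by rewrite ltn_subrL kp (leq_trans kp kn).
apply: (ile_trans (@imulS _ _ _ _ (IH _ nk))).
case/orP: fks => [/eqP E|fks].
  have := @hsum_shift (n - fk.2).+1 (n - fk.2); move: kn nk; rewrite {}E => kn nk.
  by rewrite subnK// => H; apply: (ile_trans H); apply: hsum_mono; rewrite ltnS.
have := @hsum_closed (n - fk.2).+1 _ fks (n - fk.2); rewrite subnK// => H.
by apply: (ile_trans H); apply: hsum_mono; rewrite ltnS ltnW.
Qed.

Local Close Scope nat_scope.
Variable W : nat -> ideal A.
Hypotheses (clW : gclosed ((f, k) :: fs) W) (WF : gle W F).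

(* Leading coefficients, with respect to powers of [f], of the elements of [W]. *)
Definition hlead (j n : nat) : ideal A.
Proof.
exists (fun b => hbase n b /\
          exists u, W (n + j * k)%N u /\ hsum j (n + j * k)%N (u - f ^+ j * b)).
- by split; [exact: id0|exists 0; rewrite mulr0 subr0; split; apply: id0].
- move=> x y [Bx [u [Wu Hu]]] [By [v [Wv Hv]]]; split; first exact: idD.
  exists (u + v); split; first exact: idD.
  by rewrite mulrDr opprD addrACA; apply: idD.
- move=> a x [Bx [u [Wu Hu]]]; split; first exact: idM.
  exists (a * u); split; first exact: idM.
  by rewrite mulrCA -mulrBr; apply: idM.
Defined.

Lemma hlead_closed j : gclosed fs (hlead j).
Proof.
move=> fk fks n; apply/imulP => b [Bb [u [Wu Hu]]]; split.
  by apply: hbase_closed => //; exists b.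
exists (fk.1 * u); rewrite addnAC; split.
  by apply: (gclosedW clW fks); exists u.
by rewrite mulrCA -mulrBr; apply: hsum_closed => //; exists (u - f ^+ j * b).
Qed.

Lemma hlead_inc j : gle (hlead j) (hlead j.+1).
Proof.
move=> n b [Bb [u [Wu Hu]]]; split=> //; exists (f * u).
rewrite mulSn (addnC k) addnA; split; first by apply: (gclosedH clW); exists u.
by rewrite exprS -mulrA -mulrBr; apply: hsum_shift; exists (u - f ^+ j * b).
Qed.

(** A combination of leading coefficients is the leading coefficient of the same combination of
    elements of W. *)
Lemma hlead_gsum j n b : (n0 <= n)%N -> gsum fs (hlead j) n b ->
  exists w, gsum fs W (n + j * k)%N w /\ hsum j (n + j * k)%N (w - f ^+ j * b).
Proof.
move=> nn; have dn := dfs nn.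
have sub : {subset fs <= fs} by [].
elim: {1 3 4}fs b sub => [|fk gs IH] b sub /=.
  by move=> ->; exists 0; rewrite mulr0 subr0; split=> //; apply: id0.
move=> [_ [y [[c [Bc [u [Wu Hu]]] ->] Hy ->]]].
have fks : fk \in fs by apply: sub; rewrite inE eqxx.
have kn := dn _ fks.
have [|w [Hw Hw']] := IH y _ Hy; first by move=> gl gls; apply: sub; rewrite inE gls orbT.
exists (fk.1 * u + w); split.
  by exists (fk.1 * u), w; split=> //; exists u => //; rewrite -addnBAC.
rewrite mulrDr opprD addrACA; apply: idD => //.
rewrite mulrCA -mulrBr.
have := @hsum_closed j _ fks (n - fk.2 + j * k)%N.
by rewrite addnAC subnK//; apply; exists (u - f ^+ j * c).
Qed.

End HilbertStep.

(** The modules of leading coefficients increase with the degree in [f], so they stabilize at some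
    [j0] by induction on [fs]. An element of W of large degree is then reduced, one power of [f] at
    a time, modulo what lower degrees of W generate. *)
Lemma gfinite_noeth fs F : gpos fs -> gclosed fs F -> gfinite fs F ->
  gnoeth fs F (fun=> ibot).
Proof.
elim: fs F => [|[f k] fs IH] F fs0 clF [n0 Hn0].
  move=> W _ WF _; exists n0 => n nn.
  by apply: ile_trans (ile_trans (WF n) (Hn0 n nn)) _; apply: ile_addr.
move=> W _ WF clW.
have [n1 [n01 dn1]] := gdeg_ge ((f, k) :: fs) n0.
have genF n : (n1 <= n)%N -> F n <=i gsum ((f, k) :: fs) F n.
  by move=> /(leq_trans n01); apply: Hn0.
have k0 := gposH fs0; have fs0' := gposW fs0.
pose B := hbase fs F n1; pose c := hlead f k fs F n1 W.
have noeB : gnoeth fs B (fun=> ibot).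
  by apply: IH => //; [apply: hbase_closed|apply: (hbase_finite _ dn1)].
have cB j : gle (c j) B by move=> n b [].
have clc j : gclosed fs (c j) by apply: hlead_closed.
have [j0 Hj0] : exists j0, forall j, gle (c j) (c j0).
  apply: (gnoeth_acc fs0' noeB clc _ cB); last exact: hlead_inc.
  by move=> j n; apply: ile_bot.
have [nj njP] := choice (fun j => noeB _ (fun n => @ile_bot _ (c j n)) (cB j) (clc j)).
have [N [n1N HN]] : exists N, (n1 <= N)%N /\ forall j, (j <= j0)%N -> (nj j <= N)%N.
  elim: (j0) => [|i [N [n1N IHi]]].
    exists (n1 + nj 0)%N; split=> [|j]; first exact: leq_addr.
    by rewrite leqn0 => /eqP->; apply: leq_addl.
  exists (N + nj i.+1)%N; split; first exact: leq_trans n1N (leq_addr _ _).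
  move=> j; rewrite leq_eqVlt => /orP[/eqP->|]; first exact: leq_addl.
  by rewrite ltnS => /IHi/leq_trans; apply; apply: leq_addr.
exists (N + j0 * k)%N => m mN.
have n1m : (n1 <= m)%N by apply: leq_trans mN; apply: leq_trans n1N (leq_addr _ _).
have dm := dn1 _ n1m.
have km : (k <= m)%N by apply: (dm (f, k)); rewrite inE eqxx.
set H := hsum f k fs F n1.
suff key j u : W m u -> H j m u -> gsum ((f, k) :: fs) W m u.
  move=> u Wu; apply: ile_addr; apply: (key m.+1) => //.
  by apply: (hsum_full k0 fs0' dn1 genF); apply: WF.
elim: j u => [|j IHj] u Wu; first by move=> ->; apply: id0.
move=> [v [t [Hv + uE]]]; case: leqP => jm; last first.
  by move=> t0; rewrite t0 addr0 in uE; apply: IHj; rewrite // uE.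
move=> [b Bb tE]; rewrite {t}tE in uE.
have cb : c j (m - j * k)%N b.
  by split=> //; exists u; rewrite subnK// uE addrK; split=> //; rewrite -uE.
suff [w [Ww Hw]] : exists w, gsum ((f, k) :: fs) W m w /\ H j m (w - f ^+ j * b).
  rewrite -[u](subrK w); apply: idD => //; apply: IHj.
    by apply: idB => //; apply: gsum_closed Ww.
  by rewrite uE -addrA -opprB; apply: idB.
have [jj|jj] := leqP j j0.
  have Nm : (N <= m - j * k)%N.
    by rewrite leq_subRL//; apply: leq_trans mN; rewrite addnC leq_add2l leq_mul2r jj orbT.
  have [_ [y [-> + bE]]] := njP j _ (leq_trans (HN j jj) Nm) b cb.
  rewrite add0r in bE; rewrite -bE.
  move=> /(hlead_gsum dn1 (leq_trans n1N Nm))[w [Ww Hw]].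
  rewrite subnK// in Ww Hw; exists w; split=> //; exact: ile_addr.
(* Beyond [j0] the leading coefficient already occurs one power of [f] earlier, so f times an
   element of W cancels the leading term. *)
case: j jj jm cb {IHj uE Hv Bb} => // j jj jm cb.
have [_ [u' [Wu' Hu']]] : c j (m - j.+1 * k)%N b.
  have inc i : c i (m - j.+1 * k)%N <=i c i.+1 (m - j.+1 * k)%N by exact: hlead_inc.
  by apply: (@ascend_mono _ (fun i => c i (m - j.+1 * k)%N) inc j0 j) => //; apply: Hj0 cb.
have E : (m - j.+1 * k + j * k = m - k)%N by move: jm; rewrite mulSn; lia.
rewrite E in Wu' Hu'; exists (f * u'); split; first by apply: ile_addl; exists u'.
rewrite exprS -mulrA -mulrBr.
have := @hsum_shift f k fs F n1 j (m - k)%N; rewrite subnK//; apply.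
by exists (u' - f ^+ j * b).
Qed.

End Graded.

Arguments gclosedH {A fk fs U} _ n.
Arguments gclosedW {A fk fs U} _ [fk0] _ n : rename.

Lemma expn_homo m n r : (m <= n)%N -> (m ^ r <= n ^ r)%N.
Proof. by case: r => // r mn; rewrite leq_exp2r. Qed.

(** * Orders of growth *)

Section Growth.
Implicit Types (h g : nat -> int) (r s k n : nat).

(* [h n = O(n ^ (r - 1))], where for [r = 0] this means that h vanishes eventually. *)
Definition growth r h := exists C n0 : nat,
  forall n, (n0 <= n)%N -> (`|h n|%N * n <= C * n ^ r)%N.

Lemma growth_le r h g N : (forall n, (N <= n)%N -> (`|h n| <= `|g n|)%N) ->
  growth r g -> growth r h.
Proof.
move=> hg [C [n0 H]]; exists C, (maxn N n0) => n; rewrite geq_max => /andP[Nn nn].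
by apply: leq_trans (H n nn); rewrite leq_mul2r hg ?orbT.
Qed.

Lemma growth_eq r h g N : (forall n, (N <= n)%N -> h n = g n) -> growth r g -> growth r h.
Proof. by move=> hg; apply: (@growth_le _ _ _ N) => n /hg->. Qed.

Lemma growth0 r : growth r (fun=> 0).
Proof. by exists 0%N, 0%N => n _; rewrite absz0. Qed.

Lemma growth_ev0 h : growth 0 h <-> exists N, forall n, (N <= n)%N -> h n = 0.
Proof.
split=> [[C [n0 H]]|[N H]]; last exact: (@growth_eq _ _ _ N H (growth0 0)).
exists (maxn n0 C.+1) => n; rewrite geq_max => /andP[nn Cn].
have := H n nn; rewrite expn0 muln1 => Hn; apply/eqP; rewrite -absz_eq0.
rewrite -leqn0 leqNgt; apply/negP => h0.
by have := leq_trans (leq_pmull n h0) Hn; rewrite leqNgt Cn.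
Qed.

Lemma growthD r h g : growth r h -> growth r g -> growth r (fun n => h n + g n).
Proof.
move=> [C [n0 H]] [D [n1 G]]; exists (C + D)%N, (maxn n0 n1) => n.
rewrite geq_max => /andP[/H Hn /G Gn]; rewrite mulnDl.
apply: leq_trans (leq_add Hn Gn); rewrite -mulnDl leq_mul2r.
by apply/orP; right; lia.
Qed.

Lemma growthZ r c h : growth r h -> growth r (fun n => c * h n).
Proof.
move=> [C [n0 H]]; exists (`|c| * C)%N, n0 => n nn.
by rewrite abszM -!mulnA leq_mul2l H ?orbT.
Qed.

Lemma growthN r h : growth r h -> growth r (fun n => - h n).
Proof. by apply: (@growth_le _ _ _ 0) => n _; rewrite abszN. Qed.

Lemma growthB r h g : growth r h -> growth r g -> growth r (fun n => h n - g n).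
Proof. by move=> hr gr; apply: growthD => //; apply: growthN. Qed.

Lemma growthW r s h : (r <= s)%N -> growth r h -> growth s h.
Proof.
move=> rs [C [n0 H]]; exists C, n0.+1 => n nn.
apply: leq_trans (H n (ltnW nn)) _; rewrite leq_mul2l leq_pexp2l ?orbT//.
by apply: leq_ltn_trans nn.
Qed.

Lemma growth_muln r h : growth r h -> growth r.+1 (fun n => n%:Z * h n).
Proof.
move=> [C [n0 H]]; exists C, n0 => n nn.
by rewrite abszM absz_nat expnS mulnCA -mulnA leq_mul2l H ?orbT.
Qed.

Lemma growth_exp r : growth r.+1 (fun n => (n ^ r)%:Z).
Proof. by exists 1%N, 0%N => n _; rewrite absz_nat mul1n expnSr. Qed.

Lemma growth_subn r k h : growth r h -> growth r (fun n => h (n - k)%N).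
Proof.
move=> [C [n0 H]]; exists (2 * C)%N, (n0 + k + k)%N => n nn.
have := H (n - k)%N ltac:(lia); set a := `|_|%N => Hn.
apply: (@leq_trans (2 * (a * (n - k)))%N); first by rewrite mulnCA leq_mul2l; lia.
rewrite -mulnA leq_mul2l /=; apply: leq_trans Hn _.
by rewrite leq_mul2l expn_homo ?leq_subr ?orbT.
Qed.

Lemma growth_addn r k h : growth r h -> growth r (fun n => h (n + k)%N).
Proof.
move=> [C [n0 H]]; exists (C * 2 ^ r)%N, (n0 + k)%N => n nn.
have := H (n + k)%N ltac:(lia); set a := `|_|%N => Hn.
apply: (@leq_trans (a * (n + k))%N); first by rewrite leq_mul2l leq_addr orbT.
apply: leq_trans Hn _; rewrite -mulnA leq_mul2l -expnMn; apply/orP; right.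
by apply: expn_homo; lia.
Qed.

Lemma bounded_below h N : exists M, forall n, (n < N)%N -> (`|h n| <= M)%N.
Proof.
elim: N => [|N [M HM]]; first by exists 0%N.
exists (M + `|h N|)%N => n; rewrite ltnS leq_eqVlt => /orP[/eqP->|/HM]; lia.
Qed.

Lemma growth_sum r k h : (0 < k)%N ->
  growth r (fun n => h n - h (n - k)%N) -> growth r.+1 h.
Proof.
move=> k0; case: r => [/growth_ev0[N H]|r [C [n0 H]]].
  have [M HM] := bounded_below h (N + k).
  suff HB n : (`|h n| <= M)%N by exists M, 0%N => n _; rewrite expn1 leq_mul2r HB orbT.
  elim/ltn_ind: n => n IH; case: (ltnP n (N + k)) => [/HM//|nn].
  have := H n ltac:(lia); have := IH (n - k)%N ltac:(lia); lia.
have [M HM] := bounded_below h (n0 + k).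
have HB n : (`|h n| <= M + C * n ^ r.+1)%N.
  elim/ltn_ind: n => n IH; case: (ltnP n (n0 + k)) => [/HM|nn].
    by move=> /leq_trans; apply; apply: leq_addr.
  have n1 : (0 < n)%N by lia.
  have H2 := IH (n - k)%N ltac:(lia).
  have H1 : (`|(h n - h (n - k)%N)%R| <= C * n ^ r)%N.
    by have := H n ltac:(lia); rewrite expnSr mulnA leq_pmul2r.
  have H3 : ((n - k) ^ r.+1 <= (n - k) * n ^ r)%N.
    rewrite expnS leq_mul2l; apply/orP; right.
    by apply: expn_homo; apply: leq_subr.
  have H4 : (C * (n - k) ^ r.+1 <= C * ((n - k) * n ^ r))%N by rewrite leq_mul2l H3 orbT.
  have H5 : (C * n ^ r + C * ((n - k) * n ^ r) <= C * n ^ r.+1)%N.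
    rewrite -mulnDr leq_mul2l -mulSn expnS leq_mul2r; apply/orP; right.
    by apply/orP; right; lia.
  lia.
exists (M + C)%N, 1%N => n n1.
rewrite expnSr mulnA leq_mul2r; apply/orP; right; apply: leq_trans (HB n) _.
by rewrite mulnDl leq_add2r leq_pmulr// expn_gt0 n1.
Qed.

(** The error for d + 1 is n - k times the error for d, minus (d + 1) k^2 n^d. *)
Lemma growth_pow_diff d k : growth d (fun n =>
  (n ^ d.+1)%:Z - ((n - k) ^ d.+1)%:Z - (d.+1 * k * n ^ d)%:Z).
Proof.
elim: d => [|d IH].
  apply/growth_ev0; exists k => n kn; rewrite !expn1 expn0; lia.
pose E n : int := (n ^ d.+1)%:Z - ((n - k) ^ d.+1)%:Z - (d.+1 * k * n ^ d)%:Z.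
apply: (@growth_eq _ _ (fun n => n%:Z * E n - k%:Z * E n - (d.+1 * k * k)%:Z * (n ^ d)%:Z) k).
  move=> n kn; rewrite /E; have [m nE] : exists m, n = (m + k)%N by exists (n - k)%N; lia.
  rewrite nE addnK.
  rewrite !(expnS _ d.+1) (expnS (m + k)); move: (m ^ d.+1)%N ((m + k) ^ d)%N => b z; lia.
apply: growthB; last by apply: growthZ; apply: growth_exp.
apply: growthB; first exact: growth_muln.
by apply: growthZ; apply: growthW IH.
Qed.

End Growth.

(** * Eventually polynomial functions *)

Section EventuallyPolynomial.
Implicit Types (h g : nat -> int) (r s k n : nat) (P : {poly rat}).

(** The bound is on the size, that is, the degree is less than r; this matches the indexing of
    [growth r]. *)
Definition epoly r h := exists P, (size P <= r)%N /\
  exists n0, forall n, (n0 <= n)%N -> P.[n%:R] = (h n)%:~R.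

Lemma epoly_eq r h g N : (forall n, (N <= n)%N -> h n = g n) -> epoly r g -> epoly r h.
Proof.
move=> hg [P [sP [n0 H]]]; exists P; split=> //; exists (maxn N n0) => n.
by rewrite geq_max => /andP[/hg-> /H].
Qed.

Lemma epolyD r h g : epoly r h -> epoly r g -> epoly r (fun n => h n + g n).
Proof.
move=> [P [sP [n0 H]]] [Q [sQ [n1 G]]]; exists (P + Q); split.
  by apply: leq_trans (size_polyD _ _) _; rewrite geq_max sP.
exists (maxn n0 n1) => n; rewrite geq_max => /andP[/H Hn /G Gn].
by rewrite hornerD Hn Gn intrD.
Qed.

Lemma epolyN r h : epoly r h -> epoly r (fun n => - h n).
Proof.
move=> [P [sP [n0 H]]]; exists (- P); rewrite size_polyN; split=> //.
by exists n0 => n /H Hn; rewrite hornerN Hn intrN.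
Qed.

Lemma epolyB r h g : epoly r h -> epoly r g -> epoly r (fun n => h n - g n).
Proof. by move=> hr gr; apply: epolyD => //; apply: epolyN. Qed.

Lemma size_comp_subX P (c : rat) : size (P \Po ('X - c%:P)) = size P.
Proof. by rewrite size_comp_poly2// size_XsubC. Qed.

Lemma epoly_subn r k h : epoly r h -> epoly r (fun n => h (n - k)%N).
Proof.
move=> [P [sP [n0 H]]]; exists (P \Po ('X - (k%:R)%:P)).
rewrite size_comp_subX; split=> //; exists (n0 + k)%N => n nn.
rewrite horner_comp !hornerE -natrB; last by lia.
by apply: H; lia.
Qed.

Lemma poly_antidiff P : exists Q : {poly rat}, (size Q <= (size P).+1)%N /\
  forall x : rat, Q.[x] - Q.[x - 1] = P.[x].
Proof.
move: {2}(size P) (leqnn (size P)) => s; elim: s P => [|s IH] P.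
  rewrite leqn0 size_poly_eq0 => /eqP->; exists 0; rewrite size_poly0; split=> // x.
  by rewrite !horner0 subr0.
rewrite leq_eqVlt => /orP[/eqP sP|]; last by rewrite ltnS; apply: IH.
(* The difference of c X^(s+1) has leading term c (s+1) X^s, which has to be that of P. *)
pose c := lead_coef P / s.+1%:R.
pose T : {poly rat} := c%:P * 'X^(s.+1).
pose D := T - (T \Po ('X - 1%:P)).
have s0 : s.+1%:R != 0 :> rat by rewrite pnatr_eq0.
have lP : lead_coef P != 0 by rewrite lead_coef_eq0 -size_poly_eq0 sP.
have c0 : c != 0 by rewrite mulf_neq0// invr_neq0.
have sT : size T = s.+2 by rewrite size_Cmul// size_polyXn.
have DE : D = c%:P * ('X^(s.+1) - ('X - 1%:P) ^+ s.+1).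
  by rewrite /D /T comp_polyM comp_polyC rmorphXn /= comp_polyX mulrBr.
have coD i : (s <= i)%N -> D`_i = if i == s then lead_coef P else 0.
  move=> si; rewrite DE coefCM coefB coefXn.
  have -> : ('X - 1%:P) ^+ s.+1 = \sum_(j < s.+2) ((-1) ^+ (s.+1 - j) *+ 'C(s.+1, j)) *: 'X^j :> {poly rat}.
    rewrite addrC exprDn; apply: eq_bigr => j _.
    by rewrite -polyCN -polyC_exp mul_polyC scalerMnl.
  rewrite coef_sum.
  under eq_bigr do rewrite coefZ coefXn.
  have [->|isn] := eqVneq i s.
    rewrite (bigD1 (Ordinal (leqnSn s.+1)))//= eqxx mulr1 big1 => [|j]; last first.
      by rewrite -val_eqE /= eq_sym => /negbTE->; rewrite mulr0.
    rewrite ltn_eqF// sub0r addr0 subSnn expr1 binSn mulNrn opprK /c.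
    by rewrite divfK.
  have [->|isn1] := eqVneq i s.+1.
    rewrite (bigD1 ord_max)//= eqxx mulr1 big1 => [|j]; last first.
      by rewrite -val_eqE /= eq_sym => /negbTE->; rewrite mulr0.
    by rewrite subnn expr0 binn addr0 subrr mulr0.
  rewrite big1 ?subrr ?mulr0// => j _.
  suff /negbTE-> : i != j by rewrite mulr0.
  by apply/eqP => ij; have := ltn_ord j; rewrite -ij; lia.
have [|Q [sQ HQ]] := IH (P - D).
  apply/leq_sizeP => j sj; rewrite coefB coD//; have [->|js] := eqVneq j s.
    by rewrite lead_coefE sP subrr.
  by rewrite nth_default ?subr0// sP; lia.
exists (Q + T); split.
  apply: leq_trans (size_polyD _ _) _; rewrite geq_max sT sP ltnSn andbT.
  apply: leq_trans sQ _; rewrite ltnS; apply: leq_trans (leqnSn _).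
  apply/leq_sizeP => j sj; rewrite coefB coD//; have [->|js] := eqVneq j s.
    by rewrite lead_coefE sP subrr.
  by rewrite nth_default ?subr0// sP; lia.
move=> x; rewrite !hornerD opprD addrACA HQ.
have -> : T.[x] - T.[x - 1] = D.[x] by rewrite /D hornerD hornerN horner_comp !hornerE.
by rewrite hornerD hornerN subrK.
Qed.

(** The step has to be 1: with a larger step, h would be polynomial on each residue class only. *)
Lemma epoly_sum r h : epoly r (fun n => h n - h (n - 1)%N) -> epoly r.+1 h.
Proof.
move=> [P [sP [n0 H]]]; have [Q [sQ HQ]] := poly_antidiff P.
pose c := (h n0)%:~R - Q.[n0%:R]; exists (Q + c%:P); split.
  apply: leq_trans (size_polyD _ _) _; rewrite geq_max (leq_trans sQ)// size_polyC.
  by case: (c != 0).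
exists n0 => n /subnK<-; elim: (n - n0)%N => [|m IH].
  by rewrite add0n hornerD hornerC /c addrC subrK.
rewrite !hornerD !hornerC in IH *.
have := H (m.+1 + n0)%N ltac:(lia); rewrite -HQ rmorphB /=.
rewrite (_ : (m.+1 + n0 - 1 = m + n0)%N); last by lia.
have -> : (m.+1 + n0)%:R = (m + n0)%:R + 1 :> rat by rewrite addSn -addn1 natrD.
rewrite addrK -IH => E.
by rewrite -[X in X + c](subrK Q.[(m + n0)%:R]) E -addrA subrK.
Qed.

Lemma horner_bound P l : (size P <= l)%N ->
  exists C : rat, forall n, (0 < n)%N -> `|P.[n%:R]| * n%:R <= C * n%:R ^+ l.
Proof.
move=> sP; exists (\sum_(i < l) `|P`_i|) => n n0.
rewrite (horner_coef_wide _ sP) mulr_suml.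
apply: le_trans (ler_wpM2r (ler0n _ n) (ler_norm_sum _ _ _)) _.
rewrite mulr_suml; apply: ler_sum => i _.
rewrite normrM -mulrA ler_wpM2l// normrX normr_nat -exprSr.
by apply: ler_weXn2l => //; rewrite ler1n.
Qed.

Lemma size_poly_growth P l (C : rat) N :
  (forall n, (N <= n)%N -> `|P.[n%:R]| * n%:R <= C * n%:R ^+ l) -> (size P <= l)%N.
Proof.
move=> H; rewrite leqNgt; apply/negP => lP.
have sP : size P = (size P).-1.+1 by rewrite prednK//; apply: leq_ltn_trans lP.
set d := (size P).-1 in sP; pose a := lead_coef P.
have ld : (l <= d)%N by rewrite sP in lP.
have a0 : 0 < `|a| by rewrite normr_gt0 lead_coef_eq0 -size_poly_eq0 sP.
have [|C' HC'] := @horner_bound (P - a *: 'X^d) d.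
  apply/leq_sizeP => j; rewrite coefB coefZ coefXn leq_eqVlt => /orP[/eqP<-|dj].
    by rewrite eqxx mulr1 /a lead_coefE subrr.
  by rewrite nth_default ?sP// gtn_eqF// mulr0 subr0.
pose b := Num.bound ((`|C| + `|C'|) / `|a|); pose n := (N + b.+1)%N.
have n0 : (0 < n)%N by rewrite /n addnS.
have := H n (leq_addr _ _); have := HC' n n0.
rewrite hornerD hornerN hornerZ hornerXn.
set x : rat := n%:R; set p := P.[x] => H1 H2.
have x0 : 0 < x by rewrite ltr0n.
have H3 : `|a| * x ^+ d * x <= (`|C| + `|C'|) * x ^+ d.
  have -> : `|a| * x ^+ d = `|p - (p - a * x ^+ d)|.
    by rewrite opprB addrCA subrr addr0 normrM (ger0_norm (exprn_ge0 _ (ltW x0))).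
  apply: le_trans (ler_wpM2r (ltW x0) (ler_normB _ _)) _.
  rewrite mulrDl mulrDl; apply: lerD.
    apply: le_trans H2 _; apply: le_trans (ler_wpM2r (exprn_ge0 _ (ltW x0)) (ler_norm C)) _.
    by rewrite ler_wpM2l//; apply: ler_weXn2l => //; rewrite ler1n.
  apply: le_trans H1 _; apply: ler_wpM2r; [exact/exprn_ge0/ltW|exact: ler_norm].
move: H3; rewrite mulrAC ler_pM2r ?exprn_gt0// leNgt => /negP; apply.
rewrite mulrC -ltr_pdivrMr//; apply: lt_le_trans (archi_boundP _) _.
  by apply: divr_ge0 => //; apply: addr_ge0.
by rewrite /x ler_nat /n -/b addnS; apply: leqW; apply: leq_addl.
Qed.

Lemma growth_rat r h : growth r h <-> exists (C : rat) N,
  forall n, (N <= n)%N -> `|(h n)%:~R| * n%:R <= C * n%:R ^+ r.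
Proof.
have E n : `|(h n)%:~R : rat| * n%:R = (`|h n|%N * n)%N%:R.
  by rewrite -intr_norm -abszE natrM.
split=> [[C [N H]]|[C [N H]]].
  by exists C%:R, N => n /H Hn; rewrite E -natrX -natrM ler_nat.
exists (Num.bound `|C|), N => n /H; rewrite E => Hn.
rewrite -(ler_nat rat) [leRHS]natrM natrX; apply: le_trans Hn _.
apply: ler_wpM2r; first by apply: exprn_ge0.
by apply: le_trans (ler_norm _) (ltW (archi_boundP _)).
Qed.

Lemma epoly_growth r h : epoly r h -> growth r h.
Proof.
move=> [P [sP [N H]]]; have [C HC] := horner_bound sP.
apply/growth_rat; exists C, N.+1 => n Nn.
by rewrite -H; [apply: HC; lia|lia].
Qed.

Lemma growth_epoly r s h : epoly r h -> growth s h -> epoly s h.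
Proof.
move=> [P [sP [N H]]] /growth_rat[C [N' H']]; exists P; split; last by exists N.
apply: (@size_poly_growth _ _ C (N + N')) => n nn.
by rewrite H; [apply: H'; lia|lia].
Qed.

(** P without its monomial of degree r, and X^r - (X - k)^r, both have degree less than r. This
    bounds the growth of the difference, and a polynomial of bounded growth has bounded degree. *)
Lemma epoly_diff r k h : epoly r.+1 h -> epoly r (fun n => h n - h (n - k)%N).
Proof.
move=> hp; have [P [sP [N H]]] := hp; have hp' := epolyB hp (epoly_subn k hp).
apply: growth_epoly hp' _; case: hp => {}P [{}sP [{}N {}H]].
pose D n : int := (n ^ r)%N%:Z - ((n - k) ^ r)%N%:Z.
have [Q [sQ HQ]] : exists Q : {poly rat}, (size Q <= r)%N /\
    forall n, (k <= n)%N -> Q.[n%:R] = (D n)%:~R.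
  exists ('X^r - ('X - k%:R%:P) ^+ r); split.
    have -> : ('X - k%:R%:P) ^+ r = 'X^r \Po ('X - k%:R%:P) :> {poly rat}.
      by rewrite rmorphXn /= comp_polyX.
    have mon : 'X^r \Po ('X - k%:R%:P) \is @monic rat.
      by rewrite rmorphXn /= comp_polyX monic_exp// monicXsubC.
    apply/leq_sizeP => j; rewrite coefB coefXn leq_eqVlt => /orP[/eqP<-|rj].
      rewrite eqxx; have := monicP mon; rewrite lead_coefE size_comp_subX size_polyXn => ->.
      exact: subrr.
    by rewrite gtn_eqF// nth_default ?subrr// size_comp_subX size_polyXn.
  move=> n kn; rewrite !hornerE /D rmorphB /= -!pmulrn !natrX; congr (_ - _).
  by rewrite natrB.
have [R [sR RE]] : exists R : {poly rat}, (size R <= r)%N /\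
    forall x, R.[x] = P.[x] - P`_r * x ^+ r.
  exists (P - P`_r *: 'X^r); split=> [|x]; last by rewrite !hornerE.
  apply/leq_sizeP => j; rewrite coefB coefZ coefXn leq_eqVlt => /orP[/eqP<-|rj].
    by rewrite eqxx mulr1 subrr.
  by rewrite nth_default ?gtn_eqF ?mulr0 ?subr0//; apply: leq_trans sP _.
have [C HC] : exists C : rat, forall n, (0 < n)%N ->
    `|(R - (R \Po ('X - k%:R%:P)) + P`_r *: Q).[n%:R]| * n%:R <= C * n%:R ^+ r.
  apply: horner_bound; apply: leq_trans (size_polyD _ _) _.
  rewrite geq_max (leq_trans (size_scale_leq _ _) sQ) andbT.
  apply: leq_trans (size_polyD _ _) _.
  by rewrite geq_max sR size_polyN size_comp_subX.
apply/growth_rat; exists C, (N + k).+1 => n nn.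
have := HC n ltac:(lia).
suff -> : (R - (R \Po ('X - k%:R%:P)) + P`_r *: Q).[n%:R] = (h n - h (n - k)%N)%:~R by [].
rewrite !hornerD hornerN horner_comp hornerZ HQ; last by lia.
rewrite !hornerE -natrB; last by lia.
rewrite !RE /D !H; [|lia|lia].
by rewrite !rmorphB /= -!pmulrn !natrX; lra.
Qed.

End EventuallyPolynomial.

(** * Hilbert functions and the asymptotics of the multiplicity symbol *)

Section Hilbert.
Variables (A : comNzRingType) (noe : inoeth A) (S : A -> Prop) (Sm : mulset S).
Implicit Types (I J K N : ideal A) (U V W F : nat -> ideal A) (fs : seq (A * nat)).
Local Notation len := (len S).
Local Notation fin := (fin S).

Section HilbertStep.
Variables (f : A) (k : nat) (fs : seq (A * nat)) (U V : nat -> ideal A).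
Hypotheses (k0 : (0 < k)%N) (VU : gle V U).
Hypotheses (clU : gclosed ((f, k) :: fs) U) (clV : gclosed ((f, k) :: fs) V).
Hypothesis noeU : gnoeth ((f, k) :: fs) U V.
Hypothesis finU : forall n, fin (U n) (V n).

(** For [f] of degree k acting on U / V, the cokernel is U / [gcoker] and the kernel is [gker] / V.
    Below degree k nothing is hit, and truncated subtraction must not suggest otherwise. *)
Definition gcoker n := V n +i (if (k <= n)%N then imul f (U (n - k)%N) else ibot).
Definition gker n := icolon (V (n + k)%N) f &i U n.

Lemma gcokerE n : (k <= n)%N -> gcoker n = V n +i imul f (U (n - k)%N).
Proof. by rewrite /gcoker => ->. Qed.

Lemma gcoker_le : gle gcoker U.
Proof.
move=> n; apply: ile_add => //; case: leqP => // kn.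
by have := gclosedH clU (n - k)%N; rewrite subnK.
Qed.
Lemma gcoker_ge : gle V gcoker. Proof. by move=> n; apply: ile_addl. Qed.

Lemma gcoker_in n : imul f (U n) <=i gcoker (n + k)%N.
Proof. by rewrite /gcoker leq_addl addnK; apply: ile_addr. Qed.

Lemma gcoker_closed : gclosed fs gcoker.
Proof.
move=> fk fks n; rewrite /gcoker imulD; apply: isumS.
  exact: (gclosedW clV fks).
case: leqP => kn; last by apply/imulP => x ->; rewrite mulr0; apply: id0.
rewrite (leq_trans kn (leq_addr _ _)) imulA mulrC -imulA -addnBAC//; apply: imulS.
exact: (gclosedW clU fks).
Qed.

Lemma gcoker_noeth : gnoeth fs U gcoker.
Proof.
move=> W VW WU cW.
have [||n0 Hn0] := @noeU W _ WU.
- by move=> n; apply: ile_trans (VW n); apply: gcoker_ge.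
- apply: gclosed_cons => //= n; apply: ile_trans (VW _).
  by apply: ile_trans (@gcoker_in n); apply: imulS; apply: WU.
exists (n0 + k)%N => n nn; apply: ile_trans (Hn0 n _) _; first by lia.
rewrite /= isumA; apply: isumS => //; rewrite /gcoker.
rewrite (_ : (k <= n)%N = true); last by lia.
by apply: isumS => //; apply: imulS; apply: WU.
Qed.

Lemma gker_le : gle gker U. Proof. by move=> n; apply: ile_capr. Qed.
Lemma gker_ge : gle V gker.
Proof.
move=> n; apply: ile_cap => //.
by move=> x Vx; apply: (gclosedH clV); exists x.
Qed.

Lemma gker_closed : gclosed fs gker.
Proof.
move=> fk fks n; apply/imulP => x [Vx Ux]; split; last first.
  by apply: (gclosedW clU fks); exists x.
rewrite icolonE mulrCA addnAC; apply: (gclosedW clV fks); by exists (f * x).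
Qed.

Lemma gker_noeth : gnoeth fs gker V.
Proof.
move=> W VW WU cW.
have fW n : imul f (W n) <=i V (n + k)%N.
  by apply/imulP => x /WU[].
have [||n0 Hn0] := @noeU W VW.
- by move=> n; apply: ile_trans (WU n) _; apply: gker_le.
- by apply: gclosed_cons => //= n; apply: ile_trans (fW n) _; apply: VW.
exists (n0 + k)%N => n nn; apply: ile_trans (Hn0 n _) _; first by lia.
rewrite /= isumA; apply: isumS => //; apply: ile_add => //.
by have := fW (n - k)%N; rewrite subnK//; lia.
Qed.

Lemma gcoker_fin n : fin (U n) (gcoker n).
Proof. exact: (fin_lel Sm (@gcoker_ge n) (@finU n)). Qed.
Lemma gker_fin n : fin (gker n) (V n).
Proof. exact: (fin_ler (@gker_le n)). Qed.

(** Additivity of length along the exact sequence of kernel and cokernel of [f]. *)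
Lemma hilbert_step n : (k <= n)%N ->
  (len (U n) (V n))%:Z - (len (U (n - k)) (V (n - k)))%:Z =
  (len (U n) (gcoker n))%:Z - (len (gker (n - k)) (V (n - k)))%:Z.
Proof.
move=> kn; rewrite (lenD Sm (@gcoker_ge n) (@gcoker_le n))//.
rewrite (lenD Sm (@gker_ge (n - k)%N) (@gker_le (n - k)%N))//.
have -> : gcoker n = imul f (U (n - k)%N) +i V n by rewrite /gcoker kn isumC.
have [_ ->] := len_imul Sm (U (n - k)%N) (V n) f.
  by rewrite /gker subnK//; lia.
by have := fin_lel Sm (@gker_ge (n - k)%N) (finU (n - k)%N); rewrite /gker subnK.
Qed.

End HilbertStep.

(** Kernel and cokernel of the first operator are modules over the remaining ones, so the
    differences are known by induction. Steps larger than 1 allow only the growth bound; generators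
    of degree 1 give a polynomial. *)
Theorem hilbert_function fs U V : gpos fs -> gle V U -> gclosed fs U -> gclosed fs V ->
  gnoeth fs U V -> (forall n, fin (U n) (V n)) ->
  growth (size fs) (fun n => (len (U n) (V n))%:Z) /\
  ((forall fk, fk \in fs -> fk.2 = 1%N) ->
     epoly (size fs) (fun n => (len (U n) (V n))%:Z)).
Proof.
elim: fs U V => [|[f k] fs IH] U V fs0 VU clU clV noeU finU.
  have [|||n0 H0] := noeU U => //.
  have H n : (n0 <= n)%N -> (len (U n) (V n))%:Z = 0.
    move=> /H0 H; rewrite (len_sle Sm (VU n) _).2//; apply: (ile_sle Sm).
    by apply: ile_trans H _; apply: ile_add.
  split=> [|_]; first by apply/growth_ev0; exists n0.
  exists 0; split; first by rewrite size_poly0.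
  by exists n0 => n /H ->; rewrite horner0.
have k0 := gposH fs0; have fs0' := gposW fs0.
have [Gc Pc] := IH _ _ fs0' (gcoker_le VU clU) (gclosedW clU) (gcoker_closed clU clV)
  (gcoker_noeth k0 noeU) (gcoker_fin f k finU).
have [Gk Pk] := IH _ _ fs0' (gker_ge VU clV) (gker_closed clU clV) (gclosedW clV)
  (gker_noeth k0 noeU) (gker_fin f k finU).
have step := hilbert_step k0 VU clU clV finU.
pose c n : int := len (U n) (gcoker f k U V n).
pose u n : int := len (gker f k U V n) (V n).
split=> /= [|one].
  apply: (growth_sum k0); apply: (growth_eq (g := fun n => c n - u (n - k)%N) step).
  by apply: growthB => //; apply: (growth_subn k (h := u)).
have k1 : k = 1%N by apply: (one (f, k)); rewrite inE eqxx.
have one' fk : fk \in fs -> fk.2 = 1%N by move=> H; apply: one; rewrite inE H orbT.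
rewrite k1 in step Pc Pk @c @u *; apply: epoly_sum.
apply: (epoly_eq (g := fun n => c n - u (n - 1)%N) step).
by apply: epolyB; [apply: Pc|apply: (epoly_subn 1 (h := u)); apply: Pk].
Qed.

(* The multiplicity symbol e(f_1, ..., f_d | I / J) of Northcott and Wright, with  *)
(* the length replaced by an arbitrary additive function [phi].                    *)
Fixpoint sym fs (phi : ideal A -> ideal A -> int) I J : int :=
  if fs is fk :: fs' then
    sym fs' phi I (imul fk.1 I +i J) - sym fs' phi (icolon J fk.1 &i I) J
  else phi I J.

Definition lenz I J : int := len I J.

Section SymbolStep.
Variables (f : A) (k : nat) (fs : seq (A * nat)) (I J : ideal A) (F : nat -> ideal A).
Hypotheses (k0 : (0 < k)%N) (fs0 : gpos fs).
Hypotheses (F0 : F 0%N = I) (Fdec : forall n, F n.+1 <=i F n) (JF : forall n, J <=i F n).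
Hypotheses (clF : gclosed ((f, k) :: fs) F) (noeF : gnoeth ((f, k) :: fs) F (fun=> J)).
Hypothesis finF : forall n, fin I (F n).

(** For the filtration F of I / J: [Fq] is induced on the cokernel of [f], [Fk] on its kernel N / J,
    and W / Y measures how far [f] is from being strict for the filtrations. *)
Let N := icolon J f &i I.
Let J' := imul f I +i J.
Let Fq n := F n +i imul f I.
Let Fk n := icolon J f &i F n.
Let W n := F n &i J'.
Let Y n := imul f (F (n - k)%N) +i J.

Lemma filt_anti m n : (m <= n)%N -> F n <=i F m.
Proof.
elim: n => [|n IH]; first by rewrite leqn0 => /eqP->.
rewrite leq_eqVlt => /orP[/eqP->//|]; rewrite ltnS => /IH H.
exact: (ile_trans (@Fdec n) H).
Qed.

Lemma filt_le n : F n <=i I. Proof. by rewrite -F0; apply: filt_anti. Qed.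

Lemma quot_noeth : gnoeth fs Fq (fun=> J').
Proof.
move=> G JG GF cG; pose G' n := G n &i F n.
have GE n : G n <=i G' n +i imul f I.
  move=> x Gx; have [a [b [Fa fb E]]] := GF _ _ Gx.
  exists a, b; split=> //; split=> //.
  by rewrite -[a](addrK b) -E; apply: idB => //; apply: JG; apply: ile_addl.
have [|||n0 H0] := @noeF G'.
- by move=> n; apply: ile_cap => //; apply: (ile_trans _ (@JG n)); apply: ile_addr.
- by move=> n; apply: ile_capr.
- apply: gclosed_cons => [n /=|fk fks n]; apply/imulP => x [Gx Fx]; split.
  + by apply: JG; apply: ile_addl; exists x => //; apply: filt_le Fx.
  + by apply: (gclosedH clF); exists x.
  + by apply: cG => //; exists x.
  + by apply: (gclosedW clF fks); exists x.
exists n0 => n nn; apply: (ile_trans (@GE n)); apply: ile_add.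
  apply: (ile_trans (@H0 n nn)); rewrite /= isumA; apply: isumS; last first.
    by apply: gsumS => m; apply: ile_capl.
  apply: ile_add; first exact: ile_addr.
  by apply: ile_addlW; apply: imulS => x [_ /filt_le].
by apply: ile_addlW; apply: ile_addl.
Qed.

Lemma sub_noeth : gnoeth fs Fk (fun=> J).
Proof.
move=> G JG GF cG.
have [||n0 H0] := @noeF G JG.
- by move=> n; apply: (ile_trans (@GF n)); apply: ile_capr.
- apply: gclosed_cons => //= n; apply/imulP => x /GF[fx _]; exact: JG.
exists n0 => n nn; apply: (ile_trans (@H0 n nn)); rewrite /= isumA; apply: isumS => //.
by apply: ile_add => //; apply/imulP => x /GF[].
Qed.

Lemma diff_le : gle Y W.
Proof.
move=> n; apply: ile_add; last by apply: ile_cap; [exact: JF|exact: ile_addr].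
apply: ile_cap; last by apply: ile_addlW; apply: imulS; apply: filt_le.
apply: (ile_trans (gclosedH clF (n - k)%N)); apply: filt_anti => /=; lia.
Qed.

Lemma diff_closedW : gclosed fs W.
Proof.
move=> fk fks n; apply/imulP => x [Fx Jx]; split; last exact: idM.
by apply: (gclosedW clF fks); exists x.
Qed.

Lemma diff_closedY : gclosed fs Y.
Proof.
move=> fk fks n; rewrite imulD; apply: isumS; last exact: imul_le.
rewrite imulA mulrC -imulA; apply: imulS.
apply: (ile_trans (gclosedW clF fks (n - k)%N)); apply: filt_anti; lia.
Qed.

(** Since [f] kills W / Y, this graded module is noetherian over [fs] alone. Its length therefore
    grows one order too slowly to influence the leading term. *)
Lemma diff_noeth : gnoeth fs W Y.
Proof.
move=> G YG GW cG.
have [|||n0 H0] := @noeF G.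
- by move=> n; apply: (ile_trans _ (@YG n)); apply: ile_addr.
- by move=> n; apply: (ile_trans (@GW n)); apply: ile_capl.
- apply: gclosed_cons => //= n; apply: (ile_trans _ (@YG _)); apply: ile_addlW.
  by rewrite addnK; apply: imulS => x /GW[].
exists n0 => n nn; apply: (ile_trans (@H0 n nn)); rewrite /= isumA; apply: isumS => //.
apply: ile_add; first exact: ile_addr.
by apply: ile_addlW; apply: imulS => x /GW[].
Qed.

Lemma symbol_identity n : (k <= n)%N ->
  fin (W n) (Y n) /\ fin N (Fk n) /\
  (len I (F n))%:Z - (len I (F (n - k)))%:Z =
    (len I (Fq n))%:Z - (len N (Fk (n - k)))%:Z - (len (W n) (Y n))%:Z.
Proof.
move=> kn; set C := icolon (F n) f &i I.
have FC : F (n - k)%N <=i C.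
  move=> x Fx; split; last exact: filt_le Fx.
  by have := gclosedH clF (n - k)%N; rewrite /= subnK//; apply; exists x.
have CI : C <=i I by exact: ile_capr.
have finC : fin C (F (n - k)%N) by apply: (fin_ler CI).
have NC : N <=i C by apply: icapS => //; apply: icolonS; apply: JF.
have E1 : len I (F n) = (len I (Fq n) + len I C)%N.
  rewrite (lenD Sm (@ile_addl _ (F n) (imul f I)) _ (finF n)); last first.
    by apply: ile_add; [apply: filt_le|apply: imul_le].
  congr addn; rewrite isumC; apply: (len_imul Sm I (F n) f).2.
  exact: (fin_lel Sm FC (@finF _)).
have E2 : len I (F (n - k)) = (len I C + len C (F (n - k)%N))%N.
  by apply: lenD.
have FNk : F (n - k)%N <=i N +i F (n - k)%N by exact: ile_addr.
have E3 : len C (F (n - k)%N) = (len C (N +i F (n - k)%N) + len N (Fk (n - k)%N))%N.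
  rewrite (lenD Sm FNk _ finC); last by apply: ile_add.
  congr addn.
  have capE : N &i F (n - k)%N = Fk (n - k)%N.
    apply: ideal_eq => [x [[fx _] Fx]//|x [fx Fx]]; split=> //; split=> //.
    exact: filt_le Fx.
  rewrite -capE; apply: (len_sumcap Sm N (F (n - k)%N)).2.
  apply/(len_sumcap Sm N (F (n - k)%N)).1; apply: (fin_ler _ finC).
  by apply: ile_add.
have finN : fin N (Fk n).
  have capE : N &i F n = Fk n.
    apply: ideal_eq => [x [[fx _] Fx]//|x [fx Fx]]; split=> //; split=> //.
    exact: filt_le Fx.
  rewrite -capE; apply/(len_sumcap Sm N (F n)).1; apply: (fin_ler _ (finF n)).
  by apply: ile_add; [apply: ile_capr|apply: filt_le].
have WE : W n = imul f C +i Y n.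
  apply: ideal_eq.
    move=> x [Fx [_ [j [[i Ii ->] Jj xE]]]]; exists (f * i), j; split=> //; last first.
      exact: ile_addr.
    exists i => //; split=> //; rewrite icolonE.
    by rewrite -[f * i](addrK j) -xE; apply: idB => //; apply: JF.
  apply: ile_add; last exact: diff_le.
  by apply/imulP => x [Fx Ix]; split=> //; apply: ile_addl; exists x.
have KE : icolon (Y n) f &i C = N +i F (n - k)%N.
  apply: ideal_eq.
    move=> x [[_ [j [[y Fy ->] Jj E]]] [_ Ix]]; exists (x - y), y; rewrite subrK; split=> //.
    split; first by rewrite icolonE mulrBr E addrC addKr.
    by apply: idB => //; apply: filt_le Fy.
  apply: ile_add; apply: ile_cap => //.
    by move=> x [fx _]; apply: ile_addr.
  by move=> x Fx; apply: ile_addl; exists x.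
have finK : fin C (N +i F (n - k)%N) by exact: (fin_lel Sm FNk finC).
have [F4 E4] := len_imul Sm C (Y n) f; rewrite KE -WE in F4 E4.
split; first by apply/F4.
by split=> //; rewrite E4// E1 E2 E3; lia.
Qed.

End SymbolStep.

Definition kprod fs := (\prod_(fk <- fs) fk.2)%N.

Lemma growth_powB d k : growth d (fun n => (n ^ d)%:Z - ((n - k) ^ d)%:Z).
Proof.
case: d => [|d]; first by apply: (@growth_eq _ _ _ 0 _ (growth0 0)) => n _; rewrite !expn0 subrr.
apply: (@growth_eq _ _ (fun n => ((n ^ d.+1)%:Z - ((n - k) ^ d.+1)%:Z - (d.+1 * k * n ^ d)%:Z)
   + (d.+1 * k)%:Z * (n ^ d)%:Z) 0) => [n _|]; first by rewrite -PoszM subrK.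
apply: growthD; first exact: growthW (growth_pow_diff d k).
by apply: growthZ; apply: growth_exp.
Qed.

(** The length of I / F(n) is e n^d / (d! k_1 ... k_d) up to O(n^(d-1)), where e is the symbol.
    [symbol_identity] writes its difference with step k_1 through the cokernel and the kernel of
    f_1, just as [sym] is defined. *)
Theorem symbol_asymptotics fs I J F : gpos fs -> F 0%N = I -> (forall n, F n.+1 <=i F n) ->
  (forall n, J <=i F n) -> gclosed fs F -> gnoeth fs F (fun=> J) ->
  (forall n, fin I (F n)) ->
  growth (size fs) (fun n => ((size fs)`! * kprod fs)%:Z * (len I (F n))%:Z
                             - sym fs lenz I J * (n ^ size fs)%:Z).
Proof.
elim: fs I J F => [|[f k] fs IH] I J F fs0 F0 Fdec JF clF noeF finF.
  have [n0 H0] := noeF F JF (fun n => @ile_refl _ (F n)) clF.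
  apply/growth_ev0; exists n0 => n /H0 H.
  have -> : F n = J by apply: ideal_eq => //; apply: ile_trans H _; apply: ile_add.
  by rewrite /kprod big_nil fact0 expn0 mul1n mulr1 mul1r subrr.
have k0 := gposH fs0; have fs0' := gposW fs0.
have Fle := filt_le F0 Fdec.
have ident := symbol_identity k0 F0 Fdec JF clF finF.
set N := icolon J f &i I in ident *.
set J' := imul f I +i J in ident.
pose d := size fs; pose K := kprod fs.
have Gq : growth d (fun n => (d`! * K)%:Z * (len I (F n +i imul f I))%:Z
    - sym fs lenz I J' * (n ^ d)%:Z).
  apply: IH => //.
  - by rewrite F0 isum_idr//; apply: imul_le.
  - by move=> n; apply: isumS.
  - by move=> n; rewrite /J' isumC; apply: isumS.
  - move=> fk fks n; rewrite imulD; apply: isumS; last exact: imul_le.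
    exact: (gclosedW clF fks).
  - exact: (quot_noeth F0 Fdec JF clF noeF).
  - by move=> n; apply: (fin_lel Sm _ (finF n)); apply: ile_addl.
have Gk : growth d (fun n => (d`! * K)%:Z * (len N (icolon J f &i F n))%:Z
    - sym fs lenz N J * (n ^ d)%:Z).
  apply: IH => //.
  - by rewrite F0.
  - by move=> n; apply: icapS.
  - by move=> n; apply: ile_cap => //; apply: icolon_le.
  - move=> fk fks n; apply/imulP => x [fx Fx]; split; first exact: idM.
    by apply: (gclosedW clF fks); exists x.
  - exact: (sub_noeth noeF).
  - move=> n; have [_ [+ _]] := ident (n + k)%N (leq_addl _ _).
    apply: (fin_lel Sm); apply: icapS => //; apply: (filt_anti Fdec); lia.
have Gw : growth d (fun n => (len (F n &i J') (imul f (F (n - k)%N) +i J))%:Z).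
  apply: (hilbert_function (U := fun n => F n &i J')
    (V := fun n => imul f (F (n - k)%N) +i J) fs0' _ _ _ _ _).1.
  - exact: (diff_le k0 F0 Fdec JF clF).
  - exact: (diff_closedW clF).
  - exact: (diff_closedY k0 Fdec clF).
  - exact: (diff_noeth noeF).
  - move=> n; have [/ident[]//|nk] := leqP k n.
    suff -> : F n &i J' = imul f (F (n - k)%N) +i J by apply: fin_refl.
    rewrite (_ : (n - k = 0)%N) ?F0; last by lia.
    apply: icap_idr; apply: ile_add => //.
    rewrite -F0; apply: ile_trans (gclosedH clF 0) _.
    by apply: (filt_anti Fdec) => /=; lia.
pose a n : int := len I (F n).
pose s1 := sym fs lenz I J'; pose s2 := sym fs lenz N J.
have Gab := growthB (growthB Gq (growth_subn k Gk)) (growthZ (d`! * K)%:Z Gw).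
have Gpow := growthD Gab (growthZ s2 (growth_powB d k)).
(* It is enough to bound the difference with step [k]. There n^(d+1) contributes (d+1) k n^d, and
   this factor completes the factorial and the product of degrees. *)
apply: (growth_sum k0); rewrite /= -/J' -/N -/d -/s1 -/s2.
apply: (growth_eq (N := k) (g := fun n => (d.+1 * k)%:Z *
   ((d`! * K)%:Z * (len I (F n +i imul f I))%:Z - s1 * (n ^ d)%:Z
    - ((d`! * K)%:Z * (len N (icolon J f &i F (n - k)%N))%:Z - s2 * ((n - k) ^ d)%:Z)
    - (d`! * K)%:Z * (len (F n &i J') (imul f (F (n - k)%N) +i J))%:Z
    + s2 * ((n ^ d)%:Z - ((n - k) ^ d)%:Z)) + (s2 - s1) *
   ((n ^ d.+1)%:Z - ((n - k) ^ d.+1)%:Z - (d.+1 * k * n ^ d)%:Z))); last first.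
  by apply: growthD; [apply: growthZ; exact: Gpow|apply: growthZ; exact: growth_pow_diff].
move=> n kn; have [_ [_ E]] := ident n kn.
rewrite (_ : kprod ((f, k) :: fs) = k * K)%N; last by rewrite /kprod big_cons.
rewrite factS !PoszM; move: E; rewrite /=.
move: (Posz (len I (F n))) (Posz (len I (F (n - k)%N))) => x y.
move: (Posz (len I (F n +i _))) (Posz (len N _)) (Posz (len (F n &i _) _)) => u v w.
move=> /(canRL (subrK _))->.
move: (Posz (n ^ d.+1)) (Posz (n ^ d)) (Posz ((n - k) ^ d.+1)) (Posz ((n - k) ^ d)).
move: (Posz d.+1) (Posz k) (Posz d`!) (Posz K) => D k' Df K' e1 e2 e3 e4.
lia.
Qed.

End Hilbert.

(** * Multiplicity symbols *)

Definition sone (A : comNzRingType) (s : A) := s = 1.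
Definition scomp (A : comNzRingType) (p : ideal A) (s : A) := ~ p s.

Lemma sone_mulset (A : comNzRingType) : mulset (@sone A).
Proof. by split=> // s t -> ->; rewrite /sone mulr1. Qed.
#[global] Hint Resolve sone_mulset : core.

Lemma scomp_mulset (A : comNzRingType) (p : ideal A) : iprime p -> mulset (scomp p).
Proof. by move=> [p1 pM]; split=> // s t ps pt /pM[]. Qed.

Lemma scompl_comp (A : comNzRingType) (p : ideal A) : scompl (scomp p) p.
Proof. by split=> // y py; exists 1; rewrite mul1r. Qed.

Section Symbol.
Variable A : comNzRingType.
Implicit Types (I J K : ideal A) (fs : seq (A * nat)) (phi psi : ideal A -> ideal A -> int).

Definition symstep g phi I J := phi I (imul g I +i J) - phi (icolon J g &i I) J.

Lemma sym_rcons fs g k phi I J :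
  sym (rcons fs (g, k)) phi I J = sym fs (symstep g phi) I J.
Proof. by elim: fs I J => //= fk fs IH I J; rewrite !IH. Qed.

(** The recursion evaluates [phi] only on subquotients of I / J killed by all of [fs]. Thus the last
    element can be treated by one-dimensional theory once it has been moved into [phi]. *)
Lemma sym_ext fs phi psi I J : J <=i I ->
  (forall I' J', J' <=i I' -> I' <=i I -> J <=i J' ->
    (forall fk, fk \in fs -> imul fk.1 I' <=i J') -> phi I' J' = psi I' J') ->
  sym fs phi I J = sym fs psi I J.
Proof.
elim: fs I J => [|fk fs IH] I J JI H /=; first by apply: H.
congr (_ - _); apply: IH.
- by apply: ile_add => //; apply: imul_le.
- move=> I' J' JI' II JJ kill; apply: H => //.
    by apply: ile_trans JJ; apply: ile_addr.
  move=> gl; rewrite inE => /orP[/eqP->|/kill//].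
  apply: (ile_trans (@imulS _ fk.1 _ _ II)); apply: ile_trans JJ; exact: ile_addl.
- by apply: ile_cap => //; apply: icolon_le.
- move=> I' J' JI' II JJ kill; apply: H => //.
    by apply: ile_trans II _; apply: ile_capr.
  move=> gl; rewrite inE => /orP[/eqP->|/kill//].
  by apply/imulP => x /II[fx _]; apply: JJ.
Qed.

Lemma sym_sum fs (X : Type) (D : seq X) (c : X -> int) (phi : X -> ideal A -> ideal A -> int) I J :
  sym fs (fun I J => \sum_(q <- D) c q * phi q I J) I J = \sum_(q <- D) c q * sym fs (phi q) I J.
Proof.
elim: fs I J => //= fk fs IH I J; rewrite !IH -sumrB.
by apply: eq_bigr => q _; rewrite mulrBr.
Qed.

End Symbol.

(** * The symbol of a single element in dimension one *)

Section OneDim.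
Variables (A : comNzRingType) (noe : inoeth A).
Implicit Types (I J K P c : ideal A) (x g : A).
Local Notation S1 := (@sone A).
Local Notation len1 := (len S1).
Local Notation fin1 := (fin S1).
Let Sm := sone_mulset A.

(** The Euler characteristic of g on I / J: length of the cokernel minus length of the kernel. *)
Definition ez g := symstep g (lenz S1).

Lemma len_imul_sub (S : A -> Prop) (Smm : mulset S) x J P Q : icolon J x <=i P -> P <=i Q ->
  fin S Q P -> len S (imul x Q +i J) (imul x P +i J) = len S Q P.
Proof.
move=> JP PQ finQP.
have E : icolon (imul x P +i J) x &i Q = P.
  apply: ideal_eq; last first.
    by apply: ile_cap => // y Py; apply: ile_addl; exists y.
  move=> y [[_ [j [[z Pz ->] Jj E]]] _].
  rewrite -[y](subrK z); apply: idD => //; apply: JP.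
  by rewrite icolonE mulrBr E addrC addKr.
have [_ H] := len_imul Smm Q (imul x P +i J) x.
rewrite E in H; rewrite -(H finQP) isumA; congr (len _ _ _).
by rewrite [imul x Q +i imul x P](isum_idr (imulS PQ)).
Qed.

Section Killed.
Variables (c : ideal A) (g : A).
Hypothesis finc : fin1 itop (c +i ipr g).

Lemma ez_fin I J : J <=i I -> iprod c I <=i J ->
  fin1 I (imul g I +i J) /\ fin1 (icolon J g &i I) J.
Proof.
move=> JI cI; split; apply: (fin_killed Sm noe _ _ finc).
- by apply: ile_add => //; apply: imul_le.
- rewrite iprodC iprodD; apply: ile_add; first by rewrite iprodC; apply: ile_addrW.
  apply: ile_addlW; apply: iprod_le => x _ Ix [y _ ->]; exists (x * y); first exact: idMr.
  by rewrite mulrCA.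
- by apply: ile_cap => //; apply: icolon_le.
- rewrite iprodC iprodD; apply: ile_add.
    rewrite iprodC; apply: (ile_trans _ cI); apply: iprodS => //; exact: ile_capr.
  apply: iprod_le => x _ [gx _] [y _ ->].
  by rewrite mulrCA mulrA; apply: idMr.
Qed.

(* The snake lemma for multiplication by g. *)
Lemma ezD I J K : J <=i K -> K <=i I -> iprod c I <=i J ->
  ez g I J = ez g I K + ez g K J.
Proof.
move=> JK KI cI; rewrite /ez /symstep /lenz.
have [F1 F2] := ez_fin (ile_trans JK KI) cI.
have [F3 F4] := ez_fin KI (ile_trans cI JK).
have [F5 F6] : fin1 K (imul g K +i J) /\ fin1 (icolon J g &i K) J.
  by apply: ez_fin => //; apply: (ile_trans _ cI); apply: iprodS.
pose gIJ := imul g I +i J; pose cJ := icolon J g; pose cK := icolon K g.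
have E1 : len1 I gIJ = (len1 I (imul g I +i K) + len1 (imul g I +i K) gIJ)%N.
  by apply: lenD => //; [apply: isumS|apply: ile_add => //; apply: imul_le].
have E2 : len1 (imul g I +i K) gIJ = len1 K (K &i gIJ).
  have -> : imul g I +i K = K +i gIJ.
    by rewrite /gIJ isumA (isumC K) -isumA (isum_idr JK).
  apply: (len_sumcap Sm K gIJ).2; apply/(len_sumcap Sm K gIJ).1.
  by apply: (fin_ler _ F1); apply: ile_add => //; apply: ile_add;
    [apply: imul_le|apply: ile_trans JK KI].
have gKJ : imul g K +i J <=i K &i gIJ.
  apply: ile_cap; first by apply: ile_add => //; apply: imul_le.
  by apply: isumS => //; apply: imulS.
have E3 : len1 K (imul g K +i J) = (len1 K (K &i gIJ) + len1 (K &i gIJ) (imul g K +i J))%N.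
  by apply: lenD => //; apply: ile_capl.
have JcK : J <=i cJ &i K by apply: ile_cap => //; apply: icolon_le.
have cKI : cJ &i K <=i cJ &i I by apply: icapS.
have E4 : len1 (cJ &i I) J = (len1 (cJ &i I) (cJ &i K) + len1 (cJ &i K) J)%N.
  by apply: lenD.
have E5 : len1 (cJ &i I +i K) K = len1 (cJ &i I) (cJ &i K).
  have capE : (cJ &i I) &i K = cJ &i K.
    by apply: ideal_eq => [x [[? ?] ?]|x [? Kx]]; split=> //; split=> //; apply: KI.
  rewrite -capE; apply: (len_sumcap Sm _ _).2; rewrite capE.
  exact: (fin_lel Sm JcK F2).
have cJKI : cJ &i I +i K <=i cK &i I.
  apply: ile_add; first by apply: icapS => //; apply: icolonS.
  by apply: ile_cap => //; apply: icolon_le.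
have E6 : len1 (cK &i I) K = (len1 (cK &i I) (cJ &i I +i K) + len1 (cJ &i I +i K) K)%N.
  by apply: lenD => //; apply: ile_addr.
have E7 : len1 (K &i gIJ) (imul g K +i J) = len1 (cK &i I) (cJ &i I +i K).
  have -> : K &i gIJ = imul g (cK &i I) +i (imul g K +i J).
    apply: ideal_eq; last first.
      apply: ile_add => //; apply/imulP => x [gx Ix]; split=> //.
      by apply: ile_addl; exists x.
    move=> x [Kx [_ [j [[i Ii ->] Jj E]]]]; exists (g * i), j; split=> //; last exact: ile_addr.
    exists i => //; split=> //; rewrite icolonE -[g * i](addrK j) -E.
    by apply: idB => //; apply: JK.
  have colE : icolon (imul g K +i J) g &i (cK &i I) = cJ &i I +i K.
    apply: ideal_eq.
      move=> x [[_ [j [[k Kk ->] Jj E]]] [_ Ix]]; exists (x - k), k; rewrite subrK; split=> //.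
      split; first by rewrite /cJ icolonE mulrBr E addrC addKr.
      by apply: idB => //; apply: KI.
    apply: ile_cap => //; apply: ile_add => x; first by move=> [gx _]; apply: ile_addr.
    by move=> Kx; apply: ile_addl; exists x.
  have [FE ->] := len_imul Sm (cK &i I) (imul g K +i J) g; rewrite colE//.
  by apply: (fin_lel Sm _ F4); apply: ile_addr.
move: E1 E2 E3 E4 E5 E6 E7; rewrite /gIJ /cJ /cK; lia.
Qed.

End Killed.

Lemma ez_step g J x : fin1 itop (icolon J x +i ipr g) ->
  ez g (J +i ipr x) J = ez g itop (icolon J x).
Proof.
move=> Fg; rewrite /ez /symstep /lenz.
have kill : iprod (icolon J x) itop <=i icolon J x by apply: iprod_lel.
have [F1 F2] := ez_fin Fg (@ile_top _ _) kill.
have E1 : J +i ipr x = imul x itop +i J by rewrite isumC.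
congr (_%:Z - _%:Z).
- rewrite E1 -(len_imul_sub Sm (x := x) (J := J) _ _ F1) //; last by apply: ile_addr.
  congr len1; rewrite !imulD.
  apply: ideal_eq.
    apply: ile_add; last exact: ile_addr.
    apply: ile_add; last by apply: ile_addrW; apply: imul_le.
    by do 2 apply: ile_addlW; rewrite !imulA mulrC.
  apply: ile_add; last exact: ile_addr.
  apply: ile_add; first by do 2 apply: ile_addlW; rewrite !imulA mulrC.
  by apply: ile_addrW; apply/imulP.
- have -> : icolon J g &i (J +i ipr x) = imul x (icolon (icolon J x) g &i itop) +i J.
    apply: ideal_eq.
      move=> y [gy [j [_ [Jj [a _ ->] E]]]]; exists (x * a), j; split=> //; last by rewrite addrC.
      exists a => //; split=> //; rewrite !icolonE mulrCA.
      have -> : g * (x * a) = g * y - g * j by rewrite E mulrDr addrC addKr.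
      by apply: idB => //; apply: idM.
    apply: ile_add; last by apply: ile_cap; [apply: icolon_le|apply: ile_addl].
    apply/imulP => y [+ _]; rewrite !icolonE => H; split; first by rewrite icolonE mulrCA.
    by apply: ile_addr; exists y.
  have {3}-> : J = imul x (icolon J x) +i J by rewrite isum_idl//; apply/imulP.
  by apply: len_imul_sub => //; apply: ile_cap => //; apply: icolon_le.
Qed.

Lemma icolon_prime P g : iprime P -> ~ P g -> icolon P g = P.
Proof.
move=> [_ PM] Pg; apply: ideal_eq; last exact: icolon_le.
by move=> x /PM[].
Qed.

Variables (m : ideal A).
Hypothesis mP : scompl S1 m.

Lemma ez_maximal g : ez g itop m = 0.
Proof.
rewrite /ez /symstep /lenz; have [mg|mg] := pselect (m g).
  rewrite isum_idl; last exact: imul_top_le.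
  have -> : icolon m g = itop by apply: ideal_eq => // x _; rewrite icolonE; apply: idMr.
  by rewrite icap_idl// subrr.
have [_ /(_ g mg)[a ag]] := mP.
have E x : x = g * (a * x) by rewrite mulrA [g * a]mulrC ag mul1r.
have -> : imul g itop +i m = itop.
  by apply: ideal_eq => // x _; apply: ile_addl; exists (a * x).
have -> : icolon m g &i itop = m.
  rewrite icap_idl//; apply: ideal_eq; last exact: icolon_le.
  by move=> x gx; rewrite -[x]mul1r -ag -mulrA; apply: idM.
by rewrite !len_refl.
Qed.

Lemma ez_prime g P : iprime P -> ~ P g -> ez g itop P = len1 itop (P +i ipr g).
Proof.
move=> Pp Pg; rewrite /ez /symstep /lenz icap_idl// icolon_prime//.
by rewrite len_refl// subr0 isumC.
Qed.

(** Both sides are additive along a prime filtration of I / J. A step A / q with q in D contributes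
    the order of g on V(q) and has length one at q only; a step A / m contributes 0. *)
Lemma ez_formula c g (D : seq (ideal A)) : uniq D ->
  (forall q, q \in D -> [/\ iprime q, ~ q g & ~ (m <=i q)]) ->
  (forall q q', q \in D -> q' \in D -> q <=i q' -> q = q') ->
  (forall q, iprime q -> c <=i q -> q \in D \/ q = m) ->
  fin1 itop (c +i ipr g) ->
  forall I J, J <=i I -> iprod c I <=i J ->
  (forall q, q \in D -> fin (scomp q) I J) /\
  ez g I J = \sum_(q <- D) (len1 itop (q +i ipr g))%:Z * lenz (scomp q) I J.
Proof.
move=> uD HD anti Dc finc I J JI.
pose Phi J := iprod c I <=i J -> (forall q, q \in D -> fin (scomp q) I J) /\
  ez g I J = \sum_(q <- D) (len1 itop (q +i ipr g))%:Z * lenz (scomp q) I J.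
apply: (prime_filtration noe (I := I) (Phi := Phi)) JI => {J} [_|K x KI Ix Pp IH cI].
  split=> [q /HD[qp _ _]|]; first by apply: fin_refl; apply: scomp_mulset.
  rewrite big_seq big1 => [|q /HD[qp _ _]]; last first.
    by rewrite /lenz len_refl ?mulr0//; apply: scomp_mulset.
  rewrite /ez /symstep /lenz isum_idl; last exact: imul_le.
  have -> : icolon I g &i I = I by apply: icap_idr; apply: icolon_le.
  by rewrite !len_refl.
have KK' : K <=i K +i ipr x by exact: ile_addl.
have K'I : K +i ipr x <=i I by apply: ile_add => //; apply: imul_top_le.
have [FI EI] := IH (ile_trans cI KK').
have cP : c <=i icolon K x by move=> y cy; rewrite icolonE mulrC; apply: cI; apply: iprod_in.
have finP : fin1 itop (icolon K x +i ipr g).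
  by apply: (fin_lel Sm _ finc); apply: isumS.
have lenq q : q \in D -> fin (scomp q) itop (icolon K x) /\
    len (scomp q) itop (icolon K x) = (q == icolon K x) :> nat.
  move=> qD; have [qp qg qm] := HD q qD; have [PD|Pm] := Dc _ Pp cP.
    have [qP|nqP] := eqVneq q (icolon K x).
      by rewrite -qP; apply: (len_scompl (scomp_mulset qp) (scompl_comp q)).
    apply: (len_prime_other (scomp_mulset qp) (scompl_comp q)) => H.
    by move/eqP: nqP; apply; rewrite (anti _ _ PD qD H).
  rewrite Pm; have -> : (q == m) = false by apply/eqP => qE; apply: qm; rewrite qE.
  exact: (len_prime_other (scomp_mulset qp) (scompl_comp q)).
have FK q : q \in D -> fin (scomp q) (K +i ipr x) K.
  move=> qD; have [qp _ _] := HD q qD.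
  by apply/(len_step (scomp_mulset qp) K x).1; have [] := lenq q qD.
split=> [q qD|].
  have [qp _ _] := HD q qD; apply: (finD (scomp_mulset qp) KK' K'I); [exact: FI|exact: FK].
rewrite (ezD finc KK' K'I cI) EI (ez_step finP).
transitivity (\sum_(q <- D) (len1 itop (q +i ipr g))%:Z * lenz (scomp q) I (K +i ipr x)
  + \sum_(q <- D) (len1 itop (q +i ipr g))%:Z * (q == icolon K x)%:Z); last first.
  rewrite -big_split /=; apply: eq_big_seq => q qD; have [qp _ _] := HD q qD.
  rewrite -mulrDr /lenz; congr (_ * _).
  rewrite (lenD (scomp_mulset qp) KK' K'I).
    rewrite PoszD (len_step (scomp_mulset qp) K x).2 ?(lenq q qD).2//.
    by have [] := lenq q qD.
  by apply: (finD (scomp_mulset qp) KK' K'I); [exact: FI|exact: FK].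
congr (_ + _); have [PD|Pm] := Dc _ Pp cP; last first.
  rewrite Pm ez_maximal big_seq big1// => q /HD[_ _ qm].
  have -> : (q == m) = false by apply/eqP => qE; apply: qm; rewrite qE.
  by rewrite mulr0.
have [_ Pg _] := HD _ PD.
rewrite ez_prime// (bigD1_seq _ PD uD)/= eqxx mulr1 big1 ?addr0// => q /negbTE->.
by rewrite mulr0.
Qed.

End OneDim.

(** * Chains of primes and parameters *)

Section Dimension.
Variables (A : comNzRingType) (noe : inoeth A).
Implicit Types (I J K P Q q b c : ideal A) (x y f : A).
Implicit Types (U V W F : nat -> ideal A) (fs : seq (A * nat)).

Definition ilt P Q := P <=i Q /\ ~ Q <=i P.

Lemma ilt_lel P Q R : P <=i Q -> ilt Q R -> ilt P R.
Proof.
move=> PQ [QR nRQ]; split; first exact: ile_trans QR.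
by move=> RP; apply: nRQ; apply: ile_trans RP PQ.
Qed.

Fixpoint pup n q : Prop :=
  if n is n'.+1 then exists q', [/\ iprime q', ilt q q' & pup n' q'] else True.
Fixpoint pto n q p : Prop :=
  if n is n'.+1 then exists q', [/\ iprime q', ilt q q' & pto n' q' p] else q = p.

Lemma pup_lel n P Q : P <=i Q -> pup n Q -> pup n P.
Proof. by case: n => //= n PQ [R [Rp QR cR]]; exists R; split=> //; apply: ilt_lel QR. Qed.

Lemma pup_ltn m n q : (m <= n)%N -> pup n q -> pup m q.
Proof.
elim: n m q => [|n IH] [|m] q //= mn [R [Rp qR cR]]; exists R; split=> //; exact: IH cR.
Qed.

Lemma pto_le n q p : pto n q p -> q <=i p.
Proof. by elim: n q => [|n IH] q /= => [->//|[R [_ [qR _] /IH]]]; apply: ile_trans. Qed.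

(** The dimension of A / J is at most r. Forbidding chains avoids the default value of [krull_dim],
    and the unit ideal satisfies every bound. *)
Definition dimle J r := forall q, iprime q -> J <=i q -> ~ pup r.+1 q.

Lemma dimleW J K r : J <=i K -> dimle J r -> dimle K r.
Proof. by move=> JK H q qp Kq; apply: H => //; apply: ile_trans Kq. Qed.

(** Only those primes of [prime_list] that start a chain of length r + 1 have to be avoided: any
    such chain over J and f would start strictly above one of them. *)
Lemma dim_step J r : dimle J r.+1 -> exists Ps : seq (ideal A),
  (forall P, P \in Ps -> [/\ iprime P, J <=i P & pup r.+1 P]) /\
  forall f, (forall P, P \in Ps -> ~ P f) -> dimle (J +i ipr f) r.
Proof.
move=> dJ; have [Ps [HP HJ]] := prime_list noe J.
exists [seq P <- Ps | `[< pup r.+1 P >]]; split=> [P|f Hf q qp Jq cq].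
  by rewrite mem_filter => /andP[/asboolP cP /HP[]].
have Jq' : J <=i q by apply: ile_trans Jq; apply: ile_addl.
have [P [PPs Pq]] := iprime_foldr qp (ile_trans HJ Jq').
have cP : pup r.+1 P by apply: pup_lel cq.
have [Pp JP] := HP P PPs.
have fP : ~ P f by apply: Hf; rewrite mem_filter PPs andbT; apply/asboolP.
apply: (dJ P Pp JP); exists q; split=> //; split=> // qP.
by apply/fP/qP/Jq; apply: ile_addr; apply: ipr_in.
Qed.

(** Prime avoidance inside the coset x + c. A prime lying inside another one is dropped; otherwise
    the correction is an element of c that lies in the primes already avoided but outside the new
    one. *)
Lemma coset_avoid x c (Ps : seq (ideal A)) :
  (forall P, P \in Ps -> iprime P /\ ~ c <=i P) ->
  exists h, c h /\ forall P, P \in Ps -> ~ P (x + h).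
Proof.
move: {2}(size Ps) (leqnn (size Ps)) => n; elim: n Ps => [|n IH] [|P Ps] //=; do ?by
  exists 0; split=> //; apply: id0.
rewrite ltnS => sPs HP.
have [Pp cP] := HP P (mem_head _ _).
have HPs R : R \in Ps -> iprime R /\ ~ c <=i R by move=> H; apply: HP; rewrite inE H orbT.
have [[R [RPs RP]]|nR] := pselect (exists R, R \in Ps /\ R <=i P).
  have [||h [ch Hh]] := IH (P :: rem R Ps).
  - by rewrite /= size_rem// prednK//; case: (Ps) RPs.
  - by move=> T; rewrite inE => /orP[/eqP->//|/mem_rem/HPs].
  exists h; split=> // T; rewrite inE => /orP[/eqP->|TPs]; first exact: Hh (mem_head _ _).
  have [->|TR] := eqVneq T R; first by move=> /RP; apply: Hh (mem_head _ _).
  apply: Hh; rewrite inE; apply/orP; right.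
  by move: TPs; rewrite (perm_mem (perm_to_rem RPs)) inE (negbTE TR).
have [h [ch Hh]] := IH Ps sPs HPs.
have [Pxh|nPxh] := pselect (P (x + h)); last first.
  by exists h; split=> // T; rewrite inE => /orP[/eqP->|/Hh].
have [w [cw Psw Pw]] : exists w, [/\ c w, forall R, R \in Ps -> R w & ~ P w].
  elim: (Ps) HPs nR => [|R Rs IHR] HR nR.
    by move/existsNP: cP => [w /not_implyP[cw Pw]]; exists w.
  have [||w [cw Rw Pw]] := IHR.
  - by move=> T TR; apply: HR; rewrite inE TR orbT.
  - by move=> [T [TR TP]]; apply: nR; exists T; rewrite inE TR orbT.
  have /existsNP[v /not_implyP[Rv Pv]] : ~ R <=i P.
    by move=> RP; apply: nR; exists R; rewrite inE eqxx.
  exists (v * w); split; first exact: idM.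
    by move=> T; rewrite inE => /orP[/eqP->|/Rw]; [apply: idMr|apply: idM].
  by case: Pp => _ PM /PM[].
exists (h + w); split; first exact: idD.
move=> T; rewrite addrA inE => /orP[/eqP->|TPs]; first by rewrite addrC => /(idDl Pxh).
by move=> /(idDl (Psw T TPs)); apply: Hh.
Qed.

Definition one (s : seq A) : seq (A * nat) := [seq (y, 1%N) | y <- s].

Lemma one_deg s fk : fk \in one s -> fk.2 = 1%N.
Proof. by move=> /mapP[y _ ->]. Qed.
Lemma one_pos s : gpos (one s).
Proof. by move=> fk /one_deg->. Qed.

Lemma iprod_ipr y I : iprod (ipr y) I = imul y I.
Proof.
apply: ideal_eq; last by apply/imulP => x Ix; apply: iprod_in => //; apply: ipr_in.
by apply: iprod_le => _ x [a _ ->] Ix; exists (a * x); rewrite ?mulrA//; apply: idM.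
Qed.

Lemma gsum_one s U n : gsum (one s) U n.+1 = iprod (ispan s) (U n).
Proof.
elim: s => [|y s IH] /=.
  by apply: ideal_eq => //; apply: iprod_lel.
by rewrite IH subn1 /= [RHS]iprodC iprodD iprodC (iprodC _ (ipr y)) iprod_ipr.
Qed.

Lemma pow_closed s : gclosed (one s) (ipow (ispan s)).
Proof.
move=> fk /mapP[y ys ->] n; rewrite addn1 /=; apply/imulP => x bx.
by apply: iprod_in => //; apply: ispan_in.
Qed.

Lemma pow_gfinite s : gfinite (one s) (ipow (ispan s)).
Proof. by exists 1%N => -[|n]// _; rewrite gsum_one. Qed.

Lemma gclosed_add fs J F : gclosed fs F -> gclosed fs (fun n => J +i F n).
Proof.
move=> cF fk fks n; rewrite imulD; apply: isumS; first exact: imul_le.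
exact: cF.
Qed.

Lemma gnoeth_add fs J F : gclosed fs F -> gnoeth fs F (fun=> ibot) ->
  gnoeth fs (fun n => J +i F n) (fun=> J).
Proof.
move=> cF noeF W JW WF cW.
have [|||n0 H0] := noeF (fun n => W n &i F n).
- by move=> n; apply: ile_bot.
- by move=> n; apply: ile_capr.
- move=> fk fks n; apply/imulP => x [Wx Fx]; split.
    by apply: (cW _ fks); exists x.
  by apply: (cF _ fks); exists x.
exists n0 => n nn x Wx; have [j [a [Jj Fa xE]]] := WF n _ Wx.
have Wa : W n a by rewrite -[a](addKr j) -xE addrC; apply: idB => //; apply: JW.
have [_ [d [-> Hd aE]]] := H0 n nn a (conj Wa Fa).
rewrite add0r in aE; exists j, a; split=> //; rewrite aE.
by apply: gsumS Hd => k; apply: ile_capl.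
Qed.

Lemma gnoethW fs U V W : gle V W -> gnoeth fs U V -> gnoeth fs U W.
Proof.
move=> VW noeU T WT TU cT; have [|n0 H0] := noeU T _ TU cT.
  by move=> n; apply: ile_trans (@WT n); apply: VW.
exists n0 => n nn; apply: (ile_trans (@H0 n nn)); apply: isumS => //; exact: VW.
Qed.

(** The Rees module of A / J is noetherian over the Rees algebra. This is the source of the
    Artin-Rees lemma below. *)
Lemma adic_noeth s J : gnoeth (one s) (fun n => J +i ipow (ispan s) n) (fun=> J).
Proof.
apply: gnoeth_add; first exact: pow_closed.
by apply: gfinite_noeth => //; [apply: one_pos|apply: pow_closed|apply: pow_gfinite].
Qed.

(** * Hilbert-Samuel functions and chains of primes *)

Section Length.
Variables (S : A -> Prop) (Sm : mulset S).

Lemma adic_fin J b n : fin S itop b -> fin S itop (J +i ipow b n).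
Proof. by move=> Fb; apply: (fin_lel Sm _ (fin_ipow Sm n noe Fb)); apply: ile_addr. Qed.

Lemma adic_epoly J s : fin S itop (ispan s) ->
  epoly (size s).+1 (fun n => lenz S itop (J +i ipow (ispan s) n)).
Proof.
move=> Fb; set b := ispan s; pose U n := J +i ipow b n.
have Udec n : U n.+1 <=i U n by apply: isumS => //; apply: iprod_ler.
have finU n : fin S (U n) (U n.+1).
  by apply: (fin_ler (I := itop)) => //; apply: adic_fin.
have [||||_ /(_ (@one_deg s))] := hilbert_function Sm (fs := one s)
    (U := U) (V := fun n => U n.+1) (@one_pos s) _ _ _ _ finU.
- exact: Udec.
- by apply: gclosed_add; apply: pow_closed.
- by move=> fk fks n; apply: (gclosed_add (@pow_closed s) fks).
- by apply: gnoethW (@adic_noeth s J) => n; apply: ile_addl.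
rewrite size_map => H; apply: epoly_sum.
apply: (epoly_eq (g := fun n => (len S (U (n - 1)%N) (U (n - 1).+1))%:Z) (N := 1)).
  move=> [//|n] _; rewrite subn1 succnK.
  have := lenD Sm (Udec n) (@ile_top _ (U n)) (adic_fin J n.+1 Fb); rewrite /lenz -/b.
  move: (len S itop (U n.+1)) (len S itop (U n)) (len S (U n) (U n.+1)) => u v w.
  by move=> ->; rewrite PoszD addrAC subrr add0r.
exact: (epoly_subn 1 (h := fun n => (len S (U n) (U n.+1))%:Z)).
Qed.

(** Artin-Rees for the ideal generated by x in the domain A / q, where x can be cancelled
    afterwards. *)
Lemma artin_rees_prime q (s : seq A) x : iprime q -> ~ q x -> exists c : nat, forall n,
  icolon (q +i ipow (ispan s) (n + c)) x <=i q +i ipow (ispan s) n.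
Proof.
move=> [_ qM] qx; set b := ispan s; pose U n := q +i ipow b n.
pose W n := (q +i ipr x) &i U n.
have cU : gclosed (one s) U by apply: gclosed_add; apply: pow_closed.
have [|||c Hc] := @adic_noeth s q W.
- by move=> n; apply: ile_cap; apply: ile_addl.
- by move=> n; apply: ile_capr.
- move=> fk fks n; apply/imulP => y [qy Uy]; split; first exact: idM.
  by apply: (cU _ fks); exists y.
have WE n : W (n + c)%N <=i q +i imul x (ipow b n).
  elim: n => [|n IH]; first by apply: ile_trans (@ile_capl _ _ _) _; apply: isumS => //; apply: imulS.
  apply: ile_trans (Hc (n.+1 + c)%N _) _; first exact: leq_addl.
  apply: ile_add; first exact: ile_addl.
  rewrite addSn gsum_one; apply: ile_trans (iprodS (@ile_refl _ _) IH) _.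
  rewrite iprodD; apply: isumS; first exact: iprod_ler.
  rewrite -iprod_ipr iprodA (iprodC (ispan s)) -iprodA iprod_ipr; exact: imulS.
exists c => n y Uxy.
have /WE[z [_ [qz [w bw ->] E]]] : W (n + c)%N (x * y).
  by split=> //; apply: ile_addr; exists y.
exists (y - w), w; rewrite subrK; split=> //.
by have /qM[] : q (x * (y - w)) by rewrite mulrBr E addrK.
Qed.

Variable p : ideal A.
Hypothesis Sp : scompl S p.

Lemma len_gt0 I : fin S itop I -> I <=i p -> (0 < len S itop I)%N.
Proof.
move=> FI Ip; rewrite -(len_scompl Sm Sp).2.
exact: (len_lel Sm Ip (@ile_top _ _)).
Qed.

(* The length of a chain of primes is less than the growth rate of the Hilbert-Samuel *)
(* function, because dividing by an element outside the first prime lowers that rate. *)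
Lemma dim_growth e r q (s : seq A) : iprime q -> pto e q p -> ispan s <=i p -> fin S itop (ispan s) ->
  growth r (fun n => lenz S itop (q +i ipow (ispan s) n)) -> (e < r)%N.
Proof.
move=> + + bp Fb; set b := ispan s.
elim: e r q => [|e IH] r q qp cq gq.
all: have r0 : (0 < r)%N.
1,3: rewrite lt0n; apply/eqP => rE; move: gq; rewrite rE => /growth_ev0[N HN];
  have := HN N.+1 (leqnSn _); apply/eqP; rewrite /lenz eqz_nat -lt0n; apply: len_gt0;
  [exact: adic_fin|apply: ile_add; [exact: pto_le cq|];
   apply: ile_trans bp; apply: iprod_lel].
  by [].
move: cq => [q1 [q1p [qq1 /existsNP[x /not_implyP[q1x qx]]] cq1]].
case: r gq r0 => // r gq _; rewrite ltnS; apply: IH q1p cq1 _.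
have [c Hc] := artin_rees_prime s qp qx.
pose H n := lenz S itop (q +i ipow b n).
have Hdiff : growth r (fun n => H n - H (n - c)%N).
  by apply/epoly_growth/epoly_diff; apply: growth_epoly gq; apply: adic_epoly.
apply: (growth_le (N := c)) Hdiff => n cn.
have := @Hc (n - c)%N; rewrite subnK// => colon_le.
have F0 := adic_fin q n Fb.
set C := icolon (q +i ipow b n) x in colon_le.
have FC : fin S itop C by apply: (fin_lel Sm _ F0); apply: icolon_le.
have E1 : len S itop (q +i ipow b n) = (len S itop (q +i ipow b n +i ipr x) +
    len S (q +i ipow b n +i ipr x) (q +i ipow b n))%N.
  by apply: (lenD Sm) => //; apply: ile_addl.
have E2 := (len_step Sm (q +i ipow b n) x).2 FC.
have E3 : (len S itop (q +i ipow b (n - c)) <= len S itop C)%N by apply: len_lel.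
have E4 : (len S itop (q1 +i ipow b n) <= len S itop (q +i ipow b n +i ipr x))%N.
  apply: len_lel => //; last by apply: (fin_lel Sm _ F0); apply: ile_addl.
  apply: ile_add; first by apply: isumS.
  by apply: ile_addlW; apply: imul_top_le.
rewrite /H /lenz; move: E1 E2 E3 E4; rewrite -/C; lia.
Qed.

End Length.
End Dimension.

(** Take K maximal between N and M among the ideals that do not become all of M after localization.
    Such a K absorbs p M, since s - a r is invertible at p for s in S and a in p; but N + p M does
    become all of M. *)
Lemma nakayama_loc (A : comNzRingType) (noe : inoeth A) (S : A -> Prop) (Sm : mulset S)
    (p M N : ideal A) : scompl S p -> N <=i M -> sle S M (N +i iprod p M) -> sle S M N.
Proof.
move=> [Sp pS] NM MN; apply: contrapT => nMN.
have [|K [[NK KM nMK] Kmax]] := @acc_max _ (@ile A)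
    (fun K => [/\ N <=i K, K <=i M & ~ sle S M K]) (@ile_refl A) (@ile_trans A) (ideal_acc noe).
  by exists N.
have Kin y : M y -> ~ sle S M (K +i ipr y) -> K y.
  move=> My nfull; have KK' : K <=i K +i ipr y by exact: ile_addl.
  apply: (Kmax (K +i ipr y)) => //; last by apply: ile_addr; apply: ipr_in.
  split=> //; first exact: ile_trans NK KK'.
  by apply: ile_add => //; apply: imul_top_le.
have sat y s : M y -> S s -> K (s * y) -> K y.
  move=> My Ss Ksy; apply: Kin => // full; apply: nMK; apply: (sle_trans Sm full).
  move=> _ [k [_ [Kk [r _ ->] ->]]]; exists s => //.
  by rewrite mulrDr; apply: idD; [apply: idM|rewrite mulrA; apply: idMr].
apply: (nMK); apply: (sle_trans Sm MN); apply: (ile_sle Sm).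
apply: ile_add => //; apply: iprod_le => a x pa Mx; apply: Kin; first exact: idM.
move=> full; have [s Ss [k [_ [Kk [r _ ->] xE]]]] := full x Mx.
have E : (s - a * r) * x = k by rewrite mulrBl xE mulrAC addrK.
have [|c Sc] := pS (s - a * r).
  by move=> H; apply: (Sp s Ss); rewrite -[s](subrK (a * r)); apply: idD => //; apply: idMr.
have Kx : K x by apply: (sat _ _ Mx Sc); rewrite -mulrA E; apply: idM.
apply: nMK; apply: (sle_trans Sm full); apply: (ile_sle Sm); apply: ile_add => //.
by apply: imul_top_le; apply: idM.
Qed.

Lemma nakayama (A : comNzRingType) (noe : inoeth A) (m M N : ideal A) :
  scompl (@sone A) m -> N <=i M -> M <=i N +i iprod m M -> M <=i N.
Proof.
move=> mloc NM MN x Mx.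
have [_ ->] := nakayama_loc noe (sone_mulset A) mloc NM (ile_sle (sone_mulset A) MN) Mx.
by rewrite mul1r.
Qed.

(** * Homogeneous primes and parameters in the Rees algebra *)

Section Rees.
Variables (A : comNzRingType) (noe : inoeth A) (ys : seq A).
Let Q := ispan ys.
Let R := ipow Q.
Let fs1 := one ys.
Implicit Types (U P : nat -> ideal A) (x y f : A).
Local Notation S1 := (@sone A).
Local Notation len1 := (len S1).
Local Notation fin1 := (fin S1).
Let Sm := sone_mulset A.

(** Homogeneous ideals of the Rees algebra of Q. The associated graded ring is its quotient by the
    ideal with components Q^(n+1). *)
Definition gideal U := gle U R /\ gclosed fs1 U.

Lemma rees_closed f k : R k f -> gclosed ((f, k) :: fs1) R.
Proof.
move=> Rf; apply: gclosed_cons; last exact: pow_closed.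
by move=> n /=; apply/imulP => x Rx; rewrite addnC; apply: ipow_in.
Qed.

Lemma gidealM U i j x y : gideal U -> R i x -> U j y -> U (i + j)%N (x * y).
Proof.
move=> [UR cU]; elim: i x y => [|i IH] x y; first by move=> _ Uy; apply: idM.
move=> Rx Uy; have {Rx} : iprod Q (R i) x by [].
suff H : iprod Q (R i) <=i icolon (U (i.+1 + j)%N) y by move=> /H; rewrite icolonE mulrC.
rewrite iprodC; apply: iprod_le => a b Ra Qb; rewrite icolonE mulrC -mulrA mulrCA.
have := IH a y Ra Uy; move: (a * y) => z Uz.
have : Q <=i icolon (U (i.+1 + j)%N) z.
  apply: ispan_le => q qys; rewrite icolonE mulrC.
  have := cU (q, 1%N) (map_f _ qys) (i + j)%N; rewrite addn1; apply.
  by exists z.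
by move=> /(_ b Qb); rewrite icolonE mulrC.
Qed.

Lemma gideal_closed U f k : gideal U -> R k f -> gclosed ((f, k) :: fs1) U.
Proof.
move=> gU Rf; apply: gclosed_cons; last by case: gU.
by move=> n /=; apply/imulP => x Ux; rewrite addnC; apply: gidealM.
Qed.

Lemma rees_noeth U : gle U R -> gnoeth fs1 R U.
Proof.
move=> UR; apply: (gnoethW (V := fun=> ibot)); first by move=> n; apply: ile_bot.
by apply: gfinite_noeth => //; [apply: one_pos|apply: pow_closed|apply: pow_gfinite].
Qed.

Lemma gcoker_gideal U f k : gideal U -> R k f -> gideal (gcoker f k R U).
Proof.
move=> gU Rf; split; first exact: (gcoker_le gU.1 (rees_closed Rf)).
exact: (gcoker_closed (rees_closed Rf) (gideal_closed gU Rf)).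
Qed.

Lemma gker_gideal U f k : gideal U -> R k f -> gideal (gker f k R U).
Proof.
move=> gU Rf; split; first exact: gker_le.
exact: (gker_closed (rees_closed Rf) (gideal_closed gU Rf)).
Qed.

Definition gprime P := [/\ gideal P, ~ P 0%N 1 &
  forall i j x y, R i x -> R j y -> P (i + j)%N (x * y) -> P i x \/ P j y].

(** Such a P gives a point of Proj. When P contains all of degree 1, the quotient by P lives in
    degree 0 and cannot influence growth. *)
Definition relevant P := exists u, Q u /\ ~ P 1%N u.

Lemma gseq_eq U V : gle U V -> gle V U -> U = V.
Proof. by move=> UV VU; apply/funext => n; apply: ideal_eq. Qed.

Definition gid := {U : nat -> ideal A | gideal U}.
Definition gidle (U V : gid) := gle (sval U) (sval V).

Lemma gid_acc : acc gidle.
Proof.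
move=> F Finc.
have [|||||j0 H0] := gnoeth_acc noe (@one_pos _ ys) (@rees_noeth (fun=> ibot) _)
    (c := fun j => sval (F j)).
- by move=> n; apply: ile_bot.
- by move=> j; case: (svalP (F j)).
- by move=> j n; apply: ile_bot.
- by move=> j; case: (svalP (F j)).
- exact: Finc.
by exists j0; apply: H0.
Qed.

(** As for ideals of A: a maximal annihilator of a homogeneous element is prime. The factor
    belonging to x is the quotient by that prime, shifted by the degree of x. *)
Lemma graded_prime_filtration (Phi : (nat -> ideal A) -> Prop) : Phi R ->
  (forall U k x, gideal U -> R k x -> gprime (gker x k R U) ->
     Phi (gcoker x k R U) -> Phi U) ->
  forall U, gideal U -> Phi U.
Proof.
move=> PhiR step U gU.
suff : Phi (sval (exist _ U gU : gid)) by [].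
move: (exist _ U gU : gid); apply: (acc_ind gid_acc) => -[{gU}U gU] /= IH.
have [RU|/existsNP[k0 /existsNP[x0 /not_implyP[Rx0 nUx0]]]] := pselect (gle R U).
  by rewrite (gseq_eq gU.1 RU).
have [||||[T gT] [[k [x [Rx nUx TE]]] Pmax]] := @acc_max _ gidle
    (fun T : gid => exists k x, [/\ R k x, ~ U k x & sval T = gker x k R U]).
- by move=> T n.
- by move=> T1 T2 T3 H1 H2 n; apply: (ile_trans (@H1 n) (@H2 n)).
- exact: gid_acc.
- by exists (exist _ _ (gker_gideal gU Rx0)), k0, x0.
rewrite /= in TE; subst T.
apply: (step U k x) => //; last first.
  apply: (IH (exist _ _ (gcoker_gideal gU Rx))) => /=; first exact: gcoker_ge.
  move=> H; apply: nUx; apply: (H k); apply: ile_addr; rewrite leqnn subnn.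
  exact: ipr_in.
split=> //; first by move=> [+ _]; rewrite icolonE mulr1 add0n.
move=> i j y z Ry Rz [Uxyz _]; rewrite icolonE in Uxyz.
have [Uxy|nUxy] := pselect (U (i + k)%N (x * y)); [by left|right].
have Rxy : R (i + k)%N (x * y) by rewrite addnC; apply: ipow_in.
have : gle (gker (x * y) (i + k) R U) (gker x k R U).
  apply: (Pmax (exist _ _ (gker_gideal gU Rxy))); first by exists (i + k)%N, (x * y).
  move=> n t [Uxt Rt]; split=> //; move: Uxt; rewrite !icolonE => Uxt.
  by rewrite (mulrC x) -mulrA addnCA; apply: gidealM.
by apply; split=> //; rewrite icolonE -mulrA addnCA addnA.
Qed.

Section Growth.
Hypothesis finQ : fin1 itop Q.

Lemma rees_fin U n : gle U R -> (forall n, R n.+1 <=i U n) -> fin1 (R n) (U n).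
Proof.
move=> UR RU; apply: (fin_killed Sm noe (UR n) _ finQ); exact: RU.
Qed.

(** Outside P the element f is injective on R / P, so the new length is a difference with step k. It
    is the polynomiality of the length of R / P, generated in degree 1, that makes this difference
    grow one order slower. *)
Lemma rees_prime_growth P f k r : gprime P -> (forall n, R n.+1 <=i P n) ->
  (0 < k)%N -> R k f -> ~ P k f \/ ~ relevant P ->
  growth r.+1 (fun n => (len1 (R n) (P n))%:Z) ->
  growth r (fun n => (len1 (R n) (gcoker f k R P n))%:Z).
Proof.
move=> [gP P1 PM] RP k0 Rf fP gr; have [PR cP] := gP.
have finP n := rees_fin n PR RP.
have [nPf|irr] := fP.
  have kerE : gker f k R P = P.
    apply: gseq_eq; last exact: (gker_ge PR (gideal_closed gP Rf)).
    by move=> n x [Px Rx]; have [] := PM n k x f Rx Rf; rewrite // mulrC.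
  apply: (growth_eq (N := k) (g := fun n => (len1 (R n) (P n))%:Z - (len1 (R (n - k)%N) (P (n - k)%N))%:Z)).
    move=> n kn; have := hilbert_step Sm k0 PR (rees_closed Rf) (gideal_closed gP Rf) finP kn.
    by rewrite kerE len_refl// subr0 => ->.
  apply: epoly_growth; apply: (epoly_diff k (h := fun n => (len1 (R n) (P n))%:Z)).
  apply: growth_epoly gr.
  have [_] := hilbert_function Sm (@one_pos _ ys) PR (@pow_closed _ ys) cP (rees_noeth PR) finP.
  by apply; apply: one_deg.
apply: (growthW (leq0n r)); apply/growth_ev0; exists 1%N => n n1.
have QP : Q <=i P 1%N by move=> u Qu; apply: contrapT => Pu; apply: irr; exists u.
suff -> : gcoker f k R P n = R n by rewrite len_refl.
apply: ideal_eq; first exact: (gcoker_le PR (rees_closed Rf)).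
apply: (ile_trans _ (@gcoker_ge _ f k R P n)).
case: n n1 => // n _; rewrite /R /= iprodC; apply: iprod_le => a b Ra Qb.
by rewrite -addn1; apply: gidealM => //; apply: QP.
Qed.

(** The list consists of the relevant primes in a filtration of R / U; an element outside all of
    them lowers the growth of every factor. *)
Lemma graded_param U : gideal U -> (forall n, R n.+1 <=i U n) ->
  exists Ps : seq (nat -> ideal A), (forall P, P \in Ps -> gprime P /\ relevant P) /\
  forall k f, (0 < k)%N -> R k f -> (forall P, P \in Ps -> ~ P k f) ->
  forall r, growth r.+1 (fun n => (len1 (R n) (U n))%:Z) ->
  growth r (fun n => (len1 (R n) (gcoker f k R U n))%:Z).
Proof.
move=> gU; pose Phi U := (forall n, R n.+1 <=i U n) ->
  exists Ps : seq (nat -> ideal A), (forall P, P \in Ps -> gprime P /\ relevant P) /\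
  forall k f, (0 < k)%N -> R k f -> (forall P, P \in Ps -> ~ P k f) ->
  forall r, growth r.+1 (fun n => (len1 (R n) (U n))%:Z) ->
  growth r (fun n => (len1 (R n) (gcoker f k R U n))%:Z).
apply: (graded_prime_filtration (Phi := Phi)) gU => {U} [_|U k0 x gU Rx Pp IH RU].
  exists [::]; split=> // k f _ Rf _ r _.
  apply: (growth_eq (N := 0%N) (g := fun=> 0)) (growth0 r) => n _.
  have -> : gcoker f k R R n = R n by apply: ideal_eq; [apply: (gcoker_le _ (rees_closed Rf)) => ?|apply: gcoker_ge].
  by rewrite len_refl.
set P := gker x k0 R U in Pp *; set U' := gcoker x k0 R U in IH *.
have UU' : gle U U' by apply: gcoker_ge.
have gU' : gideal U' by apply: gcoker_gideal.
have RU' n : R n.+1 <=i U' n by apply: ile_trans (RU n) (UU' n).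
have UP : gle U P by apply: (gker_ge gU.1 (gideal_closed gU Rx)).
have RP n : R n.+1 <=i P n by apply: ile_trans (RU n) (UP n).
have PR : gle P R by apply: gker_le.
have [Ps [HPs Hgr]] := IH RU'.
pose Ps' := if `[< relevant P >] then P :: Ps else Ps.
have PsPs' T : T \in Ps -> T \in Ps' by rewrite /Ps'; case: ifP => // _; rewrite inE orbC => ->.
exists Ps'; split=> [T|k f kp Rf Hf r gr].
  rewrite /Ps'; case: asboolP => [relP|_]; last exact: HPs.
  by rewrite inE => /orP[/eqP->|/HPs].
have finU n := rees_fin n gU.1 RU; have finU' n := rees_fin n gU'.1 RU'.
have finP n := rees_fin n PR RP.
have stepU n : (k0 <= n)%N -> len1 (U' n) (U n) = len1 (R (n - k0)%N) (P (n - k0)%N).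
  move=> kn; have -> : U' n = imul x (R (n - k0)%N) +i U n by rewrite /U' gcokerE// isumC.
  have := finP (n - k0)%N; rewrite /P /gker subnK// => F.
  exact: (len_imul Sm (R (n - k0)%N) (U n) x).2.
have lenU n : len1 (R n) (U n) = (len1 (R n) (U' n) + len1 (U' n) (U n))%N.
  by apply: lenD => //; apply: gU'.1.
have grP : growth r.+1 (fun n => (len1 (R n) (P n))%:Z).
  apply: (growth_le (N := 0%N) _ (growth_addn k0 gr)) => n _.
  by have := lenU (n + k0)%N; rewrite stepU ?leq_addl// addnK; lia.
have grU' : growth r.+1 (fun n => (len1 (R n) (U' n))%:Z).
  by apply: (growth_le (N := 0%N) _ gr) => n _; have := lenU n; lia.
have G1 := Hgr k f kp Rf (fun T TPs => Hf T (PsPs' T TPs)) r grU'.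
have G2 : growth r (fun n => (len1 (R n) (gcoker f k R P n))%:Z).
  apply: rees_prime_growth => //; have [relP|] := pselect (relevant P); [left|by right].
  by apply: Hf; rewrite /Ps'; case: asboolP => // _; rewrite inE eqxx.
(* R / (U, f) is an extension of R / (U', f) by the submodule that x generates, which is a quotient
   of R / (P, f) shifted by [k0]. *)
apply: (growth_le (N := (k0 + k)%N) _ (growthD G1 (growth_subn k0 G2))) => n kn.
have [k0n kn0 k1n nkE] : [/\ k0 <= n, k <= n - k0, k <= n & n - k = k0 + (n - k0 - k)]%N.
  by clear -kn; split; lia.
pose V := gcoker f k R U n; pose I := R (n - k0)%N.
have E : gcoker f k R U' n = imul x I +i V.
  by rewrite /V /U' !gcokerE// (isumC (U n)) -isumA.
have colE : gcoker f k R P (n - k0)%N <=i icolon V x &i I.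
  apply: ile_cap; last exact: (gcoker_le PR (rees_closed Rf)).
  rewrite /V !gcokerE//.
  apply: ile_add => [y [+ _]|]; first by rewrite icolonE subnK//; apply: ile_addl.
  apply/imulP => y Ry; rewrite icolonE mulrCA; apply: ile_addr; exists (x * y) => //.
  by rewrite nkE; apply: ipow_in.
have finPf : fin1 I (gcoker f k R P (n - k0)%N).
  by apply: (fin_lel Sm _ (finP _)); apply: gcoker_ge.
have L1 : len1 (gcoker f k R U' n) V = len1 I (icolon V x &i I).
  by rewrite E; apply: (len_imul Sm I V x).2; apply: (fin_lel Sm colE).
have L2 : (len1 I (icolon V x &i I) <= len1 I (gcoker f k R P (n - k0)%N))%N.
  by apply: (len_lel Sm colE) => //; apply: ile_capr.
have L3 : len1 (R n) V = (len1 (R n) (gcoker f k R U' n) + len1 (gcoker f k R U' n) V)%N.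
  apply: (lenD Sm) => //.
  - by rewrite E; apply: ile_addr.
  - exact: (gcoker_le gU'.1 (rees_closed Rf)).
  - by apply: (fin_lel Sm _ (finU n)); apply: gcoker_ge.
by rewrite -/V L3 L1; move: L2; rewrite -/I; lia.
Qed.

End Growth.

Lemma gprimeX P u n : gprime P -> Q u -> ~ P 1%N u -> R n (u ^+ n) /\ ~ P n (u ^+ n).
Proof.
move=> [gP P1 PM] Qu Pu; elim: n => [|n [Ru nPu]]; first by rewrite expr0.
have R1u : R 1 u by rewrite /R ipow1.
rewrite exprS; split; first exact: (ipow_in R1u Ru).
by move=> /(PM 1%N n _ _ R1u Ru)[].
Qed.

(** The correction term must have the same degree as f. It is an element w multiplied by a power of
    some u of degree 1 outside P, which is possible only in degrees at least that of w. This
    explains both the relevance hypothesis and the bound K. *)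
Lemma graded_avoid (Ps : seq (nat -> ideal A)) :
  (forall P, P \in Ps -> gprime P /\ relevant P) ->
  exists K, forall k, (K <= k)%N -> exists f, R k f /\ forall P, P \in Ps -> ~ P k f.
Proof.
move: {2}(size Ps) (leqnn (size Ps)) => n; elim: n Ps => [|n IH] [|P Ps] //=; do ?by
  exists 0%N => k _; exists 0; split=> //; apply: id0.
rewrite ltnS => sPs HP.
have [Pp [u [Qu Pu]]] := HP P (mem_head _ _).
have HPs T : T \in Ps -> gprime T /\ relevant T by move=> H; apply: HP; rewrite inE H orbT.
have [[T0 [TPs TP]]|nT] := pselect (exists T, T \in Ps /\ gle T P).
  have [||K HK] := IH (P :: rem T0 Ps).
  - by rewrite /= size_rem// prednK//; case: (Ps) TPs.
  - by move=> T; rewrite inE => /orP[/eqP->|/mem_rem/HPs]//; split=> //; exists u.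
  exists K => k /HK[f [Rf Hf]]; exists f; split=> // T.
  rewrite inE => /orP[/eqP->|TPs']; first exact: Hf (mem_head _ _).
  have [->|TR] := eqVneq T T0; first by move=> /TP; apply: Hf (mem_head _ _).
  apply: Hf; rewrite inE; apply/orP; right.
  by move: TPs'; rewrite (perm_mem (perm_to_rem TPs)) inE (negbTE TR).
have [K HK] := IH Ps sPs HPs.
have [e [w [Rw Psw Pw]]] : exists e w, [/\ R e w, forall T, T \in Ps -> T e w & ~ P e w].
  elim: (Ps) HPs nT => [|T Ts IHT] HT nT.
    by exists 0%N, 1; split=> //; case: Pp.
  have [||e [w [Rw Tw Pw]]] := IHT.
  - by move=> T' H; apply: HT; rewrite inE H orbT.
  - by move=> [T' [H1 H2]]; apply: nT; exists T'; rewrite inE H1 orbT.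
  have /existsNP[i /existsNP[v /not_implyP[Tv Pv]]] : ~ gle T P.
    by move=> TP; apply: nT; exists T; rewrite inE eqxx.
  have [Tp _] := HT T (mem_head _ _); have [gT _ _] := Tp.
  have Rv : R i v by apply: gT.1.
  exists (i + e)%N, (v * w); split; first exact: ipow_in.
    move=> T'; rewrite inE => /orP[/eqP->|H].
      by rewrite addnC mulrC; apply: gidealM.
    have [T'p _] := HT T' ltac:(rewrite inE H orbT //); have [gT' _ _] := T'p.
    by apply: gidealM => //; apply: Tw.
  by case: Pp => _ _ PM /PM[].
exists (K + e)%N => k Kk; have [|f [Rf Hf]] := HK k; first by lia.
have [Pf|nPf] := pselect (P k f); last first.
  by exists f; split=> // T; rewrite inE => /orP[/eqP->|/Hf].
have [Rue Pue] := gprimeX (k - e) Pp Qu Pu.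
have kE : (k = e + (k - e))%N by lia.
exists (f + w * u ^+ (k - e)); split; first by apply: idD => //; rewrite {1}kE; apply: ipow_in.
move=> T; rewrite inE => /orP[/eqP->|TPs]; last first.
  have Tw : T k (w * u ^+ (k - e)).
    have [[gT _ _] _] := HPs T TPs.
    by have := gidealM gT Rue (Psw T TPs); rewrite addnC -kE mulrC.
  by move=> /(idDl Tw); apply: Hf.
rewrite addrC => /(idDl Pf); rewrite {1}kE.
by case: Pp => _ _ PM /(PM _ _ _ _ Rw Rue)[].
Qed.

End Rees.

Lemma growth_dilate r c h : (0 < c)%N -> growth r h -> growth r (fun n => h (c * n)%N).
Proof.
move=> c0 [C [N H]]; exists (C * c ^ r)%N, N => n nn.
have /H : (N <= c * n)%N by apply: leq_trans nn _; apply: leq_pmull.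
rewrite expnMn => Hn; rewrite -mulnA; apply: leq_trans Hn.
by rewrite leq_mul2l leq_pmull// orbT.
Qed.

(** * Generic parameters of a local ring *)

Section Local.
Variables (A : comNzRingType) (noe : inoeth A) (m : ideal A).
Hypothesis mloc : scompl (@sone A) m.
Implicit Types (I J K P Q q b c : ideal A) (x y f g : A).
Local Notation S1 := (@sone A).
Local Notation len1 := (len S1).
Local Notation fin1 := (fin S1).
Let Sm := sone_mulset A.

Lemma loc_unit y : ~ m y -> exists a, a * y = 1.
Proof. by case: mloc => _; apply. Qed.

Lemma loc_prime : iprime m.
Proof.
split=> [|x y mxy]; first by case: mloc => /(_ 1 erefl).
apply: contrapT => /not_orP[/loc_unit[a ax] /loc_unit[c cy]].
case: mloc => /(_ 1 erefl) + _; apply.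
suff -> : 1 = (a * c) * (x * y) by apply: idM.
by rewrite mulrACA ax cy mulr1.
Qed.

Lemma loc_le I : ~ I 1 -> I <=i m.
Proof.
move=> I1 x Ix; apply: contrapT => /loc_unit[a ax].
by apply: I1; rewrite -ax; apply: idM.
Qed.

Lemma loc_prime_le q : iprime q -> q <=i m.
Proof. by case=> q1 _; apply: loc_le. Qed.

Lemma loc_pup1 q : iprime q -> ~ pup 1 q -> q = m.
Proof.
move=> qp H; apply: ideal_eq; first exact: loc_prime_le.
apply: contrapT => mq; apply: H; exists m; split=> //; first exact: loc_prime.
by split=> //; apply: loc_prime_le.
Qed.

Lemma loc_not_pup1 : ~ pup 1 m.
Proof. by move=> [q [qp [_ nqm] _]]; apply/nqm/loc_prime_le. Qed.

(** Equivalently, A / q has dimension one. *)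
Definition curve q := [/\ iprime q, ~ m <=i q & ~ pup 2 q].

Lemma curve_le q q' : curve q -> iprime q' -> q <=i q' -> q' = q \/ q' = m.
Proof.
move=> [qp mq cq] q'p qq'; have [q'q|nq'q] := pselect (q' <=i q).
  by left; apply: ideal_eq.
right; apply: loc_pup1 => // cq'; apply: cq; exists q'; split=> //.
Qed.

Lemma curve_anti q q' : curve q -> curve q' -> q <=i q' -> q = q'.
Proof. by move=> cq [q'p mq' _] /(curve_le cq q'p)[->//|q'E]; rewrite q'E in mq'. Qed.

Lemma dimle0_max J q : dimle J 0 -> iprime q -> J <=i q -> q = m.
Proof. by move=> dJ qp Jq; apply: loc_pup1 => //; apply: dJ. Qed.

Lemma foldr_pow (Ps : seq (ideal A)) : (forall P, P \in Ps -> m <=i P) ->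
  ipow m (size Ps) <=i foldr (@iprod A) itop Ps.
Proof.
elim: Ps => //= P Ps IH H; apply: iprodS; first by apply: H; rewrite inE eqxx.
by apply: IH => R RPs; apply: H; rewrite inE RPs orbT.
Qed.

Lemma dimle0_pow J : dimle J 0 -> exists N, ipow m N <=i J.
Proof.
move=> dJ; have [Ps [HP HJ]] := prime_list noe J.
exists (size Ps); apply: ile_trans HJ; apply: foldr_pow => P /HP[Pp JP].
by rewrite (dimle0_max dJ Pp JP).
Qed.

Lemma fin_max : fin1 itop m. Proof. exact: (len_scompl Sm mloc).1. Qed.

Lemma pow_fin N J : ipow m N <=i J -> fin1 itop J.
Proof. by move=> H; apply: (fin_lel Sm H); apply: fin_ipow => //; apply: fin_max. Qed.

Lemma dimle0_fin J : dimle J 0 -> fin1 itop J.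
Proof. by move=> /dimle0_pow[N]; apply: pow_fin. Qed.

Lemma pup_not_max n P : pup n.+1 P -> ~ m <=i P.
Proof. move=> /(@pup_ltn _ 1 n.+1 _ isT) cP mP; by apply: loc_not_pup1; apply: pup_lel cP. Qed.

(** Each new element avoids the top-dimensional components of the current scheme and of its
    intersection with V(b), so both dimensions drop. After d - 1 steps the intersection is at most
    the closed point. *)
Lemma generic_params d b : dimle (@ibot A) d -> dimle b d.-1 -> forall i, (i <= d)%N ->
  exists xs : seq A, [/\ size xs = i, ispan xs <=i m, dimle (ispan xs) (d - i) &
    (i < d)%N -> dimle (b +i ispan xs) (d.-1 - i)].
Proof.
move=> d0 db; elim=> [|i IH] id.
  exists [::]; rewrite /= !subn0; split=> // _.
  by apply: dimleW db; apply: ile_addl.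
have [xs [sxs xm dxs dbx]] := IH (ltnW id).
have [Ps [HPs Ps_dim]] : exists Ps : seq (ideal A),
    (forall P, P \in Ps -> iprime P /\ ~ m <=i P) /\
    forall f, (forall P, P \in Ps -> ~ P f) -> dimle (ispan xs +i ipr f) (d - i.+1).
  have [|Ps [HPs H]] := @dim_step _ noe (ispan xs) (d - i.+1).
    by rewrite subnSK.
  by exists Ps; split=> // P /HPs[Pp _ /pup_not_max].
have [Rs [HRs Rs_dim]] : exists Ps : seq (ideal A),
    (forall P, P \in Ps -> iprime P /\ ~ m <=i P) /\
    forall f, (forall P, P \in Ps -> ~ P f) -> (i.+1 < d)%N ->
      dimle (b +i ispan xs +i ipr f) (d.-1 - i.+1).
  have [id1|nid] := ltnP i.+1 d; last by exists [::]; split.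
  have [|Rs [HRs H]] := @dim_step _ noe (b +i ispan xs) (d.-1 - i.+1).
    by rewrite subnSK; [apply: dbx|lia].
  exists Rs; split=> [P /HRs[Pp _ /pup_not_max]//|f Hf _]; exact: H.
have [|h [mh Hh]] := @coset_avoid _ 0 m (Ps ++ Rs).
  by move=> P; rewrite mem_cat => /orP[/HPs|/HRs].
exists (rcons xs h); rewrite size_rcons sxs ispan_rcons; split=> //.
- by apply: ile_add => //; apply: imul_top_le.
- by apply: Ps_dim => P H; rewrite -[h]add0r; apply: Hh; rewrite mem_cat H.
- by rewrite isumA; apply: Rs_dim => P H; rewrite -[h]add0r; apply: Hh; rewrite mem_cat H orbT.
Qed.

Lemma sum_avoid_max b c q : dimle (b +i c) 0 -> curve q -> c <=i q -> ~ b <=i q.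
Proof.
move=> d0 [qp mq _] cq bq; apply: mq.
by rewrite -(dimle0_max d0 qp)//; apply: ile_add.
Qed.

(** If no prime other than m contained the d - 1 generic elements, their Hilbert-Samuel polynomial,
    of degree at most d - 1, would contradict the chain of length d. *)
Lemma exists_curve d b q0 : (0 < d)%N -> iprime q0 -> pto d q0 m -> dimle (@ibot A) d ->
  dimle b d.-1 -> exists q, curve q /\ ~ b <=i q.
Proof.
case: d => // d _ q0p cq0 d0 db.
have [xs [sxs xm dxs /(_ (ltnSn d)) dbx]] := generic_params d0 db (leqnSn d).
rewrite subSnn /= subnn in dxs dbx.
suff [q [qp mq xq]] : exists q, [/\ iprime q, ~ m <=i q & ispan xs <=i q].
  have cq : curve q by split=> //; apply: dxs.
  by exists q; split=> //; apply: sum_avoid_max dbx cq xq.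
apply: contrapT => nq.
have dx0 : dimle (ispan xs) 0.
  move=> q qp xq cq; apply: nq; exists q; split=> //; exact: pup_not_max cq.
have Fx := dimle0_fin dx0.
suff : (d.+1 < d.+1)%N by rewrite ltnn.
apply: (dim_growth noe Sm mloc q0p cq0 xm Fx).
by rewrite -sxs; apply: epoly_growth; apply: adic_epoly.
Qed.

Lemma samuel_growth d Q : dimle (@ibot A) d -> (exists N, ipow m N <=i Q) ->
  growth d.+1 (fun n => (len1 itop (ipow Q n))%:Z).
Proof.
move=> d0 [N mQ].
have dtop : dimle (@itop A) d.-1 by move=> q [q1 _] /(_ 1 I).
have [xs [sxs xm dxs _]] := generic_params d0 dtop (leqnn d).
rewrite subnn in dxs; have Fx := dimle0_fin dxs.
have gx : growth d.+1 (fun n => lenz S1 itop (ibot +i ipow (ispan xs) n)).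
  by rewrite -sxs; apply: epoly_growth; apply: adic_epoly.
(* The power [N.+1] of the parameter ideal lies in Q; the successor makes the dilation factor
   positive. *)
apply: (growth_le (N := 0%N) _ (growth_dilate (c := N.+1) isT gx)) => n _.
rewrite /lenz /= isum_idl; last exact: ile_bot.
apply: (len_lel Sm _ (@ile_top _ _)); last by apply: fin_ipow.
rewrite -ipowX; apply: ipowS; apply: (ile_trans _ mQ).
by apply: (ile_trans (@ipowS _ _ _ N.+1 xm)); apply: ipow_anti.
Qed.

End Local.

(** * Multiplicities and orders on curves *)

Definition ordz (A : comNzRingType) (q : ideal A) (g : A) : int :=
  len (@sone A) itop (q +i ipr g).

(* The integers generated by the orders at the closed point of elements of the rings *)
(* A / q, for the curves V(q) such that [U q].                                       *)
Inductive ospan (A : comNzRingType) (m : ideal A) (U : ideal A -> Prop) : int -> Prop :=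
| ospan_nil : ospan m U 0
| ospan_add z q g of curve m q & U q & ~ q g & ospan m U z : ospan m U (z + ordz q g)
| ospan_sub z q g of curve m q & U q & ~ q g & ospan m U z : ospan m U (z - ordz q g).

Section OrderSpan.
Variables (A : comNzRingType) (m : ideal A) (U : ideal A -> Prop).
Local Notation ospan := (ospan m U).

Lemma ospanD z w : ospan z -> ospan w -> ospan (z + w).
Proof.
move=> oz; elim=> [|{}w q g cq Uq qg _ IH|{}w q g cq Uq qg _ IH].
- by rewrite addr0.
- by rewrite addrA; apply: ospan_add.
- by rewrite addrA; apply: ospan_sub.
Qed.

Lemma ospanN z : ospan z -> ospan (- z).
Proof.
elim=> [|{}z q g cq Uq qg _ IH|{}z q g cq Uq qg _ IH].
- by rewrite oppr0; apply: ospan_nil.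
- by rewrite opprD; apply: ospan_sub.
- by rewrite opprB addrC; apply: ospan_add.
Qed.

Lemma ospanM z w : ospan z -> ospan (z * w).
Proof.
move=> oz; have H (n : nat) : ospan (z * n%:Z).
  elim: n => [|n IH]; first by rewrite mulr0; apply: ospan_nil.
  by rewrite -addn1 PoszD mulrDr mulr1; apply: ospanD.
by case: w => n //; rewrite NegzE mulrN; apply: ospanN.
Qed.

Lemma ospan_sum (I : Type) (r : seq I) (P : pred I) (F : I -> int) :
  (forall i, P i -> ospan (F i)) -> ospan (\sum_(i <- r | P i) F i).
Proof. by move=> H; apply: big_ind => //; [exact: ospan_nil|exact: ospanD]. Qed.

Lemma ospan_ord q g : curve m q -> U q -> ~ q g -> ospan (ordz q g).
Proof. by move=> cq Uq qg; rewrite -[ordz _ _]add0r; apply: ospan_add => //; apply: ospan_nil. Qed.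

End OrderSpan.

(** * General elements and the multiplicity as a combination of orders *)

Section Params.
Variables (A : comNzRingType) (noe : inoeth A) (m : ideal A).
Hypothesis mloc : scompl (@sone A) m.
Implicit Types (I J K P Q q b c : ideal A) (x y f g : A) (fs : seq (A * nat)).
Local Notation S1 := (@sone A).
Local Notation len1 := (len S1).
Local Notation fin1 := (fin S1).
Let Sm := sone_mulset A.

Definition fspan fs := ispan [seq fk.1 | fk <- fs].

Lemma fspan_rcons fs f k : fspan (rcons fs (f, k)) = fspan fs +i ipr f.
Proof. by rewrite /fspan map_rcons ispan_rcons. Qed.

Lemma curve_list c : dimle c 1 ->
  exists D : seq (ideal A), uniq D /\ forall q, q \in D <-> curve m q /\ c <=i q.
Proof.
move=> dc; have [Ps [HP HJ]] := prime_list noe c.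
exists (undup [seq P <- Ps | `[< ~ m <=i P >]]); split; first exact: undup_uniq.
move=> q; rewrite mem_undup mem_filter; split=> [/andP[/asboolP mq /HP[qp cq]]|[cq cle]].
  by split=> //; split=> //; apply: dc.
have [qp mq _] := cq; apply/andP; split; first exact/asboolP.
have [P [PPs Pq]] := iprime_foldr qp (ile_trans HJ cle).
have [Pp cP] := HP P PPs; suff -> : q = P by [].
have cvP : curve m P.
  split=> //; first by move=> mP; apply: mq; apply: ile_trans Pq.
  exact: dc.
by rewrite (curve_anti mloc cvP cq Pq).
Qed.

(** The innermost step of the symbol acts on modules killed by [fs], where [ez_formula] applies; by
    linearity the sum over D passes through the remaining recursion. *)
Lemma symbol_formula fs D g k : let c := fspan fs in dimle c 1 ->
  uniq D -> (forall q, q \in D <-> curve m q /\ c <=i q) -> dimle (c +i ipr g) 0 ->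
  sym (rcons fs (g, k)) (lenz S1) itop ibot =
  \sum_(q <- D) ordz q g * sym fs (lenz (scomp q)) itop ibot.
Proof.
move=> c dc uD HD dg; rewrite sym_rcons.
rewrite -(sym_sum fs D (fun q => ordz q g) (fun q => lenz (scomp q))).
apply: sym_ext => // I' J' JI _ _ kill.
have kill' : iprod c I' <=i J'.
  rewrite iprodC; apply: iprod_le => x y Ix cy.
  suff H : c <=i icolon J' x by have := H y cy; rewrite icolonE.
  apply: ispan_le => _ /mapP[fk fks ->].
  by rewrite icolonE mulrC; apply: (kill _ fks); exists x.
apply: (ez_formula noe mloc uD (g := g) (c := c) _ _ _ _ JI kill').2.
- move=> q /HD[cq cle]; have [qp mq _] := cq; split=> // qg; apply: mq.
  by rewrite (dimle0_max mloc dg qp)//; apply: ile_add => //; apply: imul_top_le.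
- by move=> q q' /HD[cq _] /HD[cq' _]; apply: (curve_anti mloc cq cq').
- move=> q qp cq; have [mq|nmq] := pselect (m <=i q).
    by right; apply: ideal_eq => //; apply: loc_prime_le.
  by left; apply/HD; split=> //; split=> //; apply: dc.
- exact: (dimle0_fin noe mloc dg).
Qed.

Lemma gsum_rcons fs fk (U : nat -> ideal A) n :
  gsum (rcons fs fk) U n = gsum fs U n +i imul fk.1 (U (n - fk.2)%N).
Proof.
elim: fs => [|gl fs IH] /=; last by rewrite IH isumA.
by rewrite isumC.
Qed.

Section State.
Variables (ys : seq A) (d t N : nat) (b : ideal A).
Let Q := ispan ys.
Let R := ipow Q.
Hypotheses (t1 : (1 < t)%N) (Qm : Q <=i m) (mQ : ipow m N <=i Q).
Hypotheses (d0 : dimle (@ibot A) d) (db : dimle b d.-1).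

(** The invariant after i choices. In large degrees, U / Q^(n+1) lies in what the classes of [fs]
    generate in the associated graded ring, and the quotient by U has dimension at most d - i. The
    same elements cut down A and V(b). *)
Record pstate i fs (U : nat -> ideal A) : Prop := PState {
  ps_size : size fs = i;
  ps_el : forall fk, fk \in fs -> ipow Q fk.2 fk.1 /\ exists a, fk.2 = (t ^ a)%N;
  ps_gid : gideal ys U;
  ps_low : forall n, R n.+1 <=i U n;
  ps_gsum : exists n0, forall n, (n0 <= n)%N -> U n <=i R n.+1 +i gsum fs R n;
  ps_growth : growth (d - i) (fun n => (len1 (R n) (U n))%:Z);
  ps_dim : dimle (fspan fs) (d - i);
  ps_dimb : (i < d)%N -> dimle (b +i fspan fs) (d.-1 - i) }.

Lemma finQ : fin1 itop Q. Proof. exact: (pow_fin noe mloc mQ). Qed.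

Lemma not_Q_prime P : iprime P -> ~ m <=i P -> ~ Q <=i P.
Proof.
move=> Pp mP QP; apply: mP; apply: (iprime_pow Pp (n := N)).
exact: ile_trans QP.
Qed.

(** The homogeneous prime of the Rees algebra over a prime P of A. With it, primes of A and primes
    of the graded ring are avoided in a single application of [graded_avoid]. *)
Definition gtrace P n := P &i R n.

Lemma gtrace_prime P : iprime P -> ~ Q <=i P ->
  gprime ys (gtrace P) /\ relevant ys (gtrace P).
Proof.
move=> [P1 PM] /existsNP[u /not_implyP[Qu Pu]]; split; last by exists u; split=> // -[].
split.
- split=> [n|fk fks n]; first exact: ile_capr.
  apply/imulP => x [Px Rx]; split; first exact: idM.
  by apply: (pow_closed fks); exists x.
- by move=> [].
- by move=> i j x y Rx Ry [/PM[Px|Py] _]; [left|right].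
Qed.

Lemma pstate0 : pstate 0 [::] (fun n => R n.+1).
Proof.
split=> //.
- split=> [n|fk fks n]; first exact: iprod_ler.
  exact: (pow_closed fks).
- by exists 0%N => n _; apply: ile_addl.
- rewrite subn0; pose h n : int := len1 itop (R n).
  have hg : growth d.+1 h by apply: (samuel_growth noe mloc d0); exists N.
  have hp : epoly (size ys).+1 h.
    apply: (epoly_eq (N := 0%N) _ (adic_epoly noe Sm ibot finQ)) => n _.
    by rewrite /h /lenz isum_idl//; apply: ile_bot.
  apply: (growth_eq (N := 0%N) _ (growth_addn 1 (epoly_growth (epoly_diff 1 (growth_epoly hp hg))))) => n _.
  rewrite addnK addn1 /h (lenD Sm (J := R n.+1) (K := R n) (I := itop)) ?PoszD.
  + by rewrite addrAC subrr add0r.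
  + exact: iprod_ler.
  + by [].
  + by apply: fin_ipow => //; apply: finQ.
- by rewrite subn0 /fspan.
- by move=> _; rewrite subn0; apply: dimleW db; apply: ile_addl.
Qed.

Lemma pstep i fs U : (i < d)%N -> pstate i fs U ->
  exists f k, pstate i.+1 (rcons fs (f, k)) (gcoker f k R U).
Proof.
move=> id [sfs el gU RU [n0 Hn0] gr dfs dbfs].
have [|Ps [HPs Ps_dim]] := @dim_step _ noe (fspan fs) (d - i.+1).
  by rewrite subnSK.
have [Rs [HRs Rs_dim]] : exists Rs : seq (ideal A),
    (forall P, P \in Rs -> iprime P /\ ~ m <=i P) /\
    forall f, (forall P, P \in Rs -> ~ P f) -> (i.+1 < d)%N ->
      dimle (b +i fspan fs +i ipr f) (d.-1 - i.+1).
  have [id1|nid] := ltnP i.+1 d; last by exists [::]; split.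
  have [|Rs [HRs H]] := @dim_step _ noe (b +i fspan fs) (d.-1 - i.+1).
    by rewrite subnSK; [apply: dbfs|lia].
  exists Rs; split=> [P /HRs[Pp _ /(pup_not_max mloc)]//|f Hf _]; exact: H.
have [Ts [HTs Ts_gr]] := graded_param noe finQ gU RU.
have [|K HK] := graded_avoid (ys := ys) (Ps := Ts ++ map gtrace (Ps ++ Rs)).
  move=> T; rewrite mem_cat => /orP[/HTs//|/mapP[P]].
  rewrite mem_cat => /orP[/HPs[Pp _ /(pup_not_max mloc) mP]|/HRs[Pp mP]] ->.
    by apply: gtrace_prime => //; apply: not_Q_prime.
  by apply: gtrace_prime => //; apply: not_Q_prime.
(* A power of [t] that is at least the bound K. *)
have [f [Rf Hf]] := HK (t ^ K)%N (ltnW (ltn_expl K t1)).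
have kp : (0 < t ^ K)%N by rewrite expn_gt0 (ltn_trans _ t1).
have Hf' P : P \in Ps ++ Rs -> ~ P f.
  move=> H Pf; have : gtrace P \in Ts ++ map gtrace (Ps ++ Rs).
    by rewrite mem_cat map_f ?orbT.
  by move=> /Hf; apply.
exists f, (t ^ K)%N; split.
- by rewrite size_rcons sfs.
- move=> fk; rewrite mem_rcons inE => /orP[/eqP->/=|/el//].
  by split=> //; exists K.
- exact: gcoker_gideal.
- by move=> n; apply: (ile_trans (RU n)); apply: gcoker_ge.
- exists (n0 + t ^ K)%N => n nn; rewrite gcokerE; last by lia.
  by rewrite gsum_rcons isumA; apply: isumS => //; apply: Hn0; lia.
- apply: Ts_gr => // [T TTs|]; first by apply: Hf; rewrite mem_cat TTs.
  by rewrite subnSK.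
- by rewrite fspan_rcons; apply: Ps_dim => P H; apply: Hf'; rewrite mem_cat H.
- by rewrite fspan_rcons isumA; apply: Rs_dim => P H; apply: Hf'; rewrite mem_cat H orbT.
Qed.

Lemma pstates i : (i <= d)%N -> exists fs U, pstate i fs U.
Proof.
elim: i => [|i IH] id; first by exists [::], (fun n => R n.+1); apply: pstate0.
have [fs [U st]] := IH (ltnW id); have [f [k st']] := pstep id st.
by exists (rcons fs (f, k)), (gcoker f k R U).
Qed.

(** After d choices the growth is of order 0, so U agrees with R in large degrees, and Nakayama's
    lemma removes the term Q^(n+1). Thus the powers of Q are finitely generated over [fs], as the
    asymptotics of the symbol require. *)
Lemma pstate_gfinite fs U : pstate d fs U ->
  [/\ gpos fs, gclosed fs R & gfinite fs R].
Proof.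
move=> [sfs el gU RU [n0 Hn0] + _ _]; rewrite subnn => /growth_ev0[n1 Hn1].
have fs0 : gpos fs.
  by move=> fk /el[_ [a ->]]; rewrite expn_gt0 (ltn_trans _ t1).
have cR : gclosed fs R.
  move=> fk /el[Qf _] n; apply/imulP => x Rx; rewrite addnC; exact: ipow_in.
split=> //; have [N0 [_ HN0]] := gdeg_ge fs 0.
exists (n0 + n1 + N0)%N => n nn.
have RnU : R n <=i U n.
  have /eqP := Hn1 n ltac:(lia); rewrite eqz_nat => /eqP L0 x Rx.
  have [s -> ] := sle_len (gU.1 n) (rees_fin noe finQ n gU.1 RU) L0 Rx.
  by rewrite mul1r.
apply: (nakayama noe mloc); first by apply: gsum_closed => //; apply: HN0; lia.
apply: (ile_trans RnU); apply: (ile_trans (Hn0 n ltac:(lia))).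
apply: ile_add; last exact: ile_addl.
by apply: ile_addrW; apply: iprodS.
Qed.

End State.

(** The multiplicity as a relation with rational values, since neither the existence of the
    polynomial nor integrality is presupposed. *)
Definition hsmult d Q (z : rat) := exists2 P : {poly rat},
  (exists n0, forall n, (n0 <= n)%N -> P.[n%:R] = (len1 itop (ipow Q n))%:R) &
  z = (d`!)%:R * P`_d.

Lemma horner_growth_coef (P : {poly rat}) d (h : nat -> int) (D : nat) (s : int) :
  (exists n0, forall n, (n0 <= n)%N -> P.[n%:R] = (h n)%:~R) ->
  growth d (fun n => D%:Z * h n - s * (n ^ d)%:Z) -> D%:R * P`_d = s%:~R.
Proof.
move=> [n0 HP] /growth_rat[C [n1 HC]].
pose T := D%:R *: P - s%:~R *: 'X^d : {poly rat}.
have sT : (size T <= d)%N.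
  apply: (@size_poly_growth _ _ C (n0 + n1)) => n nn.
  rewrite /T hornerD hornerN !hornerZ hornerXn HP; last by lia.
  have := HC n ltac:(lia).
  by rewrite rmorphB !rmorphM /= -!pmulrn natrX.
have /eqP := nth_default 0 sT.
by rewrite /T coefB !coefZ coefXn eqxx mulr1 subr_eq0 => /eqP.
Qed.

Lemma symbol_adic_growth fs Q : gpos fs -> gclosed fs (ipow Q) -> gfinite fs (ipow Q) ->
  fin1 itop Q -> growth (size fs) (fun n => ((size fs)`! * kprod fs)%:Z * (len1 itop (ipow Q n))%:Z
                             - sym fs (lenz S1) itop ibot * (n ^ size fs)%:Z).
Proof.
move=> fs0 cR gR FQ; apply: symbol_asymptotics => //.
- by move=> n; apply: iprod_ler.
- exact: gfinite_noeth.
- by move=> n; apply: fin_ipow.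
Qed.

Theorem hsmult_ospan d b (U : ideal A -> Prop) Q N z : (0 < d)%N ->
  Q <=i m -> ipow m N <=i Q -> dimle (@ibot A) d -> dimle b d.-1 ->
  (forall q, iprime q -> ~ b <=i q -> U q) ->
  hsmult d Q z%:~R -> ospan m U z.
Proof.
case: d => // d _; have [ys ->] := noe Q => Qm mQ d0 db HU [P HP zE].
have FQ := finQ mQ.
have key t : (1 < t)%N -> exists a, ospan m U ((t ^ a)%:Z * z).
  move=> t1.
  have [fs [V st]] := pstates t1 mQ d0 db (leqnSn d).
  (* The last element [g] is kept apart: the elements [fs] before it define curves, which avoid
     V(b), and [g] is a parameter on each of them. *)
  have [g [k st']] := pstep t1 mQ (ltnSn d) st.
  have [fs0 cR gR] := pstate_gfinite t1 Qm mQ st'.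
  have := symbol_adic_growth fs0 cR gR FQ; rewrite (ps_size st').
  have HP' : exists n0, forall n, (n0 <= n)%N -> P.[n%:R] = ((len1 itop (ipow (ispan ys) n))%:Z)%:~R.
    by [].
  move=> /(horner_growth_coef HP'); set s := sym _ _ _ _ => sE.
  have ss : ospan m U s.
    have dc : dimle (fspan fs) 1 by have := ps_dim st; rewrite subSnn.
    have [D [uD HD]] := curve_list dc.
    have dg : dimle (fspan fs +i ipr g) 0.
      by have := ps_dim st'; rewrite subnn fspan_rcons.
    rewrite /s (symbol_formula k dc uD HD dg) big_seq.
    apply: ospan_sum => q /HD[cq fq]; apply: ospanM; apply: ospan_ord => //.
      have [qp _ _] := cq; apply: HU => //; apply: (sum_avoid_max mloc _ cq fq).
      by have := ps_dimb st (ltnSn d); rewrite subnn.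
    move=> qg; have [qp mq _] := cq; apply: mq.
    by rewrite (dimle0_max mloc dg qp)//; apply: ile_add => //; apply: imul_top_le.
  have [a aE] : exists a, kprod (rcons fs (g, k)) = (t ^ a)%N.
    have := ps_el st'; rewrite /kprod; elim: (rcons _ _) => [|fk l IH] H.
      by exists 0%N; rewrite big_nil.
    have [|a aE] := IH; first by move=> fk' H'; apply: H; rewrite inE H' orbT.
    have [_ [a' a'E]] := H fk (mem_head _ _).
    by exists (a' + a)%N; rewrite big_cons a'E aE expnD.
  exists a; suff -> : (t ^ a)%:Z * z = s by [].
  apply: (@intr_inj rat); rewrite -sE natrM aE rmorphM /= zE -pmulrn.
  by rewrite mulrA; congr (_ * _); rewrite mulrC.
have [a oa] := key 2 isT; have [c oc] := key 3 isT.
have cop : coprime (2 ^ a) (3 ^ c) by rewrite coprimeXl// coprimeXr.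
(* The Bezout relation u 2^a = v 3^c + 1 recovers z from its two multiples. *)
have [u v uvE _] := egcdnP (3 ^ c) (m := 2 ^ a) ltac:(by rewrite expn_gt0).
rewrite (eqP cop) in uvE.
have -> : z = ((2 ^ a)%:Z * z) * u%:Z - ((3 ^ c)%:Z * z) * v%:Z.
  have : (u * 2 ^ a)%:Z = (v * 3 ^ c + 1)%:Z by rewrite uvE.
  rewrite PoszD !PoszM; move: (Posz (2 ^ a)) (Posz (3 ^ c)) (Posz u) (Posz v) => X Y u' v' E.
  by rewrite !(mulrAC _ z) -mulrBl (mulrC X) E (mulrC Y) addrAC subrr add0r mul1r.
by apply: ospanD; [apply: ospanM|apply: ospanN; apply: ospanM].
Qed.

End Params.

Lemma growth_lead_ge0 d (D : nat) (h : nat -> nat) (s : int) :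
  growth d (fun n => D%:Z * (h n)%:Z - s * (n ^ d)%:Z) -> 0 <= s.
Proof.
move=> [C [N H]]; rewrite leNgt; apply/negP => s0.
pose n := (N + C).+1; have := H n ltac:(lia).
have n0 : (0 < n ^ d)%N by rewrite expn_gt0.
rewrite leqNgt => /negP; apply.
apply: (@leq_trans (n ^ d * n)%N); first by rewrite mulnC ltn_pmul2l//; lia.
rewrite leq_mul2r; apply/orP; right; move: (n ^ d)%N n0 => x x0.
have : s * x%:Z <= - x%:Z by rewrite -mulN1r ler_pM2r ?ltz_nat//; lia.
have : 0 <= D%:Z * (h n)%:Z by rewrite -PoszM.
move: (D%:Z * (h n)%:Z) (s * x%:Z) => u v; lia.
Qed.

(** * Bounds for the symbol *)

Section SymbolBounds.
Variables (A : comNzRingType) (noe : inoeth A) (S : A -> Prop) (Sm : mulset S).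
Implicit Types (I J K P Q q b c : ideal A) (x y f g : A) (s : seq A).

Lemma ipow_add_le c b n : ipow (c +i b) n <=i c +i ipow b n.
Proof.
elim: n => [|n IH]; first exact: ile_addr.
apply: (ile_trans (iprodS (@ile_refl _ (c +i b)) IH)); rewrite iprodD; apply: ile_add.
  by apply: ile_addlW; apply: iprod_ler.
rewrite iprodC iprodD; apply: ile_add; first by apply: ile_addlW; apply: iprod_ler.
by apply: ile_addrW; rewrite iprodC.
Qed.

Lemma adic_killed_fin s c I J n : J <=i I -> iprod c I <=i J -> fin S itop (c +i ispan s) ->
  fin S I (J +i iprod (ipow (ispan s) n) I).
Proof.
move=> JI cI Fc; apply: (@fin_killed _ _ Sm _ _ (c +i ipow (ispan s) n) noe).
- by apply: ile_add => //; apply: iprod_ler.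
- rewrite iprodC iprodD; apply: ile_add; rewrite iprodC; last exact: ile_addr.
  exact: ile_addlW.
- by apply: (fin_lel Sm (@ipow_add_le c (ispan s) n)); apply: fin_ipow.
Qed.

(** The symbol is the leading coefficient of a function with nonnegative values. The ideal [c] kills
    I / J and ensures that the lengths involved are finite. *)
Lemma sym_ge0 s c I J : J <=i I -> iprod c I <=i J -> fin S itop (c +i ispan s) ->
  0 <= sym (one s) (lenz S) I J.
Proof.
move=> JI cI Fc; pose F n := iprod (ipow (ispan s) n) I.
have cF : gclosed (one s) F.
  move=> fk /mapP[y ys ->] n; rewrite addn1 /F /= -iprodA.
  by apply/imulP => x Fx; apply: iprod_in => //; apply: ispan_in.
have noeF : gnoeth (one s) F (fun=> ibot).
  apply: gfinite_noeth => //; first exact: one_pos.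
  by exists 1%N => -[|n]// _; rewrite gsum_one /F /= iprodA.
apply: (growth_lead_ge0 (d := size (one s)) (D := ((size (one s))`! * kprod (one s))%N)
  (h := fun n => len S I (J +i F n))).
apply: (symbol_asymptotics Sm (F := fun n => J +i F n) (@one_pos _ s)).
- by rewrite /F /= iprod1 isum_idl.
- by move=> n; apply: isumS => //; apply: iprodS => //; apply: iprod_ler.
- by move=> n; apply: ile_addl.
- exact: gclosed_add.
- exact: gnoeth_add.
- by move=> n; apply: adic_killed_fin Fc.
Qed.

(** The kernel terms of the recursion are nonnegative and enter with a minus sign; the cokernel
    terms alone lead to the length on the right. *)
Lemma sym_le s c I J : J <=i I -> iprod c I <=i J -> fin S itop (c +i ispan s) ->
  sym (one s) (lenz S) I J <= lenz S I (J +i iprod (ispan s) I).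
Proof.
elim: s c I J => [|y s IH] c I J JI cI Fc.
  have -> : iprod (ispan [::]) I = ibot by apply: ideal_eq; [apply: iprod_lel|apply: ile_bot].
  by rewrite /= isum_idr//; apply: ile_bot.
have yI : imul y I +i J <=i I by apply: ile_add => //; apply: imul_le.
have Fc' : fin S itop (c +i ipr y +i ispan s) by rewrite -isumA.
have ge0 : 0 <= sym (one s) (lenz S) (icolon J y &i I) J.
  apply: (@sym_ge0 s (c +i ipr y)) => //.
    by apply: ile_cap => //; apply: icolon_le.
  rewrite iprodC iprodD iprodC; apply: ile_add.
    by apply: (ile_trans _ cI); apply: iprodS => //; apply: ile_capr.
  by rewrite iprodC iprod_ipr; apply/imulP => x [].
rewrite /= lerBlDr; apply: ler_wpDr => //.
have -> : J +i iprod (ipr y +i ispan s) I = (imul y I +i J) +i iprod (ispan s) I.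
  by rewrite (iprodC (_ +i _)) iprodD iprodC iprod_ipr isumA (isumC J) (iprodC I).
apply: (IH (c +i ipr y)) => //.
rewrite iprodC iprodD; apply: ile_add; first by rewrite iprodC; apply: ile_addrW.
by rewrite iprodC iprod_ipr; apply: ile_addl.
Qed.

End SymbolBounds.

(** * Curves through regular points *)

Section RegularPoint.
Variables (A : comNzRingType) (noe : inoeth A) (m : ideal A).
Hypothesis mloc : scompl (@sone A) m.
Implicit Types (I J K P Q q b c : ideal A) (x y f g : A) (s xs : seq A).
Local Notation S1 := (@sone A).
Local Notation len1 := (len S1).
Local Notation fin1 := (fin S1).
Let Sm := sone_mulset A.

(** Each element is changed by an element of p^2 only: this leaves room to avoid the large
    components, yet Nakayama's lemma at p still sees the old generators. *)
Lemma generic_coset_params d p xs : curve m p -> dimle (@ibot A) d -> ispan xs <=i p ->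
  (size xs < d)%N -> exists fs, [/\ size fs = size xs, ispan fs <=i p,
    ispan xs <=i ispan fs +i ipow p 2 & dimle (ispan fs) (d - size xs)].
Proof.
move=> [pp mp cp] d0; elim/last_ind: xs => [|xs x IH] xp sd.
  by exists [::]; rewrite subn0; split=> //; apply: ile_bot.
rewrite size_rcons ispan_rcons in xp sd *.
have [||fs [sfs fp xf df]] := IH; [|exact: ltnW|].
  by apply: ile_trans xp; apply: ile_addl.
have [|Ps [HPs Ps_dim]] := @dim_step _ noe (ispan fs) (d - (size xs).+1).
  by rewrite subnSK//; apply: ltnW.
have [|h [ph Hh]] := @coset_avoid _ x (ipow p 2) Ps.
  (* Chains of length 2 start at these P, but none starts at p because A / p has dimension one; so P
     contains neither p nor p^2. *)
  move=> P /HPs[Pp _ cP]; split=> // /(iprime_pow Pp) pP.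
  by apply: cp; apply: pup_lel pP _; apply: pup_ltn cP; lia.
exists (rcons fs (x + h)); rewrite size_rcons ispan_rcons sfs.
have px : p x by apply: xp; apply: ile_addr; apply: ipr_in.
split=> //; last exact: Ps_dim.
- apply: ile_add => //; apply: imul_top_le; apply: idD => //.
  by move: ph; rewrite /= => /iprod_lel.
- apply: ile_add.
    apply: (ile_trans xf); apply: isumS => //; exact: ile_addl.
  apply: imul_top_le; apply: (@idDl _ _ x h); first exact: ile_addr.
  by apply: ile_addl; apply: ile_addr; apply: ipr_in.
Qed.

Lemma regular_params d p xs : curve m p -> dimle (@ibot A) d -> ispan xs <=i p ->
  (size xs).+1 = d -> sle (scomp p) p (ispan xs) ->
  exists fs, [/\ size fs = size xs, ispan fs <=i p, sle (scomp p) p (ispan fs) &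
    dimle (ispan fs) 1].
Proof.
move=> cp d0 xp sd px; have [pp _ _] := cp; have Sp := scomp_mulset pp.
have [|fs [sfs fp xf]] := generic_coset_params cp d0 xp; first by rewrite -sd.
rewrite -sd subSnn => df; exists fs; split=> //.
apply: (nakayama_loc noe Sp (scompl_comp p) fp); apply: (sle_trans Sp px).
by apply: (ile_sle Sp); apply: (ile_trans xf); rewrite -[X in iprod _ X]ipow1.
Qed.

(** The symbol lies between 0 and the length 1 of A_p / p A_p. If it were 0, the Hilbert-Samuel
    function at p would grow too slowly for a chain of length e below p. *)
Lemma regular_symbol p q e s : iprime p -> iprime q -> pto e q p -> size s = e ->
  ispan s <=i p -> sle (scomp p) p (ispan s) ->
  sym (one s) (lenz (scomp p)) itop ibot = 1.
Proof.
move=> pp qp cq se sp ps; have Sp := scomp_mulset pp.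
have [Fp Lp] := len_scompl Sp (scompl_comp p).
have Fs : fin (scomp p) itop (ispan s) by apply: (fin_sle Sp Fp).
have Fs' : fin (scomp p) itop (ibot +i ispan s) by rewrite isum_idl//; apply: ile_bot.
have kill : iprod ibot (@itop A) <=i ibot by apply: iprod_lel.
have ge0 := sym_ge0 noe Sp (@ile_top _ ibot) kill Fs'.
have le1 := sym_le noe Sp (@ile_top _ ibot) kill Fs'.
have L1 : len (scomp p) itop (ispan s) = 1%N.
  by rewrite (lenD Sp sp (@ile_top _ p) Fs) Lp (len_sle Sp sp ps).2.
rewrite iprodC iprod1 isum_idl in le1; last exact: ile_bot.
rewrite [X in _ <= X]/lenz L1 in le1.
suff ne0 : sym (one s) (lenz (scomp p)) itop ibot != 0 by lia.
apply/eqP => s0.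
have : growth e (fun n => lenz (scomp p) itop (ipow (ispan s) n)).
  have G := symbol_asymptotics Sp (@one_pos _ s) (F := ipow (ispan s)) (J := ibot) erefl
    (fun n => @iprod_ler _ _ _) (fun n => @ile_bot _ _) (@pow_closed _ s)
    (gfinite_noeth noe (@one_pos _ s) (@pow_closed _ s) (@pow_gfinite _ s))
    (fun n => fin_ipow Sp n noe Fs).
  rewrite s0 size_map se in G.
  apply: (growth_le (N := 0%N) _ G) => n _.
  rewrite mul0r subr0 -PoszM absz_nat leq_pmull// muln_gt0 fact_gt0 /=.
  by rewrite /kprod big_map /= big1_eq.
move=> gr; suff : (e < e)%N by rewrite ltnn.
apply: (dim_growth noe Sp (scompl_comp p) qp cq sp Fs).
apply: (growth_le (N := 0%N) _ gr) => n _; rewrite /lenz !absz_nat.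
apply: (len_lel Sp) => //; first exact: ile_addr.
exact: fin_ipow.
Qed.

Lemma curve_fin q g : curve m q -> ~ q g -> fin1 itop (q +i ipr g).
Proof.
move=> cq qg; apply: (dimle0_fin noe mloc) => P Pp qP cP.
have [PE|PE] := curve_le mloc cq Pp (ile_trans (@ile_addl _ _ _) qP); last first.
  by apply: (loc_not_pup1 mloc); rewrite -PE.
by apply: qg; rewrite -PE; apply: qP; apply: ile_addr; apply: ipr_in.
Qed.

Lemma ordzM q f g : curve m q -> ~ q f -> ~ q g -> ordz q (f * g) = ordz q f + ordz q g.
Proof.
move=> cq qf qg; have [qp _ _] := cq.
have qfg : ~ q (f * g) by case: qp => _ qM /qM[].
have fgf : q +i ipr (f * g) <=i q +i ipr f.
  by apply: isumS => //; apply: imul_top_le; apply: idMr; apply: ipr_in.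
rewrite /ordz (lenD Sm fgf (@ile_top _ _) (curve_fin cq qfg)) PoszD; congr (_ + _).
rewrite -(len_imul_sub Sm (x := f) (J := q) _ (@ile_top _ _) (curve_fin cq qg)); last first.
  by rewrite icolon_prime//; apply: ile_addl.
congr (Posz (len _ _ _)); first by rewrite isumC.
by rewrite imulD imulA [RHS]isumC isumA (isum_idr (@imul_le _ f q)).
Qed.

Lemma hsmult_symbol fs : dimle (ispan fs) 0 ->
  0 <= sym (one fs) (lenz S1) itop ibot /\
  hsmult (size fs) (ispan fs) (sym (one fs) (lenz S1) itop ibot)%:~R.
Proof.
move=> df; have Ff := dimle0_fin noe mloc df.
have Ff' : fin1 itop (ibot +i ispan fs) by rewrite isum_idl//; apply: ile_bot.
have kill : iprod ibot (@itop A) <=i ibot by apply: iprod_lel.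
split; first exact: (sym_ge0 noe Sm (@ile_top _ ibot) kill Ff').
have [P [_ HP]] := adic_epoly noe Sm ibot Ff.
have HP' : exists n0, forall n, (n0 <= n)%N ->
    P.[n%:R] = ((len1 itop (ipow (ispan fs) n))%:Z)%:~R.
  have [n0 H] := HP; exists n0 => n /H ->.
  by rewrite /lenz isum_idl//; apply: ile_bot.
exists P; first exact: HP'.
have := symbol_adic_growth noe (@one_pos _ fs) (@pow_closed _ fs) (@pow_gfinite _ fs) Ff.
rewrite size_map => /(horner_growth_coef HP')<-.
by rewrite /kprod big_map /= big1_eq muln1.
Qed.

Lemma avoid_others (D : seq (ideal A)) p : (forall q, q \in D -> iprime q /\ ~ q <=i p) ->
  iprime p -> exists c : A, ~ p c /\ forall q, q \in D -> q c.
Proof.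
move=> + pp; elim: D => [|q D IH] HD; first by exists 1; split=> //; case: pp.
have [|c [pc Dc]] := IH; first by move=> q' H; apply: HD; rewrite inE H orbT.
have [_ /existsNP[y /not_implyP[qy py]]] := HD q (mem_head _ _).
exists (y * c); split; first by case: pp => _ pM /pM[].
by move=> q'; rewrite inE => /orP[/eqP->|/Dc]; [apply: idMr|apply: idM].
Qed.

(* With f' = (f_1, ..., f_(d-1)) generating p at p, take g1 = a c + e and g2 = c + e, where e *)
(* lies in p and c in all the other curves through V(f'): the symbols of (f', g1) and *)
(* (f', g2) differ exactly by the order of a on V(p).                                 *)
Theorem ord_difference d p q0 xs a : curve m p -> dimle (@ibot A) d -> ispan xs <=i p ->
  (size xs).+1 = d -> sle (scomp p) p (ispan xs) -> iprime q0 -> pto (size xs) q0 p ->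
  ~ p a -> exists Q1 Q2 (z1 z2 : nat),
    [/\ dimle Q1 0 /\ Q1 <=i m, dimle Q2 0 /\ Q2 <=i m, hsmult d Q1 z1%:R, hsmult d Q2 z2%:R &
        ordz p a = z1%:Z - z2%:Z].
Proof.
move=> cp d0 xp sd px q0p cq0 pa; have [pp mp _] := cp.
have [fs [sfs fp pf df]] := regular_params cp d0 xp sd px.
have [D [uD HD]] := curve_list noe mloc df.
have pD : p \in D by apply/HD.
have HD' q : q \in rem p D -> [/\ curve m q, ispan fs <=i q & q != p].
  by rewrite (mem_rem_uniq _ uD) inE => /andP[qp /HD[]].
have [|c0 [pc0 Dc0]] := @avoid_others (rem p D) p _ pp.
  move=> q /HD'[cq _ qp]; have [qpr _ _] := cq; split=> // H.
  by move/eqP: qp; apply; apply: (curve_anti mloc cq cp H).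
have /existsNP[u /not_implyP[mu pu]] := mp.
have [|e [pe De]] := @coset_avoid _ 0 p (rem p D).
  move=> q /HD'[cq _ qp]; have [qpr _ _] := cq; split=> // H.
  by move/eqP: qp; apply; rewrite (curve_anti mloc cp cq H).
(* The factor u, in m but not in p, puts c and hence both g1 and g2 into the maximal ideal. *)
pose c := u * c0.
have pc : ~ p c by case: pp => _ pM /pM[].
have mc : m c by apply: idMr.
have Dc q : q \in rem p D -> q c by move=> /Dc0; apply: idM.
have me : m e by apply: (loc_prime_le mloc pp).
have good t : ~ p t -> let g := t * c + e in
    dimle (ispan (rcons fs g)) 0 /\ ispan (rcons fs g) <=i m /\
    ordz p g = ordz p t + ordz p c /\
    (forall q, q \in rem p D -> ordz q g = ordz q e).
  move=> pt g.
  have mg : m g by apply: idD => //; apply: idM.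
  have ptc : ~ p (t * c) by case: pp => _ pM /pM[].
  have ipE q (x y : A) : q y -> q +i ipr (x + y) = q +i ipr x.
    move=> qy; apply: ideal_eq; apply: ile_add; do ?exact: ile_addl; apply: imul_top_le.
      by apply: idD; [apply: ile_addr; apply: ipr_in|apply: ile_addl].
    by apply: (@idDl _ _ x y); [apply: ile_addl|apply: ile_addr; apply: ipr_in].
  have pg : ~ p g by move=> /(idDl pe).
  have Dg q : q \in rem p D -> ~ q g.
    move=> qD; rewrite /g addrC => /(idDl (idM t (Dc q qD))) qe.
    by apply: (De q qD); rewrite add0r.
  split; last split; last split.
  - rewrite ispan_rcons => q qp gq cq; have mq := pup_not_max mloc cq.
    have fq : ispan fs <=i q by apply: (ile_trans _ gq); apply: ile_addl.
    have qg : q g by apply: gq; apply: ile_addr; apply: ipr_in.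
    have cvq : curve m q by split=> //; apply: df.
    have [qE|qp'] := eqVneq q p; first by apply: pg; rewrite -qE.
    by apply: (Dg q) => //; rewrite (mem_rem_uniq _ uD) inE qp'; apply/HD.
  - rewrite ispan_rcons; apply: ile_add; last exact: imul_top_le.
    by apply: (ile_trans fp); apply: (loc_prime_le mloc pp).
  - by rewrite -ordzM// /ordz ipE.
  - by move=> q qD; rewrite /ordz /g addrC ipE//; apply: idM; apply: Dc.
have p1 : ~ p 1 by case: pp.
have [d1 [m1 [op1 oq1]]] := good a pa; have [d2 [m2 [op2 oq2]]] := good 1 p1.
set g1 := a * c + e in d1 m1 op1 oq1; set g2 := 1 * c + e in d2 m2 op2 oq2.
have sE g : dimle (ispan (rcons fs g)) 0 -> sym (one (rcons fs g)) (lenz S1) itop ibot =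
    ordz p g + \sum_(q <- rem p D) ordz q g * sym (one fs) (lenz (scomp q)) itop ibot.
  move=> dg; have E : one (rcons fs g) = rcons (one fs) (g, 1%N) by rewrite /one map_rcons.
  have fE : fspan (one fs) = ispan fs by rewrite /fspan -map_comp map_id.
  rewrite E (symbol_formula noe mloc (D := D)) ?fE//; last by rewrite -ispan_rcons.
  rewrite (big_rem _ pD) /=; congr (_ + _).
  by rewrite (regular_symbol pp q0p cq0 sfs fp pf) mulr1.
have [p1' h1] := hsmult_symbol d1; have [p2' h2] := hsmult_symbol d2.
rewrite size_rcons sfs sd in h1; rewrite size_rcons sfs sd in h2.
exists (ispan (rcons fs g1)), (ispan (rcons fs g2)), `|sym (one (rcons fs g1)) (lenz S1) itop ibot|%N,
  `|sym (one (rcons fs g2)) (lenz S1) itop ibot|%N; split=> //.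
- by rewrite pmulrn gez0_abs.
- by rewrite pmulrn gez0_abs.
- rewrite !gez0_abs// !sE// op1 op2.
  have -> : ordz p 1 = 0.
    rewrite /ordz (_ : p +i ipr 1 = itop) ?len_refl//.
    by apply: ideal_eq => // x _; apply: ile_addr; exists x; rewrite ?mul1r.
  rewrite (eq_big_seq (fun q => ordz q g2 * sym (one fs) (lenz (scomp q)) itop ibot)).
    by rewrite add0r opprD addrACA subrr addr0 addrK.
  by move=> q qD; rewrite /= oq1// oq2.
Qed.

End RegularPoint.

(** * Submodules, spectra and quotient rings *)

Section Bridge.
Variable A : comNzRingType.
Implicit Types (I J K : ideal A) (p q : Spec A).

Definition of_submod (N : submodClosed A^o) : ideal A.
Proof.
refine (@Ideal A (fun x : A => x \in (N : {pred A^o})) _ _ _).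
- exact: rpred0.
- by move=> x y; apply: rpredD.
- by move=> a x; apply: (rpredZ (a : A)).
Defined.

Definition ipred I : A^o -> bool := fun x => `[< I x >].
Lemma ipred_submod I : submod_closed (ipred I).
Proof.
split=> [|a x y /asboolP Ix /asboolP Iy]; apply/asboolP; first exact: id0.
by apply: idD => //; apply: idM.
Qed.
HB.instance Definition _ (I : ideal A) :=
  GRing.isSubmodClosed.Build A A^o (ipred I) (ipred_submod I).
Definition to_submod I : submodClosed A^o := GRing.SubmodClosed.clone A A^o (ipred I) _.

Lemma to_submodP I (x : A) : x \in (to_submod I : {pred A^o}) <-> I x.
Proof. by split=> [/asboolP|Ix]; last exact/asboolP. Qed.

Definition of_idealr (m : idealr A) : ideal A.
Proof.
refine (@Ideal A (fun x : A => x \in (m : {pred A})) _ _ _).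
- exact: rpred0.
- by move=> x y; apply: rpredD.
- by move=> a x; apply: idealMr.
Defined.

Lemma of_idealr1 (m : idealr A) : ~ of_idealr m 1.
Proof. by rewrite /icar /= idealr1. Qed.

(** Packing an ideal with its proofs allows structure instances to be declared for [rpred_of] and
    [ppred_of]. *)
Record proper_id := ProperId { proper_id_val :> ideal A; _ : ~ proper_id_val 1 }.
Record prime_id := PrimeId { prime_id_val :> proper_id; _ : iprime prime_id_val }.

Definition rpred_of (I : proper_id) : A -> bool := fun x => `[< I x >].
Lemma rpred_of_idealr (I : proper_id) : idealr_closed (rpred_of I).
Proof.
case: I => I I1; split; first by apply/asboolP; apply: id0.
  by apply/negP => /asboolP.
move=> a x y /asboolP Ix /asboolP Iy; apply/asboolP.
by apply: idD => //; apply: idM.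
Qed.
HB.instance Definition _ (I : proper_id) := isIdealr.Build A (rpred_of I) (rpred_of_idealr I).

Definition ppred_of (P : prime_id) : A -> bool := rpred_of P.
HB.instance Definition _ (P : prime_id) := isIdealr.Build A (ppred_of P) (rpred_of_idealr P).
Lemma ppred_of_prime (P : prime_id) : prime_idealr_closed (ppred_of P).
Proof.
case: P => P [P1 PM] x y /asboolP /= /PM[Px|Py]; apply/orP; [left|right]; exact/asboolP.
Qed.
HB.instance Definition _ (P : prime_id) :=
  isPrimeIdealrClosed.Build A (ppred_of P) (@ppred_of_prime P).

Definition to_idealr I (I1 : ~ I 1) : idealr A := Idealr.clone A (rpred_of (ProperId I1)) _.
Definition to_spec I (Ip : iprime I) : Spec A :=
  PrimeIdealr.clone A (ppred_of (@PrimeId (ProperId Ip.1) Ip)) _.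

Lemma to_idealrK I (I1 : ~ I 1) : of_idealr (to_idealr I1) = I.
Proof. by apply: ideal_eq => x; [move=> /asboolP|move=> Ix; apply/asboolP]. Qed.

Lemma to_specK I (Ip : iprime I) : of_idealr (to_spec Ip) = I.
Proof. by apply: ideal_eq => x; [move=> /asboolP|move=> Ix; apply/asboolP]. Qed.

Lemma spec_prime p : iprime (of_idealr p).
Proof.
split; first exact: of_idealr1.
by move=> x y; rewrite /icar /= prime_idealrM => /orP.
Qed.

Lemma proper_ilt (p q : idealr A) : proper_subpred p q <-> ilt (of_idealr p) (of_idealr q).
Proof. by split=> [/asboolP|H]; last exact/asboolP. Qed.

Lemma ideal_genE (E : set A) (x : A) :
  x \in (ideal_gen E : {pred A^o}) <-> forall I, (forall y, E y -> I y) -> I x.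
Proof.
split=> [/asboolP H I EI|H].
  by apply: (to_submodP I x).1; apply: (H (to_submod I)) => y /EI /(to_submodP I y).2.
by apply/asboolP => N EN; apply: (H (of_submod N)).
Qed.

Lemma ideal_gen_seq (s : seq A) : of_submod (ideal_gen [set x | x \in s]) = ispan s.
Proof.
apply: ideal_eq => x; first by move=> /ideal_genE; apply=> y; apply: ispan_in.
by move=> sx; apply/ideal_genE => I sI; apply: ispan_le sx => y ys; apply: sI.
Qed.

Lemma ideal_gen1 (a : A) : of_submod (ideal_gen [set a]) = ipr a.
Proof.
apply: ideal_eq => x; first by move=> /ideal_genE; apply=> y ->; apply: ipr_in.
by move=> ax; apply/ideal_genE => I aI; apply: imul_top_le ax; apply: aI.
Qed.

Lemma noetherian_inoeth : noetherian A -> inoeth A.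
Proof.
move=> noe I; have [s Is] := noe (to_submod I); exists s.
rewrite -ideal_gen_seq; apply: ideal_eq => x.
  by move=> /(to_submodP I x).2; rewrite Is.
by move=> H; apply: (to_submodP I x).1; rewrite Is.
Qed.

Lemma ideal_powerE (Q : idealr A) n : of_submod (ideal_power Q n) = ipow (of_idealr Q) n.
Proof.
apply: ideal_eq => x.
  move=> /ideal_genE; apply=> _ [t [tQ ->]] {x}.
  have : forall s : seq A, {subset s <= Q} -> ipow (of_idealr Q) (size s) (\prod_(y <- s) y).
    elim=> [|y s IH] sQ; first by rewrite big_nil.
    rewrite big_cons; apply: iprod_in; first by apply: sQ; rewrite inE eqxx.
    by apply: IH => z zs; apply: sQ; rewrite inE zs orbT.
  by move=> /(_ t tQ); rewrite size_tuple.
elim: n x => [|n IH] x.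
  move=> _; apply/ideal_genE => I /(_ 1) I1; rewrite -[x]mulr1; apply: idM; apply: I1.
  by exists [tuple]; split=> //; rewrite big_nil.
move: x; suff : ipow (of_idealr Q) n.+1 <=i of_submod (ideal_power Q n.+1) by [].
apply: iprod_le => a b Qa Qb.
have /ideal_genE Gb : b \in (ideal_power Q n : {pred A^o}) by apply: IH.
apply/ideal_genE => I HI; suff : icolon I a b by [].
apply: Gb => _ [t [tQ ->]]; rewrite icolonE; apply: HI.
exists [tuple of a :: t]; split; last by rewrite big_cons.
by move=> y; rewrite inE => /orP[/eqP->|/tQ].
Qed.

Section Quotient.
Variable N : submodClosed A^o.
Local Notation M := (mod_quot N).
Local Notation pi := (\pi_(Quotient.quot (submod_zmod N))%qT : A -> M).

Lemma pi_eq0 x : (pi x = 0) <-> of_submod N x.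
Proof.
rewrite /icar /= -[x in x \in _]subr0.
have E : (0 : M) = pi 0 by rewrite -[0](raddf0 \pi_(Quotient.quot (submod_zmod N))%qT).
rewrite E; split=> [/eqP|H].
  by rewrite -Quotient.idealrBE.
by apply/eqP; rewrite -Quotient.idealrBE.
Qed.

Definition pull (K : submodClosed M) : ideal A.
Proof.
refine (@Ideal A (fun x => pi x \in (K : {pred M})) _ _ _).
- by rewrite (_ : pi 0 = 0) ?rpred0//; apply/pi_eq0; apply: id0.
- by move=> x y Kx Ky; rewrite piD; apply: rpredD.
- by move=> a x Kx; rewrite -[pi (a * x)](pi_scale N (a : A) (x : A^o)); apply: rpredZ.
Defined.

Lemma pull_ge (K : submodClosed M) : of_submod N <=i pull K.
Proof. by move=> x /pi_eq0 xN; rewrite /icar /= xN rpred0. Qed.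

Definition push_pred I : M -> bool := fun y => `[< exists2 x, I x & y = pi x >].
Lemma push_submod I : submod_closed (push_pred I).
Proof.
split=> [|a _ _ /asboolP[x Ix ->] /asboolP[y Iy ->]]; apply/asboolP.
  by exists 0; [exact: id0|symmetry; apply/pi_eq0; apply: id0].
exists (a * x + y); first by apply: idD => //; apply: idM.
by rewrite piD -(pi_scale N (a : A) (x : A^o)).
Qed.
HB.instance Definition _ (I : ideal A) := GRing.isSubmodClosed.Build A M (push_pred I) (push_submod I).
Definition push I : submodClosed M := GRing.SubmodClosed.clone A M (push_pred I) _.

Lemma pushK I : of_submod N <=i I -> pull (push I) = I.
Proof.
move=> NI; apply: ideal_eq => x; last by move=> Ix; apply/asboolP; exists x.
move=> /asboolP[y Iy E]; rewrite -[x](subrK y); apply: idD => //; apply: NI.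
by apply/pi_eq0; rewrite piD E -piD subrr; apply/pi_eq0; apply: id0.
Qed.

Lemma pull_slt (K K' : submodClosed M) : proper_subpred K K' <->
  slt (@sone A) (pull K) (pull K').
Proof.
have sub (L L' : submodClosed M) : {subset L <= L'} <-> pull L <=i pull L'.
  split=> H x; first exact: H.
  by have [y ->] := pi_surj x => /(H y).
rewrite /slt; split=> [/asboolP[/sub H1 H2]|[H1 H2]]; last apply/asboolP.
  split=> // H; apply: H2; apply/sub => x /H[s ->]; by rewrite mul1r.
split; first exact/sub.
by move=> /sub H; apply: H2; apply: ile_sle.
Qed.

Lemma chain_sorted n : chain (@sone A) n itop (of_submod N) <->
  exists c : seq (submodClosed M), sorted (fun K K' : submodClosed M => proper_subpred K K') c /\
    size c = n.+1.
Proof.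
pose lt := (fun K K' : submodClosed M => proper_subpred K K').
have H (K : submodClosed M) : chain (@sone A) n itop (pull K) <-> exists c, path lt K c /\ size c = n.
  elim: n K => [|n IH] K; first by split=> // _; exists [::].
  split=> [[L KL /= cL]|[[|L c] [] // /andP[KL cL] [sc]]].
    have NL : of_submod N <=i L by apply: ile_trans KL.1; apply: pull_ge.
    rewrite -(pushK NL) in KL cL; have /IH[c [cL' sc]] := cL.
    by exists (push L :: c); rewrite /= cL' sc andbT; split=> //; apply/pull_slt.
  exists (pull L); first exact/pull_slt.
  by apply/IH; exists c.
split=> [|[[|K c] [] // cK [sc]]].
  rewrite -{1}(pushK (@ile_refl _ (of_submod N))) => /H[c [cc sc]].
  by exists (push (of_submod N) :: c); rewrite /= sc.
apply: (@chain_lel _ _ (sone_mulset A) _ _ _ (pull K)); first exact: pull_ge.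
by apply/H; exists c.
Qed.

Lemma mod_lengthE : mod_length M = len (@sone A) itop (of_submod N).
Proof.
rewrite /mod_length /max_chain_length /len; congr xget; apply/seteqP; split=> n /=.
  move=> [/chain_sorted cn H]; split=> // cn1; have [c [cc sc]] := (chain_sorted n.+1).1 cn1.
  by have := H c cc; rewrite sc ltnn.
move=> [/chain_sorted cn nc]; split=> // -[//|K c] cc.
rewrite leqNgt; apply/negP => sc; apply: nc.
apply: (@chain_leq _ (@sone A) n.+1 (size c)) => //.
by apply/chain_sorted; exists (K :: c).
Qed.

End Quotient.

Lemma krull_chain n : (exists c : seq (Spec A), sorted (fun p q => proper_subpred p q) c /\
  size c = n.+1) <-> exists q : ideal A, iprime q /\ pup n q.
Proof.
have H (p : Spec A) : pup n (of_idealr p) <->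
    exists c : seq (Spec A), path (fun p q => proper_subpred p q) p c /\ size c = n.
  elim: n p => [|n IH] p; first by split=> // _; exists [::].
  split=> [[q [qp pq cq]]|[[|q c] [] // /andP[/proper_ilt pq cq] [sc]]].
    rewrite -(to_specK qp) in pq cq; have /IH[c [cc sc]] := cq.
    by exists (to_spec qp :: c); rewrite /= sc cc andbT; split=> //; apply/proper_ilt.
  by exists (of_idealr q); split=> //; [apply: spec_prime|apply/IH; exists c].
split=> [[[|p c] [] // cc [sc]]|[q [qp]]].
  by exists (of_idealr p); split; [apply: spec_prime|apply/H; exists c].
rewrite -(to_specK qp) => /H[c [cc sc]].
by exists (to_spec qp :: c); rewrite /= sc.
Qed.

Lemma krull_dimP n : (exists q : ideal A, iprime q /\ pup n q) -> (forall q : ideal A, iprime q -> ~ pup n.+1 q) ->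
  krull_dim A = n.
Proof.
move=> /(krull_chain n).2 cn nc; rewrite /krull_dim /max_chain_length.
have bound (c : seq (Spec A)) : sorted (fun p q => proper_subpred p q) c -> (size c <= n.+1)%N.
  case: c => // p c cc; rewrite leqNgt; apply/negP => sc.
  have [|q [qp cq]] := (krull_chain (size c)).1; first by exists (p :: c).
  by apply: (nc q qp); apply: pup_ltn cq.
apply: xget_unique => // k [[c [cc sc]] Hk]; apply/eqP; rewrite eqn_leq.
have [c' [cc' sc']] := cn.
by rewrite -ltnS -sc bound//= -ltnS -sc' Hk.
Qed.

(** A positive value cannot be the default of [max_chain_length], so a longest chain exists. *)
Lemma krull_dim_gt0 n : (0 < n)%N -> krull_dim A = n ->
  (exists q : ideal A, iprime q /\ pup n q) /\ (forall q : ideal A, iprime q -> ~ pup n.+1 q).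
Proof.
rewrite /krull_dim /max_chain_length; case: xgetP => [k _ [ck Hk]|_] n0 kn; last by rewrite -kn in n0.
rewrite -kn; split; first exact: (krull_chain k).1.
move=> q qp cq; have [|c [cc sc]] := (krull_chain k.+1).2; first by exists q.
by have := Hk c cc; rewrite sc ltnn.
Qed.

End Bridge.

(** * Ideals under ring homomorphisms *)

Section Preimage.
Variables (A B : comNzRingType) (phi : {rmorphism A -> B}).
Implicit Types (J : ideal A) (K : ideal B).

Definition preim K : ideal A.
Proof.
refine (@Ideal A (fun x : A => K (phi x)) _ _ _).
- by rewrite rmorph0; apply: id0.
- by move=> x y Kx Ky; rewrite rmorphD; apply: idD.
- by move=> a x Kx; rewrite rmorphM; apply: idM.
Defined.

Lemma preim_prime K : iprime K -> iprime (preim K).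
Proof.
move=> [K1 KM]; split=> [|x y]; rewrite /icar /= ?rmorph1// rmorphM; exact: KM.
Qed.

Lemma preimS K K' : K <=i K' -> preim K <=i preim K'.
Proof. by move=> KK' x /KK'. Qed.

Hypothesis surj : forall y, exists x, y = phi x.

Definition image J : ideal B.
Proof.
refine (@Ideal B (fun y => exists2 x, J x & y = phi x) _ _ _).
- by exists 0; [exact: id0|rewrite rmorph0].
- by move=> _ _ [x Jx ->] [y Jy ->]; exists (x + y); [exact: idD|rewrite rmorphD].
- move=> b _ [x Jx ->]; have [a ->] := surj b.
  by exists (a * x); [exact: idM|rewrite rmorphM].
Defined.

Lemma imageS J J' : J <=i J' -> image J <=i image J'.
Proof. by move=> JJ' _ [x /JJ' Jx ->]; exists x. Qed.

Lemma preimK K : image (preim K) = K.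
Proof.
apply: ideal_eq => [_ [x Kx ->]//|y Ky].
by have [x yE] := surj y; exists x => //; rewrite /icar /= -yE.
Qed.

Lemma imageK J : preim ibot <=i J -> preim (image J) = J.
Proof.
move=> kJ; apply: ideal_eq => x; last by move=> Jx; exists x.
move=> [y Jy E]; rewrite -[x](subrK y); apply: idD => //; apply: kJ.
by rewrite /icar /= rmorphB E subrr.
Qed.

Lemma preim_ker K : preim ibot <=i preim K.
Proof. by apply: preimS; apply: ile_bot. Qed.

Lemma preim_le K K' : preim K <=i preim K' -> K <=i K'.
Proof. by move=> /imageS; rewrite !preimK. Qed.

Lemma image_prime J : iprime J -> preim ibot <=i J -> iprime (image J).
Proof.
move=> Jp /imageK E; move: Jp; rewrite -{1}E => -[J1 JM]; split=> [H|x y].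
  by apply: J1; rewrite /icar /= rmorph1.
have [a ->] := surj x; have [b ->] := surj y; rewrite -rmorphM => /(JM a b)//.
Qed.

Lemma pup_preim n K : pup n K <-> pup n (preim K).
Proof.
elim: n K => // n IH K; split=> -[Q [Qp KQ cQ]].
  exists (preim Q); split; [exact: preim_prime| |exact/IH].
  by split; [apply: preimS KQ.1|move=> /preim_le; apply: KQ.2].
have kQ : preim ibot <=i Q by apply: ile_trans KQ.1; apply: preim_ker.
exists (image Q); split; [exact: image_prime| |by apply/IH; rewrite imageK].
by rewrite -(imageK kQ) in KQ; split; [apply: preim_le KQ.1|move=> /preimS; apply: KQ.2].
Qed.

Lemma len_preim K : len (@sone B) itop K = len (@sone A) itop (preim K).
Proof.
rewrite /len; suff H n K' : chain (@sone B) n itop K' <-> chain (@sone A) n itop (preim K').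
  congr xget; apply/seteqP; split=> n [c1 c2]; split; try exact/(H n K).
    by move=> c; apply: c2; apply/(H n.+1 K).
  by move=> c; apply: c2; apply/(H n.+1 K).
have slt_le (R : comNzRingType) (I J : ideal R) : slt (@sone R) I J <-> ilt I J.
  rewrite /slt /ilt; split=> -[IJ nJI]; split=> // JI; apply: nJI.
    exact: ile_sle.
  by move=> x /JI[s ->]; rewrite mul1r.
elim: n K' => [|n IH] K' //; split=> -[Q /slt_le KQ cQ].
  exists (preim Q); last exact/IH.
  by apply/slt_le; split; [apply: preimS KQ.1|move=> /preim_le; apply: KQ.2].
have kQ : preim ibot <=i Q by apply: ile_trans KQ.1; apply: preim_ker.
exists (image Q); last by apply/IH; rewrite imageK.
rewrite -(imageK kQ) in KQ; apply/slt_le.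
by split; [apply: preim_le KQ.1|move=> /preimS; apply: KQ.2].
Qed.

Lemma preim_ipr b : preim (ipr (phi b)) = preim ibot +i ipr b.
Proof.
apply: ideal_eq.
  move=> x [y _ E]; have [a yE] := surj y.
  exists (x - b * a), (b * a); rewrite subrK; split=> //; last by exists a.
  by rewrite /icar /= rmorphB rmorphM E yE subrr.
apply: ile_add; first by apply: preimS; apply: ile_bot.
by apply: imul_top_le; exact: ipr_in.
Qed.

End Preimage.

(** * Quotient rings *)

Section IdealQuotient.
Variables (A : comNzRingType) (I : idealr A).

Definition qpi : {rmorphism A -> {ideal_quot I}} := \pi_({ideal_quot I})%qT.

Lemma qpi_surj y : exists x, y = qpi x.
Proof. by exists (repr y); rewrite /qpi /= reprK. Qed.

Lemma qpi_eq0 x : qpi x = 0 <-> of_idealr I x.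
Proof.
have E : (0 : {ideal_quot I}) = qpi 0 by rewrite rmorph0.
rewrite /icar /= -[x in x \in _]subr0 E; split=> [/eqP|H].
  by rewrite -Quotient.idealrBE.
by apply/eqP; rewrite -Quotient.idealrBE.
Qed.

Lemma qpi_ker : preim qpi ibot = of_idealr I.
Proof. by apply: ideal_eq => x /qpi_eq0. Qed.

Lemma quot_krull_gt0 n : (0 < n)%N -> krull_dim {ideal_quot I} = n ->
  (exists q : ideal A, [/\ iprime q, of_idealr I <=i q & pup n q]) /\
  dimle (of_idealr I) n.
Proof.
move=> n0 /(krull_dim_gt0 n0)[[q [qp cq]] nq]; split.
  exists (preim qpi q); split; [exact: preim_prime| |exact: (pup_preim (@qpi_surj) n q).1].
  by rewrite -qpi_ker; apply: preim_ker.
move=> P Pp IP cP; rewrite -qpi_ker in IP.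
apply: (nq (image (@qpi_surj) P)); first exact: image_prime.
by apply/(pup_preim (@qpi_surj)); rewrite imageK.
Qed.

Lemma quot_krull n : (exists q : ideal A, [/\ iprime q, of_idealr I <=i q & pup n q]) ->
  dimle (of_idealr I) n -> krull_dim {ideal_quot I} = n.
Proof.
move=> [q [qp Iq cq]] dI; apply: krull_dimP.
  rewrite -qpi_ker in Iq; exists (image (@qpi_surj) q); split; first exact: image_prime.
  by apply/(pup_preim (@qpi_surj)); rewrite imageK.
move=> P Pp cP; apply: (dI (preim qpi P)); first exact: preim_prime.
  by rewrite -qpi_ker; apply: preim_ker.
exact/(pup_preim (@qpi_surj)).
Qed.

Lemma colength_quot a : colength (qpi a) = len (@sone A) itop (of_idealr I +i ipr a).
Proof.
rewrite /colength mod_lengthE ideal_gen1 (len_preim qpi_surj) preim_ipr ?qpi_ker//.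
exact: qpi_surj.
Qed.

Lemma quot_regular a : regular_element (qpi a) <->
  forall x, of_idealr I (a * x) -> of_idealr I x.
Proof.
split=> [H x|H y].
  by move=> /qpi_eq0; rewrite rmorphM => /H/qpi_eq0.
by have [x ->] := qpi_surj y; rewrite -rmorphM => /qpi_eq0/H/qpi_eq0.
Qed.

Lemma quot_reduced : reduced_ring {ideal_quot I} <->
  forall x n, of_idealr I (x ^+ n) -> of_idealr I x.
Proof.
split=> [H x n /qpi_eq0|H y n].
  by rewrite rmorphXn => /H/qpi_eq0.
by have [x ->] := qpi_surj y; rewrite -rmorphXn => /qpi_eq0/H/qpi_eq0.
Qed.

End IdealQuotient.

Section LocalRing.
Variables (A : comNzRingType) (noeA : noetherian A) (m : idealr A).
Hypothesis (locm : local_ring m).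
Let noe := noetherian_inoeth noeA.
Local Notation mm := (of_idealr m).

Lemma local_scompl : scompl (@sone A) mm.
Proof.
split=> [s ->|y my]; first exact: of_idealr1.
apply: contrapT => nu.
have [|M [[yM M1] Mmax]] := @acc_max _ (@ile A) (fun I => I y /\ ~ I 1)
    (@ile_refl A) (@ile_trans A) (ideal_acc noe).
  exists (ipr y); split; first exact: ipr_in.
  by move=> [a _ E]; apply: nu; exists a; rewrite mulrC.
have := locm.2 (to_idealr M1).
have max : maximal_ideal (to_idealr M1).
  move=> I MI x Ix; have : M x; last by move=> Mx; apply/asboolP.
  apply: (Mmax (of_idealr I)) => //.
    by split; [apply: MI; apply/asboolP|exact: of_idealr1].
  by move=> z Mz; apply: MI; apply/asboolP.
move=> /(_ max y) E; apply: my; rewrite /icar /= -E; exact/asboolP.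
Qed.

End LocalRing.

(** * Heights in catenary equidimensional rings *)

Section Heights.
Variables (A : comNzRingType).
Implicit Types (p q r : ideal A).

Definition cov q r := ilt q r /\ ~ exists t, [/\ iprime t, ilt q t & ilt t r].
Fixpoint pcov n q p : Prop :=
  if n is n'.+1 then exists q', [/\ iprime q', cov q q' & pcov n' q' p] else q = p.

Lemma pto_max_pcov n q p : pto n q p -> (forall k, pto k q p -> (k <= n)%N) -> pcov n q p.
Proof.
elim: n q => // n IH q [q' [q'p qq' cq]] max.
have max' k : pto k q' p -> (k <= n)%N.
  by move=> ck; rewrite -ltnS; apply: max; exists q'.
exists q'; split=> //; last exact: IH.
split=> // -[t [tp qt tq']].
suff : (n.+2 <= n.+1)%N by rewrite ltnn.
by apply: max; exists t; split=> //; exists q'.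
Qed.

Lemma pcov_rcons n q p r : iprime r -> pcov n q p -> cov p r -> pcov n.+1 q r.
Proof.
move=> rp; elim: n q => [|n IH] q; first by move=> -> pr; exists r.
move=> [q' [q'p qq' cq]] pr; exists q'; split=> //; exact: IH.
Qed.

Lemma pto_pup n q p : pto n q p -> pup n q.
Proof.
elim: n q => // n IH q [q' [q'p qq' cq]].
by exists q'; split=> //; apply: IH.
Qed.

Lemma covers_cov (p q : Spec A) : covers p q <-> cov (of_idealr p) (of_idealr q).
Proof.
split=> [/asboolP[/proper_ilt pq nr]|[pq nr]].
  split=> // -[t [tp pt tq]]; apply: nr; exists (to_spec tp).
  by split; apply/proper_ilt; rewrite to_specK.
apply/asboolP; split; first exact/proper_ilt.
move=> [r [/proper_ilt pr /proper_ilt rq]]; apply: nr.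
by exists (of_idealr r); split=> //; apply: spec_prime.
Qed.

Lemma pcov_path n (q p : Spec A) : pcov n.+1 (of_idealr q) (of_idealr p) ->
  exists c : seq (Spec A), [/\ path (@covers A) q c, last q c = p & size c = n.+1].
Proof.
elim: n q => [|n IH] q [q' [q'p qq' cq]].
  by exists [:: p]; rewrite /= andbT; split=> //; apply/covers_cov; rewrite -cq.
rewrite -(to_specK q'p) in qq' cq; have [c [cc lc sc]] := IH _ cq.
exists (to_spec q'p :: c); rewrite /= cc andbT; split=> //; last by rewrite sc.
exact/covers_cov.
Qed.

Lemma catenary_pcov a b q p : catenary A -> iprime q -> iprime p -> q <=i p ->
  pcov a.+1 q p -> pcov b.+1 q p -> a = b.
Proof.
move=> cat qp pp qqp; rewrite -(to_specK qp) -(to_specK pp) in qqp *.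
move=> /pcov_path[c [cc lc sc]] /pcov_path[c' [cc' lc' sc']].
by have [_ /(_ c c' cc lc cc' lc')] := cat _ _ qqp; rewrite sc sc' => -[].
Qed.

Variable m : ideal A.
Hypothesis mloc : scompl (@sone A) m.

Lemma pup_pto n q : iprime q -> pup n q -> ~ pup n.+1 q -> pto n q m.
Proof.
elim: n q => [|n IH] q qp /=; first by move=> _ H; apply: (loc_pup1 mloc).
move=> [q' [q'p qq' cq]] nq; exists q'; split=> //; apply: IH => // cq'.
by apply: nq; exists q'.
Qed.

Variable d : nat.
Hypotheses (d0 : (0 < d)%N) (dA : dimle (@ibot A) d).
Hypothesis equi : forall q, iprime q -> (forall r, iprime r -> r <=i q -> q <=i r) -> pup d q.
Hypothesis cat : catenary A.

Lemma pto_bound n q p : iprime q -> pto n q p -> (n <= d)%N.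
Proof.
move=> qp /pto_pup cq; rewrite leqNgt; apply/negP => dn.
by apply: (dA qp (@ile_bot _ _)); apply: pup_ltn cq.
Qed.

Lemma max_nat (P : nat -> Prop) : (exists n, P n) -> (forall n, P n -> (n <= d)%N) ->
  exists n, P n /\ forall k, P k -> (k <= n)%N.
Proof.
move=> [n Pn] Pd; apply: contrapT => nex.
suff H k : exists2 n, (k <= n)%N & P n.
  by have [n' dn' /Pd] := H d.+1; rewrite leqNgt dn'.
elim: k => [|k [i ki Pi]]; first by exists n.
have [[j [Pj ij]]|nj] := pselect (exists j, P j /\ (i < j)%N).
  by exists j => //; apply: leq_ltn_trans ij.
case: nex; exists i; split=> // j Pj; rewrite leqNgt; apply/negP => ij.
by apply: nj; exists j.
Qed.

(** A longest chain below p is saturated and starts at a minimal prime; with m added it remains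
    saturated. Equidimensionality gives a saturated chain of length d between the same ends, and
    catenarity makes the two lengths equal. *)
Lemma curve_height p : curve m p ->
  (exists q, iprime q /\ pto d.-1 q p) /\
  (forall q n, iprime q -> pto n q p -> (n <= d.-1)%N).
Proof.
move=> [pp mp cp]; have mprime := loc_prime mloc.
have covpm : cov p m.
  split; first by split=> //; apply: (loc_prime_le mloc).
  move=> [t [tp pt tm]]; apply: cp; exists t; split=> //.
  by exists m; split.
have [||n [[q [qp cq]] nmax]] := @max_nat (fun n => exists q, iprime q /\ pto n q p).
- by exists 0%N, p.
- by move=> n [q [qp cq]]; apply: pto_bound cq.
have minq r : iprime r -> r <=i q -> q <=i r.
  move=> rp rq; apply: contrapT => qr.
  suff : (n.+1 <= n)%N by rewrite ltnn.
  by apply: nmax; exists r; split=> //; exists q.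
have cqm : pto d q m.
  by apply: pup_pto => //; [exact: equi|exact: dA (@ile_bot _ _)].
have pcqm : pcov d q m.
  by apply: pto_max_pcov => // k; apply: pto_bound.
have pcq : pcov n q p by apply: pto_max_pcov => // k ck; apply: nmax; exists q.
have nd : d.-1 = n.
  rewrite -(prednK d0) in pcqm; apply: (catenary_pcov cat qp mprime _ pcqm).
    exact: (loc_prime_le mloc).
  exact: pcov_rcons covpm.
rewrite nd; split; first by exists q.
by move=> r k rp cr; apply: nmax; exists r.
Qed.

End Heights.

(** * Localization at a regular point *)

Section RegularLocus.
Variables (A : comNzRingType) (noe : inoeth A) (p : Spec A) (h : nat).
Local Notation P := (of_idealr p).
Hypothesis Pbound : forall q n, iprime q -> pto n q P -> (n <= h)%N.
Hypothesis Pchain : exists q, iprime q /\ pto h q P.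

Section Localization.
Variables (L : comUnitRingType) (j : {rmorphism A -> L}).
Hypothesis jloc : is_localization [set x | x \notin p] j.

Let junit s : ~ P s -> j s \is a GRing.unit.
Proof. by move=> Ps; case: jloc => H _ _; apply: H; apply/negP. Qed.
Let jfrac y : exists x s, ~ P s /\ y = j x / j s.
Proof.
by case: jloc => _ H _; have [x [s [/negP Ps ->]]] := H y; exists x, s.
Qed.
Let jker x : j x = 0 -> exists2 s, ~ P s & s * x = 0.
Proof. by case: jloc => _ _ H /H[s /negP Ps E]; exists s. Qed.

Lemma jeq x y : j x = j y -> exists2 s, ~ P s & s * x = s * y.
Proof.
move=> E; have [|s Ps /eqP] := jker (x := x - y); first by rewrite rmorphB E subrr.
by rewrite mulrBr subr_eq0 => /eqP; exists s.
Qed.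

Let PM : forall x y, ~ P x -> ~ P y -> ~ P (x * y).
Proof. by move=> x y Px Py /(spec_prime p).2[]. Qed.

Definition jext (q : ideal A) : ideal L.
Proof.
refine (@Ideal L (fun y => exists x s, [/\ q x, ~ P s & y = j x / j s]) _ _ _).
- by exists 0, 1; split; [exact: id0|exact: of_idealr1|rewrite rmorph0 mul0r].
- move=> _ _ [x [s [qx Ps ->]]] [y [t [qy Pt ->]]].
  exists (x * t + y * s), (s * t); split; [|exact: PM|].
    by apply: idD; apply: idMr.
  have us := junit Ps; have ut := junit Pt.
  rewrite rmorphD !rmorphM invrM// mulrDl mulrA mulrK//.
  by rewrite (mulrC (j t)^-1) mulrA mulrK.
- move=> b _ [x [s [qx Ps ->]]]; have [a [t [Pt ->]]] := jfrac b.
  exists (a * x), (t * s); split; [exact: idM|exact: PM|].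
  by rewrite !rmorphM invrM ?junit// mulrACA (mulrC (j t)^-1).
Defined.

Lemma jext_in (q : ideal A) x : iprime q -> q <=i P -> jext q (j x) -> q x.
Proof.
move=> [_ qM] qP [a [s [qa Ps E]]].
have : j (s * x) = j a by rewrite rmorphM E mulrCA mulrV ?mulr1//; apply: junit.
move=> /jeq[t Pt E'].
have : q (t * (s * x)) by rewrite E'; apply: idM.
by case/qM => [/qP//|/qM[/qP|]].
Qed.

Lemma jext_prime (q : ideal A) : iprime q -> q <=i P -> iprime (jext q).
Proof.
move=> qp qP; split; first by rewrite -(rmorph1 j) => /(jext_in qp qP); case: qp.
have unit_in x s y : ~ P s -> jext q y -> y = j x / j s -> q x.
  move=> Ps Jy yE; apply: (jext_in qp qP).
  suff -> : j x = j s * y by apply: idM.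
  by rewrite yE mulrCA mulrV ?mulr1//; apply: junit.
move=> y z Jyz; have [x [s [Ps yE]]] := jfrac y; have [x' [s' [Ps' zE]]] := jfrac z.
have : q (x * x').
  apply: (unit_in _ (s * s') (y * z)) => //; first exact: PM.
  by rewrite yE zE !rmorphM invrM ?junit// mulrACA (mulrC (j s')^-1).
by case: (qp) => _ qM /qM[qx|qx']; [left; exists x, s|right; exists x', s'].
Qed.

Lemma jext_ilt (q r : ideal A) : iprime q -> iprime r -> r <=i P -> ilt q r ->
  ilt (jext q) (jext r).
Proof.
move=> qp rp rP [qr nrq]; split.
  by move=> _ [x [s [qx Ps ->]]]; exists x, s; split=> //; apply: qr.
move=> H; apply: nrq => x rx; apply: jext_in => //; first exact: ile_trans rP.
apply: H; exists x, 1; split=> //; first exact: of_idealr1.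
by rewrite rmorph1 divr1.
Qed.

Lemma pto_jext n q : iprime q -> pto n q P -> pup n (jext q).
Proof.
elim: n q => // n IH q qp [r [rp qr cr]]; have rP := pto_le cr.
exists (jext r); split; [exact: jext_prime|exact: jext_ilt|exact: IH].
Qed.

Lemma preim_le_P (Q : ideal L) : iprime Q -> preim j Q <=i P.
Proof.
move=> [Q1 _] x Qx; apply: contrapT => /junit ux; apply: Q1.
by rewrite -(mulVr ux); apply: idM.
Qed.

Lemma preim_ilt (Q Q' : ideal L) : ilt Q Q' -> ilt (preim j Q) (preim j Q').
Proof.
move=> [QQ' nQ'Q]; split; first exact: preimS.
move=> H; apply: nQ'Q => y Q'y; have [x [s [Ps yE]]] := jfrac y.
rewrite yE; apply: idMr; apply: H.
suff : Q' (j x) by [].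
have -> : j x = j s * y by rewrite yE mulrCA mulrV ?mulr1//; apply: junit.
exact: idM.
Qed.

(** The length can increase because the top of the contracted chain may lie strictly below P. *)
Lemma pup_preim_pto n (Q : ideal L) : iprime Q -> pup n Q ->
  exists2 k, (n <= k)%N & pto k (preim j Q) P.
Proof.
elim: n Q => [|n IH] Q Qp.
  move=> _; have QP := preim_le_P Qp.
  have [PQ|nPQ] := pselect (P <=i preim j Q).
    by exists 0%N => //; apply: ideal_eq.
  by exists 1%N => //; exists P; split=> //; apply: spec_prime.
move=> [Q' [Q'p QQ' /(IH _ Q'p)[k nk ck]]]; exists k.+1 => //.
by exists (preim j Q'); split; [exact: preim_prime|exact: preim_ilt|].
Qed.

Lemma loc_krull_dim : krull_dim L = h.
Proof.
apply: krull_dimP.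
  have [q [qp cq]] := Pchain; exists (jext q).
  by split; [apply: jext_prime => //; apply: pto_le cq|apply: pto_jext].
move=> Q Qp /(pup_preim_pto Qp)[k hk ck].
by have := @Pbound _ k (preim_prime j Qp) ck; rewrite leqNgt hk.
Qed.

Lemma loc_max_in (M : idealr L) x : local_ring M -> P x -> j x \in M.
Proof.
move=> [Mmax Muniq] Px; have J1 : ~ jext P 1.
  by have [] := jext_prime (spec_prime p) (@ile_refl _ P).
have Jmax : maximal_ideal (to_idealr J1).
  move=> I JI y Iy; have : jext P y; last by move=> H; apply/asboolP.
  have [a [s [Ps yE]]] := jfrac y; have [Pa|nPa] := pselect (P a); first by exists a, s.
  exfalso; apply: (@of_idealr1 _ I).
  have -> : 1 = j s / j a * y.
    by rewrite yE mulrA divrK ?mulrV//; apply: junit.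
  exact: (@idM _ (of_idealr I)).
by rewrite -(Muniq _ Jmax); apply/asboolP; exists x, 1; split=> //;
  [exact: of_idealr1|rewrite rmorph1 divr1].
Qed.

Lemma loc_max_P (M : idealr L) x s : ~ P s -> j x / j s \in M -> P x.
Proof.
move=> Ps Mx; apply: contrapT => Px; apply: (@of_idealr1 _ M).
have -> : 1 = j s / j x * (j x / j s).
  by rewrite mulrA divrK ?mulrV//; apply: junit.
exact: (@idM _ (of_idealr M)).
Qed.

Lemma ispan_frac (ts : seq L) (M : idealr L) : (forall t, t \in ts -> t \in M) ->
  exists xs : seq A, [/\ size xs = size ts, ispan xs <=i P &
    forall y, ispan ts y -> jext (ispan xs) y].
Proof.
elim: ts => [|t ts IH] HM.
  exists [::]; split=> // y ->.
  by exists 0, 1; split; [exact: id0|exact: of_idealr1|rewrite rmorph0 mul0r].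
have [|xs [sxs xP Hxs]] := IH; first by move=> t' H; apply: HM; rewrite inE H orbT.
have [x [s [Ps tE]]] := jfrac t.
have Px : P x by apply: (loc_max_P (M := M) Ps); rewrite -tE; apply: HM; rewrite inE eqxx.
exists (x :: xs); split; first by rewrite /= sxs.
  by apply: ile_add => //; apply: imul_top_le.
move=> _ [_ [z [[b _ ->] tz ->]]]; apply: idD.
  apply: idMr; rewrite tE; exists x, s; split=> //; apply: ile_addl; exact: ipr_in.
have [a [s' [xa Ps' ->]]] := Hxs z tz.
by exists a, s'; split=> //; apply: ile_addr.
Qed.

(** Numerators of a regular system of parameters; by [loc_krull_dim] their number is the height of
    P. *)
Lemma regular_loc_span : regular_local_ring L ->
  exists xs : seq A, [/\ size xs = h, ispan xs <=i P & sle (scomp P) P (ispan xs)].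
Proof.
move=> [_ [M locM [t Mt]]].
have tM : forall y, y \in (t : seq L) -> y \in M.
  by move=> y yt; rewrite Mt; apply/ideal_genE => I; apply.
have [xs [sxs xP Hxs]] := ispan_frac tM.
exists xs; split=> //; first by rewrite sxs size_tuple loc_krull_dim.
move=> y Py; have : j y \in M by apply: loc_max_in.
rewrite Mt => jy; have : of_submod (ideal_gen [set x | x \in (t : seq L)]) (j y) by [].
rewrite ideal_gen_seq => /Hxs[a [s [xa Ps E]]].
have : j (s * y) = j a by rewrite rmorphM E mulrCA mulrV ?mulr1//; apply: junit.
move=> /jeq[u Pu E']; exists (u * s); first exact: PM.
by rewrite -mulrA E'; apply: (@idM _ (ispan xs)); apply: xa.
Qed.

End Localization.

Lemma regular_span : regular_locus p ->
  exists xs : seq A, [/\ size xs = h, ispan xs <=i P & sle (scomp P) P (ispan xs)].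
Proof. by move=> [L [j [jloc]]]; apply: (regular_loc_span jloc). Qed.

End RegularLocus.

(** * Dense open sets *)

Section OpenSets.
Variables (A : comNzRingType) (noe : inoeth A) (d : nat).
Hypotheses (d0 : (0 < d)%N) (dA : dimle (@ibot A) d).

(** A prime q over b with a chain of length d above it would be minimal. Some y outside q lies in
    every listed prime not contained in q, so all points of D(y) contain q, hence b, and D(y) misses
    U. *)
Lemma open_ideal (U : set (Spec A)) : open U -> dense U ->
  exists b : ideal A, (forall q : Spec A, U q <-> ~ b <=i of_idealr q) /\ dimle b d.-1.
Proof.
move=> [E UE] dU; exists (of_submod (ideal_gen E)).
have HU (q : Spec A) : U q <-> ~ of_submod (ideal_gen E) <=i of_idealr q.
  rewrite UE /=; split=> [[x Ex /negP qx] H|H].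
    by apply/qx/H/ideal_genE => I; apply.
  apply: contrapT => nE; apply: H => x /ideal_genE; apply=> y Ey.
  by apply: contrapT => /negP qy; apply: nE; exists y.
split=> // q qp bq; rewrite prednK// => cq.
have minq r : iprime r -> r <=i q -> q <=i r.
  move=> rp rq; apply: contrapT => qr; apply: (dA rp (@ile_bot _ r)).
  by exists q; split.
have [Ps [HP HJ]] := prime_list noe (@ibot A).
have [y [qy Py]] : exists y, ~ q y /\ forall R, R \in Ps -> ~ R <=i q -> R y.
  elim: (Ps) {HP HJ} => [|R Rs [y [qy Ry]]]; first by exists 1; split=> //; case: qp.
  have [Rq|/existsNP[z /not_implyP[Rz qz]]] := pselect (R <=i q).
    by exists y; split=> // T; rewrite inE => /orP[/eqP->//|/Ry].
  exists (y * z); split; first by case: qp => _ qM /qM[].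
  move=> T; rewrite inE => /orP[/eqP-> _|/Ry H /H]; [exact: idM|exact: idMr].
have [||r [Vr Ur]] := dU [set r : Spec A | y \notin r].
- by exists (to_spec qp); apply/negP => /asboolP.
- exists [set y]; apply/seteqP; split=> r /=; first by exists y.
  by move=> [_ ->].
have rp := spec_prime r.
have [R [RPs Rr]] := iprime_foldr rp (ile_trans HJ (@ile_bot _ (of_idealr r))).
have [Rp _] := HP R RPs.
have Rq : R <=i q by apply: contrapT => nRq; move/negP: Vr; apply; apply: Rr; apply: Py.
have qr : q <=i of_idealr r by apply: ile_trans Rr; apply: minq.
by move/HU: Ur; apply; apply: ile_trans qr.
Qed.

End OpenSets.

(** * Total rings of fractions *)

Section TotalFractions.
Local Open Scope quotient_scope.
Variable B : comNzRingType.

Lemma regular1 : regular_element (1 : B).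
Proof. by move=> x; rewrite mul1r. Qed.
Lemma regularM (a b : B) : regular_element a -> regular_element b -> regular_element (a * b).
Proof. by move=> ra rb x; rewrite -mulrA => /ra/rb. Qed.
Lemma regular_inj (a x y : B) : regular_element a -> a * x = a * y -> x = y.
Proof.
by move=> ra E; apply/eqP; rewrite -subr_eq0; apply/eqP/ra; rewrite mulrBr E subrr.
Qed.

(** Membership in [ord_values] asks for a total ring of fractions, so one has to be built; all
    regular elements serve as denominators. *)
Record frac := Frac { fnum : B; fden : B; fden_reg : regular_element fden }.
HB.instance Definition _ := gen_eqMixin frac.
HB.instance Definition _ := gen_choiceMixin frac.

Definition frac_eqv (x y : frac) : bool := `[< fnum x * fden y = fnum y * fden x >].

Lemma frac_eqv_equiv : equiv_class_of frac_eqv.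
Proof.
split=> [x|x y|y x z]; first exact/asboolP.
  by apply/idP/idP => /asboolP E; apply/asboolP.
move=> /asboolP E1 /asboolP E2; apply/asboolP; apply: (@regular_inj (fden y)); first exact: fden_reg.
by rewrite (AC (1*2) (2*1*3))/= E1 (ACl (1*3*2))/= E2 (ACl (1*3*2))/= mulrC mulrA.
Qed.

Canonical frac_equiv := EquivRelPack frac_eqv_equiv.
Definition total_frac := {eq_quot frac_eqv}.
HB.instance Definition _ := Choice.on total_frac.

Definition tpi (x : frac) : total_frac := \pi_({eq_quot frac_eqv}) x.

Lemma tpi_eq x y : tpi x = tpi y <-> fnum x * fden y = fnum y * fden x.
Proof.
rewrite /tpi; split=> [/eqP|E]; first by rewrite eqmodE => /asboolP.
by apply/eqP; rewrite eqmodE; apply/asboolP.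
Qed.

Lemma tpi_surj t : exists x, t = tpi x.
Proof. by exists (repr t); rewrite /tpi reprK. Qed.

Definition lift1 (f : frac -> frac) (t : total_frac) := tpi (f (repr t)).
Definition lift2 (f : frac -> frac -> frac) (t u : total_frac) := tpi (f (repr t) (repr u)).

Lemma tpi_repr x : fnum (repr (tpi x)) * fden x = fnum x * fden (repr (tpi x)).
Proof. by apply/tpi_eq; rewrite /tpi reprK. Qed.

Definition fadd x y :=
  @Frac (fnum x * fden y + fnum y * fden x) _ (regularM (@fden_reg x) (@fden_reg y)).
Definition fmul x y := @Frac (fnum x * fnum y) _ (regularM (@fden_reg x) (@fden_reg y)).
Definition fopp x := @Frac (- fnum x) _ (@fden_reg x).
Definition finj a := @Frac a 1 regular1.

Definition tadd := lift2 fadd.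
Definition tmul := lift2 fmul.
Definition topp := lift1 fopp.

Lemma tpi_ext x y : fnum x = fnum y -> fden x = fden y -> tpi x = tpi y.
Proof. by move=> E1 E2; apply/tpi_eq; rewrite E1 E2. Qed.

Lemma taddE x y : tadd (tpi x) (tpi y) = tpi (fadd x y).
Proof.
apply/tpi_eq => /=; have := tpi_repr x; have := tpi_repr y.
move: (repr (tpi x)) (repr (tpi y)) => x' y' Ey Ex.
rewrite !mulrDl; congr (_ + _).
  by rewrite mulrACA Ex (AC (2*2) (1*4*(2*3)))/=.
by rewrite (AC (2*2) (1*4*(3*2)))/= Ey (AC (2*2) (1*3*(4*2)))/=.
Qed.

Lemma tmulE x y : tmul (tpi x) (tpi y) = tpi (fmul x y).
Proof. by apply/tpi_eq => /=; rewrite mulrACA !tpi_repr mulrACA. Qed.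

Lemma toppE x : topp (tpi x) = tpi (fopp x).
Proof. by apply/tpi_eq => /=; rewrite !mulNr tpi_repr. Qed.

Lemma taddA : associative tadd.
Proof.
move=> t u v; have [x ->] := tpi_surj t; have [y ->] := tpi_surj u; have [z ->] := tpi_surj v.
rewrite !taddE; apply: tpi_ext; rewrite /= ?mulrA// !mulrDl addrA.
by congr (_ + _ + _); rewrite ?mulrA// (ACl (1*3*2)).
Qed.
Lemma taddC : commutative tadd.
Proof.
move=> t u; have [x ->] := tpi_surj t; have [y ->] := tpi_surj u.
by rewrite !taddE; apply: tpi_ext; rewrite /= 1?addrC// mulrC.
Qed.
Lemma tadd0 : left_id (tpi (finj 0)) tadd.
Proof.
move=> t; have [x ->] := tpi_surj t.
by rewrite !taddE; apply: tpi_ext; rewrite /= ?mul0r ?add0r ?mulr1 ?mul1r.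
Qed.
Lemma taddN : left_inverse (tpi (finj 0)) topp tadd.
Proof.
move=> t; have [x ->] := tpi_surj t.
by rewrite toppE taddE; apply/tpi_eq; rewrite /= mulNr addNr !mul0r.
Qed.
HB.instance Definition _ := GRing.isZmodule.Build total_frac taddA taddC tadd0 taddN.

Lemma tmulA : associative tmul.
Proof.
move=> t u v; have [x ->] := tpi_surj t; have [y ->] := tpi_surj u; have [z ->] := tpi_surj v.
by rewrite !tmulE; apply: tpi_ext; rewrite /= mulrA.
Qed.
Lemma tmulC : commutative tmul.
Proof.
move=> t u; have [x ->] := tpi_surj t; have [y ->] := tpi_surj u.
by rewrite !tmulE; apply: tpi_ext; rewrite /= mulrC.
Qed.
Lemma tmul1 : left_id (tpi (finj 1)) tmul.
Proof.
move=> t; have [x ->] := tpi_surj t.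
by rewrite !tmulE; apply: tpi_ext; rewrite /= mul1r.
Qed.
Lemma tmulDl : left_distributive tmul tadd.
Proof.
move=> t u v; have [x ->] := tpi_surj t; have [y ->] := tpi_surj u; have [z ->] := tpi_surj v.
rewrite !(taddE, tmulE); apply/tpi_eq; rewrite /= !mulrDl.
by congr (_ + _); rewrite !mulrA [LHS](ACl (1*3*2*5*4*6*7)).
Qed.
Lemma tone_neq0 : tpi (finj 1) != tpi (finj 0).
Proof. by apply/eqP => /tpi_eq /= /eqP; rewrite !mulr1 oner_eq0. Qed.
HB.instance Definition _ :=
  GRing.Zmodule_isComNzRing.Build total_frac tmulA tmulC tmul1 tmulDl tone_neq0.

Definition tunit : pred total_frac := fun t => `[< exists u, u * t = 1 >].
Definition tinv (t : total_frac) : total_frac := xget t [set u | u * t = 1].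
Lemma tmulV : {in tunit, left_inverse 1 tinv *%R}.
Proof.
move=> t /asboolP H; rewrite /tinv; case: xgetP => [u _ //|nu].
by case: H => u /nu.
Qed.
Lemma tunitP (t u : total_frac) : u * t = 1 -> tunit t.
Proof. by move=> E; apply/asboolP; exists u. Qed.
Lemma tinv_out : {in [predC tunit], tinv =1 id}.
Proof.
move=> t /negP tu; rewrite /tinv; case: xgetP => // u _ E.
by case: tu; apply/asboolP; exists u.
Qed.
HB.instance Definition _ :=
  GRing.ComNzRing_hasMulInverse.Build total_frac tmulV tunitP tinv_out.

Definition tofrac (a : B) : total_frac := tpi (finj a).
Lemma tofrac_zmod : zmod_morphism tofrac.
Proof.
move=> a b; rewrite /tofrac -[- tpi _]/(topp _) -[_ + topp _]/(tadd _ _) toppE taddE.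
by apply: tpi_ext; rewrite /= ?mulr1.
Qed.
Lemma tofrac_monoid : monoid_morphism tofrac.
Proof.
split=> // a b; rewrite /tofrac -[tpi _ * _]/(tmul _ _) tmulE.
by apply: tpi_ext; rewrite /= ?mulr1.
Qed.
HB.instance Definition _ := GRing.isZmodMorphism.Build B total_frac tofrac tofrac_zmod.
HB.instance Definition _ := GRing.isMonoidMorphism.Build B total_frac tofrac tofrac_monoid.

Lemma total_fractions : exists (L : comUnitRingType) (j : {rmorphism B -> L}),
  is_localization (@regular_element B) j.
Proof.
exists total_frac, tofrac.
have runit s (rs : regular_element s) :
    tpi (@Frac 1 s rs) * tofrac s = 1.
  rewrite /tofrac -[tpi _ * _]/(tmul _ _) tmulE.
  by apply/tpi_eq; rewrite /= ?mulr1 ?mul1r.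
have ju s : regular_element s -> tofrac s \is a GRing.unit.
  by move=> rs; apply/asboolP; exists (tpi (@Frac 1 s rs)).
split=> // [t|x].
  have [[a s rs] ->] := tpi_surj t; exists a, s; split=> //.
  apply: (mulIr (ju s rs)); rewrite divrK ?ju// /tofrac -[tpi _ * _]/(tmul _ _) tmulE.
  by apply/tpi_eq; rewrite /= ?mulr1.
move=> /tpi_eq /=; rewrite !mulr1 => ->; exists 1; [exact: regular1|by rewrite mulr0].
Qed.

End TotalFractions.

(** * Unions of curves *)

Section CurveUnions.
Variables (A : comNzRingType) (noe : inoeth A) (m : ideal A).
Hypothesis mloc : scompl (@sone A) m.
Implicit Types (I J P Q q : ideal A) (x y f g a : A) (D : seq (ideal A)).
Local Notation S1 := (@sone A).
Local Notation len1 := (len S1).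
Local Notation fin1 := (fin S1).
Let Sm := sone_mulset A.

Lemma ordz_congr q x y : q (x - y) -> ordz q x = ordz q y.
Proof.
move=> qxy; rewrite /ordz; congr (Posz (len _ _ _)).
have H u v : q (u - v) -> q +i ipr u <=i q +i ipr v.
  move=> quv; apply: ile_add; first exact: ile_addl.
  apply: imul_top_le; rewrite -[u](subrK v); apply: idD.
    exact: ile_addl.
  by apply: ile_addr; apply: ipr_in.
by apply: ideal_eq; apply: H => //; rewrite -opprB; apply: idN.
Qed.

Lemma ordz1 q : ordz q 1 = 0.
Proof.
rewrite /ordz (_ : q +i ipr 1 = itop) ?len_refl//.
by apply: ideal_eq => // x _; apply: ile_addr; exists x; rewrite ?mul1r.
Qed.

Section Curves.
Variables (I : ideal A) (D : seq (ideal A)).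
Hypotheses (dI : dimle I 1) (uD : uniq D).
Hypothesis (HD : forall q, q \in D <-> curve m q /\ I <=i q).

Lemma curves_min q P : q \in D -> iprime P -> I <=i P -> P <=i q -> q <=i P.
Proof.
move=> /HD[[qp mq cq] Iq] Pp IP Pq; apply: contrapT => nqP.
apply: (dI Pp IP); exists q; split=> //; exists m; split=> //.
  exact: loc_prime mloc.
by split=> //; apply: (loc_prime_le mloc).
Qed.

Lemma curves_param a : (forall q, q \in D -> ~ q a) -> dimle (I +i ipr a) 0.
Proof.
move=> Da P Pp IaP cP; have IP : I <=i P by apply: (ile_trans _ IaP); apply: ile_addl.
have PD : P \in D.
  by apply/HD; split=> //; split=> //; [apply: (pup_not_max mloc cP)|exact: dI].
by apply: (Da P PD); apply: IaP; apply: ile_addr; apply: ipr_in.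
Qed.

(** Since a is regular modulo I, the kernel term of [ez] vanishes and the colength is the Euler
    characteristic of a on A / I. *)
Lemma curves_colength a : (forall q, q \in D -> ~ q a) ->
  (forall x, I (a * x) -> I x) ->
  (forall q, q \in D -> fin (scomp q) itop I) /\
  (len1 itop (I +i ipr a))%:Z = \sum_(q <- D) ordz q a * lenz (scomp q) itop I.
Proof.
move=> Da ra.
have Fa : fin1 itop (I +i ipr a) by apply: (dimle0_fin noe mloc); apply: curves_param.
have [|||||F E] := @ez_formula A noe m mloc I a D uD _ _ _ Fa itop I.
- by move=> q qD; have [[qp mq _] _] := (HD q).1 qD; split=> //; apply: Da.
- by move=> q q' /HD[cq _] /HD[cq' _]; apply: (curve_anti mloc).
- move=> q qp Iq; have [qm|qm] := pselect (m <=i q).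
    by right; apply: ideal_eq => //; apply: (loc_prime_le mloc).
  by left; apply/HD; split=> //; split=> //; apply: dI.
- exact: ile_top.
- exact: iprod_lel.
split=> //; rewrite -E /ez /symstep /lenz icap_idl//.
have -> : icolon I a = I by apply: ideal_eq; [exact: ra|exact: icolon_le].
by rewrite len_refl// subr0 isumC.
Qed.

(** If a were in q, choose y outside q in all listed primes not contained in q. Then a y lies in
    every listed prime, so it is nilpotent modulo I; reducedness and regularity put y into I, a
    contradiction. *)
Lemma regular_avoid_curves a : (forall x n, I (x ^+ n) -> I x) ->
  (forall x, I (a * x) -> I x) -> forall q, q \in D -> ~ q a.
Proof.
move=> rad ra q qD qa; have [[qp mq _] Iq] := (HD q).1 qD.
have [Ps [HP HJ]] := prime_list noe I.
have [|y [qy Py]] := @avoid_others _ [seq P <- Ps | `[< ~ P <=i q >]] q _ qp.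
  by move=> P; rewrite mem_filter => /andP[/asboolP nPq /HP[Pp _]].
apply: (qy); apply: Iq; apply: ra; apply: (rad _ (size Ps)); apply: HJ.
have : forall P, P \in Ps -> P (a * y).
  move=> P PPs; have [Pp IP] := HP P PPs; have [Pq|nPq] := pselect (P <=i q).
    by apply: idMr; apply: (curves_min qD).
  by apply: idM; apply: Py; rewrite mem_filter PPs andbT; apply/asboolP.
move: (a * y) => z; elim: (Ps) => //= P Rs IH Hz; rewrite exprS.
apply: iprod_in; first by apply: Hz; rewrite inE eqxx.
by apply: IH => R RRs; apply: Hz; rewrite inE RRs orbT.
Qed.

End Curves.

Definition icaps D := foldr (@icap A) itop D.

Lemma icapsP D x : icaps D x <-> forall q, q \in D -> q x.
Proof.
elim: D => [|q D IH]; first by split.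
split=> [[qx /IH Dx] r|H].
  by rewrite inE => /orP[/eqP->//|/Dx].
split; first by apply: H; rewrite inE eqxx.
by apply/IH => r rD; apply: H; rewrite inE rD orbT.
Qed.

Lemma icaps_prime D P : iprime P -> icaps D <=i P -> exists2 q, q \in D & q <=i P.
Proof.
move=> Pp DP; have [|q [qD qP]] := @iprime_foldr _ P D Pp; last by exists q.
apply: ile_trans DP; elim: (D) => //= q D' IH.
by apply: ile_cap; [exact: iprod_lel|apply: ile_trans IH; apply: iprod_ler].
Qed.

Section Union.
Variables (D : seq (ideal A)).
Hypotheses (uD : uniq D) (HD : forall q, q \in D -> curve m q).
Local Notation I := (icaps D).

Lemma icaps_le q : q \in D -> I <=i q.
Proof. by move=> qD x /icapsP; apply. Qed.

Lemma icaps_dimle : dimle I 1.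
Proof.
move=> P Pp /(icaps_prime Pp)[q qD qP] cP; have [_ _] := HD qD; apply.
exact: pup_lel cP.
Qed.

Lemma icaps_curves q : q \in D <-> curve m q /\ I <=i q.
Proof.
split=> [qD|[cq Iq]]; first by split; [exact: HD|exact: icaps_le].
have [|r rD rq] := icaps_prime _ Iq; first by case: cq.
by rewrite -(curve_anti mloc (HD rD) cq rq).
Qed.

Lemma icaps_rad x n : I (x ^+ n) -> I x.
Proof.
move=> /icapsP H; apply/icapsP => q qD; apply: (@iprimeX _ q x n); last exact: H.
by case: (HD qD).
Qed.

Lemma icaps_regular a : (forall q, q \in D -> ~ q a) -> forall x, I (a * x) -> I x.
Proof.
move=> Da x /icapsP H; apply/icapsP => q qD.
by have [[_ qM] _ _] := HD qD; have [/Da|] := qM _ _ (H q qD).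
Qed.

Lemma separate : exists h : ideal A -> A, forall q, q \in D ->
  ~ q (h q) /\ forall r, r \in D -> r != q -> r (h q).
Proof.
suff /choice[h H] : forall q, exists x, q \in D ->
    ~ q x /\ forall r, r \in D -> r != q -> r x by exists h.
move=> q; have [qD|qD] := boolP (q \in D); last by exists 0.
have [qp _ _] := HD qD.
have [|x [qx Dx]] := @avoid_others _ (rem q D) q _ qp.
  move=> r; rewrite (mem_rem_uniq _ uD) inE => /andP[rq rD]; have [rp _ _] := HD rD.
  by split=> // /(curve_anti mloc (HD rD) (HD qD)) E; rewrite E eqxx in rq.
exists x => _; split=> // r rD rq; apply: Dx.
by rewrite (mem_rem_uniq _ uD) inE rq.
Qed.

(** An element outside q that lies in all the other curves multiplies q into I, so I and q agree
    after localization at q. *)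
Lemma icaps_len q : q \in D -> fin (scomp q) itop I -> lenz (scomp q) itop I = 1.
Proof.
move=> qD F; have [qp _ _] := HD qD; have qm := scomp_mulset qp.
rewrite /lenz (lenD qm (icaps_le qD) (@ile_top _ q) F).
rewrite (len_scompl qm (scompl_comp q)).2 (len_sle qm (icaps_le qD) _).2//.
have [h H] := separate; have [qh rh] := H q qD.
move=> y qy; exists (h q) => //; apply/icapsP => r rD.
have [->|rq] := eqVneq r q; first exact: idM.
by apply: idMr; apply: rh.
Qed.

Lemma icaps_colength a : (forall q, q \in D -> ~ q a) ->
  (len1 itop (I +i ipr a))%:Z = \sum_(q <- D) ordz q a.
Proof.
move=> Da; have [F ->] := curves_colength icaps_dimle uD icaps_curves Da (icaps_regular Da).
apply: eq_big_seq => q qD; rewrite icaps_len ?mulr1//; exact: F.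
Qed.

(** On each curve V(q) the sum reduces to [F q * h q]. The surplus orders of [h] do not depend on F,
    so they cancel in a difference of two such sums. *)
Lemma interpolate (F h : ideal A -> A) : (forall q, q \in D -> ~ q (F q)) ->
  (forall q, q \in D -> ~ q (h q) /\ forall r, r \in D -> r != q -> r (h q)) ->
  let a := \sum_(q <- D) F q * h q in
  (forall q, q \in D -> ~ q a) /\
  (len1 itop (I +i ipr a))%:Z = \sum_(q <- D) (ordz q (F q) + ordz q (h q)).
Proof.
move=> HF Hh a; have aq q : q \in D -> q (a - F q * h q).
  move=> qD; rewrite /a (bigD1_seq q qD uD)/= [_ + _ - _]addrAC subrr add0r big_seq_cond.
  apply: id_sum => r /andP[rD rq]; apply: idM.
  by have [_] := Hh r rD; apply=> //; rewrite eq_sym.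
have na q : q \in D -> ~ q a.
  move=> qD qa; have [[_ qM] _ _] := HD qD.
  have /qM[/(HF q qD)//|] : q (F q * h q).
    by rewrite -[_ * _](subKr a); apply: idB => //; apply: aq.
  by have [] := Hh q qD.
split=> //; rewrite icaps_colength//; apply: eq_big_seq => q qD.
rewrite (ordz_congr (aq q qD)) (ordzM noe mloc)//; [exact: HD|exact: HF|].
by have [] := Hh q qD.
Qed.

End Union.

(** Turns an integral combination of orders on different curves into the order of a single fraction
    a / b on their union. *)
Lemma ospan_curves (U : ideal A -> Prop) q0 z : curve m q0 -> U q0 -> ospan m U z ->
  exists D (a b : A), [/\ uniq D /\ D != [::],
    forall q, q \in D -> [/\ curve m q, U q, ~ q a & ~ q b] &
    z = (len1 itop (icaps D +i ipr a))%:Z - (len1 itop (icaps D +i ipr b))%:Z].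
Proof.
move=> cq0 Uq0 oz.
suff [D [F [G [uD HD zE]]]] : exists D (F G : ideal A -> A),
   [/\ uniq D /\ D != [::], forall q, q \in D -> [/\ curve m q, U q, ~ q (F q) & ~ q (G q)] &
   z = \sum_(q <- D) (ordz q (F q) - ordz q (G q))].
  have HD' q : q \in D -> curve m q by case/HD.
  have [h Hh] := separate uD.1 HD'.
  have [|Da aE] := interpolate uD.1 HD' (F := F) _ Hh; first by move=> q /HD[].
  have [|Db bE] := interpolate uD.1 HD' (F := G) _ Hh; first by move=> q /HD[].
  exists D, (\sum_(q <- D) F q * h q), (\sum_(q <- D) G q * h q); split=> //.
    by move=> q qD; have [? ? _ _] := HD q qD; split=> //; [exact: Da|exact: Db].
  rewrite aE bE zE -sumrB; apply: eq_bigr => q _.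
  by rewrite opprD addrACA subrr addr0.
have step D F G q f g : curve m q -> U q -> ~ q f -> ~ q g -> uniq D /\ D != [::] ->
    (forall q, q \in D -> [/\ curve m q, U q, ~ q (F q) & ~ q (G q)]) ->
    exists D' (F' G' : ideal A -> A), [/\ uniq D' /\ D' != [::],
    forall q, q \in D' -> [/\ curve m q, U q, ~ q (F' q) & ~ q (G' q)] &
    \sum_(q <- D) (ordz q (F q) - ordz q (G q)) + (ordz q f - ordz q g) =
    \sum_(q <- D') (ordz q (F' q) - ordz q (G' q))].
  (* On a curve already present, f and g are multiplied into the given functions, because orders are
     additive; thus no curve is repeated. *)
  move=> cq Uq qf qg uD HD; have [qD|qD] := boolP (q \in D).
    exists D, (fun r => if r == q then F r * f else F r), (fun r => if r == q then G r * g else G r).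
    split=> // [r rD|].
      have [cr Ur rF rG] := HD r rD; have [[_ rM] _ _] := cr.
      by case: eqVneq => [rq|//]; rewrite -rq in qf qg; split=> //; move=> /rM[].
    rewrite !(bigD1_seq q qD uD.1) /= eqxx.
    have [_ _ qF qG] := HD q qD; rewrite !(ordzM noe mloc)// addrAC; congr (_ + _).
      by rewrite opprD addrACA.
    by apply: eq_bigr => r /negPf ->.
  exists (q :: D), (fun r => if r == q then f else F r), (fun r => if r == q then g else G r).
  split=> [|r|]; first by rewrite /= qD uD.1.
    by rewrite inE; case: eqVneq => [-> _|_ /= /HD].
  rewrite big_cons eqxx addrC; congr (_ + _); apply: eq_big_seq => r rD.
  by case: eqVneq => // E; rewrite -E rD in qD.
have n1 q : curve m q -> ~ q 1 by case=> -[].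
elim: oz => [|{}z q g cq Uq qg _ [D [F [G [uD HD ->]]]]|{}z q g cq Uq qg _ [D [F [G [uD HD ->]]]]].
(* Even the value 0 needs a nonempty union, since the subscheme must have dimension one; [q0]
   provides it. *)
- exists [:: q0], (fun=> 1), (fun=> 1); split=> // [q|]; last by rewrite big_seq1 subrr.
  by rewrite inE => /eqP->; split=> //; apply: n1.
- have [D' [F' [G' [uD' HD' E]]]] := step D F G q g 1 cq Uq qg (n1 q cq) uD HD.
  by exists D', F', G'; split=> //; rewrite -E ordz1 subr0.
- have [D' [F' [G' [uD' HD' E]]]] := step D F G q 1 g cq Uq (n1 q cq) qg uD HD.
  by exists D', F', G'; split=> //; rewrite -E ordz1 sub0r.
Qed.

End CurveUnions.

(** * The two invariants *)

(** Bezout for a possibly infinite set: the gcd is the least positive element of the generated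
    subgroup G, or 0 when G has none. So it belongs to every subgroup containing S. *)
Lemma gcd_setP (S : set nat) : (forall x, S x -> (gcd_set S %| x)%N) /\
  forall H : int -> Prop, H 0 -> (forall a b, H a -> H b -> H (a - b)) ->
    (forall x, S x -> H x%:Z) -> H (gcd_set S)%:Z.
Proof.
pose G (z : int) := forall H : int -> Prop, H 0 -> (forall a b, H a -> H b -> H (a - b)) ->
  (forall x, S x -> H x%:Z) -> H z.
have G0 : G 0 by move=> H.
have GB a b : G a -> G b -> G (a - b).
  by move=> Ga Gb H H0 HB HS; apply: (HB); [apply: Ga|apply: Gb].
have GS x : S x -> G x%:Z by move=> Sx H _ _; apply.
have GM a (n : nat) : G a -> G (a * n%:Z).
  move=> Ga; elim: n => [|n IH]; first by rewrite mulr0.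
  have -> : a * n.+1%:Z = a * n%:Z - (0 - a) by rewrite sub0r opprK -addn1 PoszD mulrDr mulr1.
  by apply: (GB _ _ IH); apply: GB.
have Gd (d : nat) z : (forall x, S x -> (d %| x)%N) -> G z -> (d%:Z %| z)%Z.
  move=> Sd Gz; apply: (Gz (fun z => (d%:Z %| z)%Z)) => [|a b|x /Sd//]; first exact: dvdz0.
  exact: rpredB.
have [g [Gg gS]] : exists g : nat, G g%:Z /\ forall x, S x -> (g %| x)%N.
  have [[n0 Hn0]|nG] := pselect (exists n : nat, `[< (0 < n)%N /\ G n%:Z >]); last first.
    exists 0%N; split=> // x Sx; rewrite dvd0n; have [//|x0] := posnP x.
    by case: nG; exists x; apply/asboolP; split=> //; apply: GS.
  have ex : exists n : nat, `[< (0 < n)%N /\ G n%:Z >] by exists n0.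
  case: (ex_minnP ex) => g /asboolP[g0 Gg] gmin; exists g; split=> // x Sx.
  rewrite /dvdn; apply: contrapT => /negP; rewrite -lt0n => r0.
  suff : (g <= x %% g)%N by rewrite leqNgt ltn_pmod.
  apply: gmin; apply/asboolP; split=> //.
  have -> : (x %% g)%N%:Z = x%:Z - g%:Z * (x %/ g)%N%:Z.
    by rewrite {2}(divn_eq x g) PoszD PoszM [g%:Z * _]mulrC addrAC subrr add0r.
  by apply: GB; [exact: GS|exact: GM].
suff -> : gcd_set S = g by split.
apply: xget_unique => [|h [hS hmax]].
  by split=> // d dS; apply: (Gd d g%:Z).
apply/eqP; rewrite eqn_dvd; apply/andP; split; last exact: hmax.
by have := Gd h g%:Z hS Gg.
Qed.

(** * The multiplicity as a well-defined number *)

Section HilbertSamuel.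
Variables (A : comNzRingType).
Implicit Types (Q : ideal A) (d : nat).

Lemma hsmult_unique d Q z z' : hsmult d Q z -> hsmult d Q z' -> z = z'.
Proof.
move=> [P [n0 HP] ->] [P' [n1 HP'] ->]; suff -> : P = P' by [].
apply/eqP; rewrite -subr_eq0; apply/eqP.
pose rs : seq rat := [seq (maxn n0 n1 + i)%:R | i <- iota 0 (size (P - P'))].
apply: (@roots_geq_poly_eq0 _ _ rs).
- apply/allP => _ /mapP[i _ ->]; rewrite /root hornerD hornerN HP ?HP' ?subrr//.
    by rewrite (leq_trans (leq_maxr n0 n1)) ?leq_addr.
  by rewrite (leq_trans (leq_maxl n0 n1)) ?leq_addr.
- rewrite map_inj_uniq ?iota_uniq// => i j /eqP.
  by rewrite eqr_nat eqn_add2l => /eqP.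
- by rewrite size_map size_iota.
Qed.

Lemma multiplicity_hsmult (Q : idealr A) e :
  hsmult (krull_dim A) (of_idealr Q) e%:R -> multiplicity Q = e.
Proof.
have E n : mod_length (mod_quot (ideal_power Q n)) =
    len (@sone A) itop (ipow (of_idealr Q) n) by rewrite mod_lengthE ideal_powerE.
move=> He; apply: xget_unique => [|e' [P [[n0 HP] eE]]].
  by case: (He) => P [n0 HP] eE; exists P; split=> //; exists n0 => n nn; rewrite E; apply: HP.
have /(hsmult_unique He)/eqP : hsmult (krull_dim A) (of_idealr Q) e'%:R.
  by exists P => //; exists n0 => n nn; rewrite -E; apply: HP.
by rewrite eqr_nat => /eqP.
Qed.

(** The second case is the default value; it is harmless because 0 belongs to every span of
    orders. *)
Lemma multiplicity_cases (Q : idealr A) :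
  hsmult (krull_dim A) (of_idealr Q) (multiplicity Q)%:R \/ multiplicity Q = 0%N.
Proof.
rewrite {2}/multiplicity; case: xgetP => [e _ [P [[n0 HP] eE]]|]; [left|by right].
have H : hsmult (krull_dim A) (of_idealr Q) e%:R.
  by exists P => //; exists n0 => n nn; rewrite -ideal_powerE -mod_lengthE; apply: HP.
by rewrite (multiplicity_hsmult H).
Qed.

End HilbertSamuel.

(** * Comparison of the two ideals of integers *)

Section Main.
Variables (A : comNzRingType) (mm : idealr A).
Hypotheses (noeA : noetherian A) (locm : local_ring mm) (eqd : equidimensional A).
Hypotheses (d0 : (0 < krull_dim A)%N) (cat : catenary A).
Local Notation m := (of_idealr mm).
Local Notation d := (krull_dim A).
Local Notation S1 := (@sone A).
Local Notation len1 := (len S1).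
Let noe := noetherian_inoeth noeA.
Let mloc := local_scompl noeA locm.
Implicit Types (I J Q q b : ideal A) (p : Spec A).

Let dA : dimle (@ibot A) d.
Proof. by move=> q qp _; apply: (krull_dim_gt0 d0 erefl).2. Qed.

Let d_chain : exists q : ideal A, iprime q /\ pto d q m.
Proof.
have [[q [qp cq]] _] := krull_dim_gt0 d0 erefl.
by exists q; split=> //; apply: (pup_pto mloc) => //; apply: dA; last exact: ile_bot.
Qed.

Let equi q : iprime q -> (forall r, iprime r -> r <=i q -> q <=i r) -> pup d q.
Proof.
move=> qp qmin; have qmin' : minimal_prime (to_spec qp).
  move=> r rq x xq.
  have : q <=i of_idealr r.
    apply: qmin; first exact: spec_prime.
    by rewrite -[q](to_specK qp).
  by apply; rewrite -[q](to_specK qp).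
have [[r [_ qr cr]] _] := quot_krull_gt0 d0 (eqd qmin').
by apply: pup_lel cr; rewrite -[q](to_specK qp).
Qed.

Lemma primary_dimle0 (Q : idealr A) : primary_to mm Q -> of_idealr Q <=i m /\ dimle (of_idealr Q) 0.
Proof.
move=> [_ Qm]; split=> [x Qx|P Pp QP cP]; first by apply/Qm; exists 1%N.
apply: (pup_not_max mloc cP) => x /Qm[n Qn].
by apply: (iprimeX Pp (n := n)); apply: QP.
Qed.

Lemma dimle0_primary Q (Q1 : ~ Q 1) : dimle Q 0 -> Q <=i m -> primary_to mm (to_idealr Q1).
Proof.
move=> dQ Qm; have [N HN] := dimle0_pow noe mloc dQ.
have pm x : m x -> Q (x ^+ N).
  move=> mx; apply: HN; have : ipow m (1 * N) (x ^+ N); last by rewrite mul1n.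
  by apply: ipow_exp; rewrite ipow1.
split=> [x y /asboolP Qxy|x].
  have [my|/(loc_unit mloc)[a ay]] := pselect (m y).
    by right; exists N; apply/asboolP; apply: pm.
  left; apply/asboolP; have -> : x = x * y * a by rewrite -mulrA [y * a]mulrC ay mulr1.
  exact: idMr.
split=> [/pm H|[n /asboolP/Qm H]]; first by exists N; apply/asboolP.
exact: (iprimeX (loc_prime mloc) H).
Qed.

Lemma gamma_hsmult Q (z : nat) : dimle Q 0 -> Q <=i m -> hsmult d Q z%:R ->
  (gamma_inv mm %| z)%N.
Proof.
move=> dQ Qm hz; have Q1 : ~ Q 1 by move/Qm; apply: of_idealr1.
apply: (gcd_setP _).1; exists (to_idealr Q1); first exact: dimle0_primary.
by apply: multiplicity_hsmult; rewrite to_idealrK.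
Qed.

Lemma gamma_ospan b : dimle b d.-1 -> ospan m (fun q => ~ b <=i q) (gamma_inv mm)%:Z.
Proof.
move=> db; apply: (gcd_setP _).2 => [|x y ox oy|_ [Q Qpr <-]].
- exact: ospan_nil.
- by apply: ospanD => //; apply: ospanN.
have [Qm dQ] := primary_dimle0 Qpr; have [N mQ] := dimle0_pow noe mloc dQ.
have [hQ|->] := multiplicity_cases Q; last exact: ospan_nil.
by apply: (hsmult_ospan noe mloc d0 Qm mQ dA db).
Qed.

Lemma gamma_ordz p a : regular_locus p -> curve m (of_idealr p) -> ~ of_idealr p a ->
  exists z1 z2 : nat, [/\ (gamma_inv mm %| z1)%N, (gamma_inv mm %| z2)%N &
    ordz (of_idealr p) a = z1%:Z - z2%:Z].
Proof.
move=> regp cp pa; have [[q [qp cq]] bound] := curve_height mloc d0 dA equi cat cp.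
have [xs [sxs xp px]] := @regular_span A p d.-1 bound (ex_intro _ q (conj qp cq)) regp.
have sd : (size xs).+1 = d by rewrite sxs prednK.
rewrite -sxs in cq.
have [Q1 [Q2 [z1 [z2 [[dQ1 Q1m] [dQ2 Q2m] h1 h2 E]]]]] :=
  ord_difference noe mloc cp dA xp sd px qp cq pa.
by exists z1, z2; split=> //; [apply: gamma_hsmult h1|apply: gamma_hsmult h2].
Qed.

(** The colength of a regular element is a combination of its orders on the components. These have
    their generic points in V, hence in the regular locus, where each order is a difference of
    multiplicities. *)
Lemma gamma_ord_values (V : set (Spec A)) z : V `<=` @regular_locus A ->
  ord_values V z -> ((gamma_inv mm)%:Z %| z)%Z.
Proof.
move=> Vreg [I [/quot_reduced rad dimI gen [L [j [_ [f _ [a' [b' [ra rb _ ->]]]]]]]]].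
have [a aE] := qpi_surj a'; have [b bE] := qpi_surj b'; rewrite {}aE {}bE in ra rb *.
have [_ dI] := quot_krull_gt0 (isT : (0 < 1)%N) dimI.
have [D [uD HD]] := curve_list noe mloc dI.
suff dvd c : regular_element (qpi I c) -> ((gamma_inv mm)%:Z %| (colength (qpi I c))%:Z)%Z.
  by apply: rpredB; apply: dvd.
move=> /quot_regular rc; have nc := regular_avoid_curves noe mloc dI HD rad rc.
rewrite colength_quot (curves_colength noe mloc dI uD HD nc rc).2.
rewrite big_seq; apply: rpred_sum => q qD; apply: dvdz_mulr.
have [cq Iq] := (HD q).1 qD; have [qp _ _] := cq.
rewrite -(to_specK qp) in cq Iq *.
have Vq : V (to_spec qp).
  apply: gen; split=> // r Ir rq.
  have := @curves_min A m mloc (of_idealr I) D dI HD q (of_idealr r) qD (spec_prime r) Ir.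
  by rewrite -{1 2}(to_specK qp) => /(_ rq).
have nqc : ~ of_idealr (to_spec qp) c by rewrite to_specK; apply: nc.
have [z1 [z2 [d1 d2 ->]]] := gamma_ordz (Vreg _ Vq) cq nqc.
by apply: rpredB.
Qed.

(** The subscheme is a union of curves outside V(b): it is reduced as an intersection of primes, and
    every generic point is one of these curves. *)
Lemma ospan_ord_values (U : set (Spec A)) b z : dimle b d.-1 ->
  (forall p, U p <-> ~ b <=i of_idealr p) -> ospan m (fun q => ~ b <=i q) z -> ord_values U z.
Proof.
move=> db HU oz; have [q0 [q0p cq0]] := d_chain.
have [q [cq bq]] := exists_curve noe mloc d0 q0p cq0 dA db.
have [D [a [b' [[uD D0] HD ->]]]] := ospan_curves noe mloc cq bq oz.
have cD r : r \in D -> curve m r by case/HD.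
have [r rD] : exists r, r \in D by case: (D) D0 => // r D' _; exists r; rewrite inE eqxx.
have [rp mr _] := cD r rD.
have I1 : ~ icaps D 1 by move/icapsP/(_ r rD); case: rp.
have ra c : (forall q, q \in D -> ~ q c) -> regular_element (qpi (to_idealr I1) c).
  move=> Dc; apply/quot_regular; rewrite to_idealrK; exact: (icaps_regular cD Dc).
exists (to_idealr I1); split.
- by apply/quot_reduced; rewrite to_idealrK; apply: (icaps_rad cD).
- apply: quot_krull; rewrite to_idealrK; last exact: (icaps_dimle cD).
  exists r; split=> //; first exact: icaps_le.
  exists m; split=> //; first exact: loc_prime mloc.
  by split=> //; apply: (loc_prime_le mloc).
- move=> p [Ip pmin]; have Ip' : icaps D <=i of_idealr p.
    by move=> x Dx; apply: Ip; apply/asboolP.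
  have [s sD sp] := icaps_prime (spec_prime p) Ip'; have [[sP _ _] bs _ _] := HD s sD.
  apply/HU => bp; apply: bs; apply: ile_trans bp _.
  rewrite -[s](to_specK sP); apply: pmin.
    by move=> x /asboolP /= Dx; apply/asboolP; apply: (icaps_le sD).
  by move=> x /asboolP /sp.
have [L [j jloc]] := total_fractions {ideal_quot (to_idealr I1)}.
exists L, j; split=> //; have [ju _ _] := jloc.
have ra1 : regular_element (qpi (to_idealr I1) a) by apply: ra => s /HD[].
have rb1 : regular_element (qpi (to_idealr I1) b') by apply: ra => s /HD[].
exists (j (qpi (to_idealr I1) a) / j (qpi (to_idealr I1) b')).
  by rewrite unitrM ju// unitrV ju.
exists (qpi (to_idealr I1) a), (qpi (to_idealr I1) b'); split=> //.
by rewrite !colength_quot to_idealrK.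
Qed.

Lemma n_inv_gamma_inv (V : set (Spec A)) : open V -> dense V -> V `<=` @regular_locus A ->
  n_inv A = gamma_inv mm.
Proof.
move=> oV dV Vreg; have [b [HV db]] := open_ideal noe d0 dA oV dV.
have E : \bigcap_(U in [set U : set (Spec A) | open U /\ dense U]) ord_values U =
    [set z | ((gamma_inv mm)%:Z %| z)%Z].
  apply/seteqP; split=> z /= Hz.
    by apply: (gamma_ord_values Vreg); apply: Hz.
  move=> U [oU dU]; have [b' [HU db']] := open_ideal noe d0 dA oU dU.
  apply: (ospan_ord_values db' HU).
  have /dvdzP[k ->] := Hz; rewrite mulrC; apply: ospanM; exact: gamma_ospan.
(* [n_inv] requires a positive generator. On a curve with generic point in V, an element of m
   outside the curve has positive order, yet that order is a difference of multiples of
   [gamma_inv mm]. *)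
have g0 : (0 < gamma_inv mm)%N.
  have [q0 [q0p cq0]] := d_chain.
  have [q [cq bq]] := exists_curve noe mloc d0 q0p cq0 dA db; have [qp mq _] := cq.
  have [a /not_implyP[ma qa]] := (existsNP _).2 mq.
  rewrite -(to_specK qp) in cq qa bq.
  have [z1 [z2 [d1 d2 zE]]] := gamma_ordz (Vreg _ ((HV _).2 bq)) cq qa.
  rewrite lt0n; apply/eqP => g0; move: d1 d2 zE; rewrite g0 !dvd0n => /eqP-> /eqP->.
  rewrite subrr => -[/eqP]; rewrite -leqn0 leqNgt => /negP; apply.
  apply: (len_gt0 (sone_mulset A) mloc); first by apply: curve_fin cq qa.
  apply: ile_add; last exact: imul_top_le.
  by apply: (loc_prime_le mloc); case: cq.
apply: xget_unique => [|n [n0 nE]]; first by split.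
have H z : (n%:Z %| z)%Z = ((gamma_inv mm)%:Z %| z)%Z.
  by apply/idP/idP => h; move: nE; rewrite E => /seteqP[s1 s2]; [apply: s2|apply: s1].
apply/eqP; rewrite eqn_dvd; apply/andP; split.
  by have := H (gamma_inv mm)%:Z; rewrite dvdzz.
by have := H n%:Z; rewrite dvdzz => /esym.
Qed.

End Main.

Theorem theorem5p6 (A : comNzRingType) (m : idealr A) :
  noetherian A -> local_ring m -> equidimensional A -> (0 < krull_dim A)%N ->
  catenary A ->
  (exists V : set (Spec A), [/\ open V, dense V & V `<=` @regular_locus A]) ->
  n_inv A = gamma_inv m.
Proof.
move=> noeA locm eqd d0 cat [V [oV dV Vreg]].
exact: (n_inv_gamma_inv noeA locm eqd d0 cat oV dV Vreg).
Qed.
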